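(* Let $\boldsymbol{k}\in\mathbb{Z}_+^m$ be a partition of $n$ and $\mathbb{T}^m\subset \mathrm{U}(n)$ the corresponding subgroup. For every $\lambda > -1$, the isotypic decomposition of the restriction $\pi_\lambda|_{\mathbb{T}^m}$ is given by the Hilbert direct sum \[ \mathcal{A}^2_\lambda(\mathbb{B}^n) = \bigoplus_{\boldsymbol{\kappa} \in \mathbb{N}^m} \mathcal{P}_{\boldsymbol{\kappa}}(\mathbb{C}^n). \]
   Context: Here $\mathbb{N}=\{0,1,2,\dots\}$ and $\mathbb{Z}_+$ is the set of positive integers. $\mathbb{B}^n$ is the open unit ball of $\mathbb{C}^n$ with Lebesgue measure $v$. For $\lambda>-1$, $dv_\lambda(z) = c_\lambda (1-|z|^2)^\lambda dv(z)$ with $c_\lambda = \frac{\Gamma(n+\lambda+1)}{\pi^n\Gamma(\lambda+1)}$, and $\mathcal{A}^2_\lambda(\mathbb{B}^n)$ is the closed subspace of holomorphic functions in $L^2(\mathbb{B}^n,v_\lambda)$. $\pi_\lambda$ is the unitary representation of the unitary group $\mathrm{U}(n)$ on $\mathcal{A}^2_\lambda(\mathbb{B}^n)$ given by $\pi_\lambda(A)f=f\circ A^{-1}$. A partition of $n$ is $\boldsymbol{k}=(k_1,\dots,k_m)\in\mathbb{Z}_+^m$ with $k_1+\dots+k_m=n$. It gives $\mathbb{C}^n=\mathbb{C}^{k_1}\times\dots\times\mathbb{C}^{k_m}$, $z=(z_{(1)},\dots,z_{(m)})$ and, for multi-indices, $\alpha=(\alpha_{(1)},\dots,\alpha_{(m)})\in\mathbb{N}^n$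 with $\alpha_{(j)}\in\mathbb{N}^{k_j}$. $\mathbb{T}^m=\{(t_1I_{(1)},\dots,t_mI_{(m)}) : t_j\in\mathbb{T}\}\subset \mathrm{U}(n)$, where $I_{(j)}$ is the identity on $\mathbb{C}^{k_j}$. For $\boldsymbol{\kappa}\in\mathbb{N}^m$, $\mathcal{P}_{\boldsymbol{\kappa}}(\mathbb{C}^n)$ is the linear span of the monomials $z^\alpha$ with $|\alpha_{(j)}|=\kappa_j$ for all $j$, considered as a subspace of $\mathcal{A}^2_\lambda(\mathbb{B}^n)$. For a closed subgroup $H\subset \mathrm{U}(n)$ and an irreducible $H$-module $V$, the isotypic component of $\pi_\lambda|_H$ associated to $V$ is the sum of all $H$-submodules of $\mathcal{A}^2_\lambda(\mathbb{B}^n)$ isomorphic to $V$; the isotypic decomposition of $\pi_\lambda|_H$ is the Hilbert direct sum decomposition of $\mathcal{A}^2_\lambda(\mathbb{B}^n)$ into its (nonzero) isotypic components. *)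

(* Defs.v *)
From HB Require Import structures.
From mathcomp Require Import all_boot all_order all_algebra.
From mathcomp Require Import sesquilinear complex.
From mathcomp Require Import all_classical all_reals all_analysis.

Set Implicit Arguments.
Unset Strict Implicit.
Unset Printing Implicit Defensive.

Import Order.TTheory GRing.Theory Num.Theory.
Import numFieldNormedType.Exports Normc.

Local Open Scope classical_set_scope.
Local Open Scope ring_scope.

Section PowerMeasure.
Context {R : realType} d (T : measurableType d).
Variable mu : {sigma_finite_measure set T -> \bar R}.

(* unification cannot find this instance of \x: the one for subprobabilities
   shadows it *)
Lemma product_sigma_finite d' (T' : measurableType d')
    (nu : {sigma_finite_measure set T' -> \bar R}) :
  sigma_finite setT (mu \x nu)%E.
Proof.
pose ax := lebesgue_integral_fubini.measure_function_Measure_isSigmaFinite__to__measure_function_isSigmaFinite.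
exact: isSigmaFinite.sigma_finiteT (ax _ _ _ _ _ mu nu).
Qed.

Definition cons_pair n (p : T * n.-tuple T) : n.+1.-tuple T :=
  [the n.+1.-tuple T of p.1 :: p.2].

Lemma measurable_cons_pair n : measurable_fun setT (@cons_pair n).
Proof. exact: measurable_cons. Qed.

Section Step.
Variables (n : nat) (nu : {sigma_finite_measure set (n.-tuple T) -> \bar R}).

(* A |-> (mu \x nu) {(x, t) | x :: t \in A} *)
Definition power_step : set (n.+1.-tuple T) -> \bar R :=
  pushforward (mu \x nu)%E (@cons_pair n).

HB.instance Definition _ := Measure.copy power_step
  (measure_function_pushforward__canonical__measure_function_Measure
     (mu \x nu)%E (@measurable_cons_pair n)).

Lemma power_step_sigma_finite : sigma_finite setT power_step.
Proof.
have [F FT Ffin] := product_sigma_finite nu.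
pose u (t : n.+1.-tuple T) : T * n.-tuple T :=
  (tnth t ord0, [tuple of behead t]).
have meas_u : measurable_fun setT u.
  exact: measurable_fun_pair (@measurable_tnth _ T _ ord0)
                             (@measurable_behead _ T n).
have uK p : u (cons_pair p) = p.
  by case: p => a t; congr pair; exact/val_inj.
exists (fun i => u @^-1` F i).
  by rewrite -preimage_bigcup -FT preimage_setT.
move=> i; have [mF Foo] := Ffin i; split.
  by rewrite -[X in measurable X]setTI; exact: meas_u.
rewrite /power_step /pushforward -comp_preimage.
by rewrite (_ : u \o _ = id); last exact/funext.
Qed.

HB.instance Definition _ :=
  Measure_isSigmaFinite.Build _ _ _ power_step power_step_sigma_finite.

End Step.

Fixpoint power_measure (n : nat) :
    {sigma_finite_measure set (n.-tuple T) -> \bar R} :=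
  match n with
  | 0 => \d_([tuple] : 0.-tuple T)
  | n'.+1 => power_step (power_measure n')
  end.

End PowerMeasure.

Section LebesgueCn.
Variable R : realType.

Definition RR : Type := (measurableTypeR R * measurableTypeR R)%type.
HB.instance Definition _ := Measurable.on RR.

(* Lebesgue measure on C = R * R *)
Definition area : set RR -> \bar R :=
  (@lebesgue_measure R \x @lebesgue_measure R)%E.
HB.instance Definition _ := Measure.copy area
  (lebesgue_integral_fubini_product_measure1__canonical__measure_function_Measure
     (@lebesgue_measure R) (@lebesgue_measure R)).
HB.instance Definition _ :=
  Measure_isSigmaFinite.Build _ _ _ area (product_sigma_finite _ _).

Definition lebesgue_Cn (n : nat) :
  {sigma_finite_measure set (n.-tuple RR) -> \bar R} := power_measure area n.

(* (x_i, y_i)_i |-> (x_i + i y_i)_i *)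
Definition Cn_of n (x : n.-tuple RR) : 'cV[R[i]]_n :=
  \col_i Complex (tnth x i).1 (tnth x i).2.

End LebesgueCn.

HB.instance Definition _ (R : rcfType) := NormedModule.copy R[i] R[i]^o.

Section Bergman.
Variables (R : realType) (n : nat).

Notation C := R[i].
Notation Cn := 'cV[C]_n.

(* All functions below live on the whole of C^n; a function on the ball is
   represented by its extension by zero. *)
Notation Fun := (Cn -> C^o).

Definition Gamma (x : R) : R :=
  \int[lebesgue_measure]_(t in `]0, +oo[) (t `^ (x - 1) * expR (- t)).

Definition sqnorm (z : Cn) : R := \sum_i normc (z i 0) ^+ 2.

Definition Bn : set Cn := [set z | sqnorm z < 1].

(* the ball in real coordinates, where Lebesgue measure is defined *)
Definition Bnr : set (n.-tuple (RR R)) := @Cn_of R n @^-1` Bn.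

Definition c_ (lambda : R) : R :=
  Gamma (n%:R + lambda + 1) / (pi ^+ n * Gamma (lambda + 1)).

(* density of dv_lambda with respect to dv *)
Definition density (lambda : R) (z : Cn) : R :=
  c_ lambda * (1 - sqnorm z) `^ lambda.

Definition holomorphic (f : Fun) : Prop := forall z, Bn z -> differentiable f z.

Definition sqint (lambda : R) (f : Fun) : \bar R :=
  (\int[lebesgue_Cn R n]_(x in Bnr)
     (normc (f (Cn_of x)) ^+ 2 * density lambda (Cn_of x))%:E)%E.

Definition L2 (lambda : R) : set Fun :=
  [set f | [/\ measurable_fun Bnr (fun x => complex.Re (f (Cn_of x)) : R),
               measurable_fun Bnr (fun x => complex.Im (f (Cn_of x)) : R) &
               (sqint lambda f < +oo)%E]].

Definition A2 (lambda : R) : set Fun :=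
  [set f | [/\ holomorphic f, L2 lambda f & forall z, ~ Bn z -> f z = 0]].

Definition A2norm (lambda : R) (f : Fun) : R :=
  Num.sqrt (fine (sqint lambda f)).

Definition A2dot (lambda : R) (f g : Fun) : C :=
  let h x := f (Cn_of x) * (g (Cn_of x))^* in
  Complex
    (\int[lebesgue_Cn R n]_(x in Bnr)
       (complex.Re (h x) * density lambda (Cn_of x)))
    (\int[lebesgue_Cn R n]_(x in Bnr)
       (complex.Im (h x) * density lambda (Cn_of x))).

Definition pi_ (A : 'M[C]_n) (f : Fun) : Fun := fun z => f (invmx A *m z).

End Bergman.

Arguments Bn {R n}.
Arguments pi_ {R n}.
Arguments A2 {R n}.

Section LinearSubspaces.
Variables (K : pzRingType) (V : lmodType K).

Definition lin_subspace (E : set V) : Prop :=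
  E 0 /\ forall (a : K) u v, E u -> E v -> E (a *: u + v).

Definition lin_span (E : set V) : set V :=
  [set v | exists (r : nat) (a : 'I_r -> K) (u : 'I_r -> V),
     (forall i, E (u i)) /\ v = \sum_i a i *: u i].

End LinearSubspaces.

Section Isotypic.
Variables (R : realType) (n : nat) (lambda : R).

Notation C := R[i].
Notation Cn := 'cV[C]_n.
Notation Fun := (Cn -> C^o).
Notation A2 := (A2 lambda).
Notation A2norm := (A2norm lambda).

(* In the definitions below H is meant to be a closed subgroup of U(n). *)
Variable H : set 'M[C]_n.

(* A complex Hilbert space with a strongly continuous unitary action of H;
   values of hact outside H are irrelevant. *)
Record hmodule := HModule {
  hsort :> completeNormedModType C;
  hdot : {dot hsort for Num.conj};
  hdotE : forall v : hsort, `|v| ^+ 2 = hdot v v;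
  hact : 'M[C]_n -> hsort -> hsort;
  hact_linear : forall A, H A -> linear (hact A);
  hact1 : forall v, hact 1%:M v = v;
  hactM : forall A B v, H A -> H B -> hact (A *m B) v = hact A (hact B v);
  hact_unitary : forall A u v, H A -> hdot (hact A u) (hact A v) = hdot u v;
  hact_cont : forall v, {within H, continuous (fun A => hact A v)}
}.

Definition irreducible_hmodule (V : hmodule) : Prop :=
  (exists v : V, v != 0) /\
  forall E : set V, lin_subspace E -> closed E ->
    (forall A v, H A -> E v -> E (hact A v)) -> E = [set 0] \/ E = setT.

Definition closed_in_A2 (W : set Fun) : Prop :=
  forall f, A2 f ->
    (forall e : R, 0 < e -> exists2 g, W g & A2norm (f - g) < e) -> W f.

Definition submodule (W : set Fun) : Prop :=
  [/\ lin_subspace W, W `<=` A2, closed_in_A2 W &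
      forall A f, H A -> W f -> W (pi_ A f)].

(* equivariant linear homeomorphism from V onto W, for the norm of A2 *)
Definition isomorphic (V : hmodule) (W : set Fun) : Prop :=
  exists phi : {linear V -> Fun},
    [/\ injective phi, range phi = W,
        forall A v, H A -> phi (hact A v) = pi_ A (phi v) &
        exists a b : R, [/\ 0 < a, 0 < b &
          forall v, a%:C%C * `|v| <= (A2norm (phi v))%:C%C <= b%:C%C * `|v| ]].

(* The sum is algebraic: irreducible modules of a compact group being
   finite-dimensional, it is already closed. *)
Definition isotypic (V : hmodule) : set Fun :=
  lin_span (\bigcup_(W in [set W | submodule W /\ isomorphic V W]) W).

Definition hilbert_direct_sum (I : Type) (M : I -> set Fun) : Prop :=
  [/\ forall i, [/\ lin_subspace (M i), M i `<=` A2 & closed_in_A2 (M i)],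
      forall i j, i <> j ->
        forall f g, M i f -> M j g -> A2dot lambda f g = 0 &
      forall f, A2 f -> forall e : R, 0 < e ->
        exists2 g, lin_span (\bigcup_i M i) g & A2norm (f - g) < e].

Definition isotypic_decomposition (I : Type) (M : I -> set Fun) : Prop :=
  [/\ hilbert_direct_sum M,
      forall i, M i <> [set 0] /\
        exists2 V : hmodule, irreducible_hmodule V & M i = isotypic V &
      forall V : hmodule, irreducible_hmodule V -> isotypic V <> [set 0] ->
        exists! i, M i = isotypic V].

End Isotypic.

Section Partition.
Variables (R : realType) (m : nat) (k : 'I_m -> nat).

Notation C := R[i].
(* the integer n of which k is a partition *)
Notation n := (\sum_(j < m) k j)%N.

Definition torus : set 'M[C]_n :=
  [set A | exists2 t : 'I_m -> C, (forall j, `|t j| = 1) &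
                                  A = \mxdiag_(j < m) (t j)%:M].

Definition monomial (alpha : 'cV[nat]_n) : 'cV[C]_n -> C^o :=
  (fun z => \prod_i z i 0 ^+ alpha i 0) \_ Bn.

Definition block_degree (alpha : 'cV[nat]_n) (j : 'I_m) : nat :=
  (\sum_(l < k j) submxcol alpha j l ord0)%N.

Definition calP (kappa : {ffun 'I_m -> nat}) : set ('cV[C]_n -> C^o) :=
  lin_span [set monomial alpha | alpha in
          [set alpha | forall j, block_degree alpha j = kappa j]].

End Partition.

Arguments torus R {m} k.
Arguments calP R {m} k.

(* Main.v *)
(* The monomials z^alpha, cut off outside the ball, are orthogonal, because
   rotating one coordinate is unitary and multiplies them by different powers;
   T^m acts on each of them by a character that depends only on the degrees in
   the blocks.  They are complete in A^2_lambda.  Fix a coordinate i.  By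
   Goursat and Cauchy in the variable z_i, the averages of f over the rotations
   of z_i by M-th roots of unity, twisted by a character, converge as M tends to
   infinity to the part of f of degree k in z_i; for each M the averages are
   orthogonal with sum f.  By Fatou the sum of the parts of degree < D has norm
   at most that of f, and so does their limit, which gives convergence in norm.
   Doing this for one coordinate after another leaves functions homogeneous in
   each coordinate, that is, multiples of monomials.
   Given completeness, P_kappa is exactly the space of the f on which T^m acts by
   one character, and it is closed because it is the orthogonal complement of the
   other monomials.  If V is irreducible and phi embeds it in A^2_lambda, some
   functional v |-> <phi v, z^alpha> is nonzero; its kernel is closed and
   invariant, hence 0, so V is a line on which T^m acts by the character of
   P_kappa, where kappa is the block degree of alpha. *)

Require Import Defs.
From HB Require Import structures.
From mathcomp Require Import all_boot all_order all_algebra.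
From mathcomp Require Import sesquilinear complex.
From mathcomp Require Import all_classical all_reals all_analysis.
From mathcomp Require Import measurable_realfun.
From mathcomp Require Import ring lra.

Set Implicit Arguments.
Unset Strict Implicit.
Unset Printing Implicit Defensive.

Import Order.TTheory GRing.Theory Num.Theory.
Import numFieldNormedType.Exports Normc.

Local Open Scope classical_set_scope.
Local Open Scope ring_scope.

(** Root-of-unity averages take the place of Fourier integrals: as finite sums of rotated copies of
    f they stay in L^2, their orthogonality is exact algebra, and no integral over a circle has to
    be exchanged with one over the ball. The price is that holomorphy of their limits is not at hand
    when the next coordinate is treated, so quantitative estimates ([good]) are carried along
    instead. Goursat is applied to f(e^(s + it)): a rectangle in (s, t) is an annulus, and only
    means over circles ever occur. For -1 < lambda < 0 the density is unbounded near the sphere, so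
    the finiteness of v_lambda is computed, one real coordinate at a time. Norms and real integrals
    are [fine] values, which turn an infinite integral into 0; finiteness is therefore also what the
    positivity of c_lambda rests on, through the convergence of Gamma. An irreducible V is an
    arbitrary Hilbert module, of unknown dimension; the kernel of a single functional does the work
    of Schur's lemma. Since [pi_] composes with the inverse, T^m acts on P_kappa by t^(-kappa), not
    t^kappa. *)

Section ComplexModulus.
Variable R : realType.
Implicit Types z w : R[i].

Lemma normc_sqrt z : normc z = Num.sqrt (complex.Re z ^+ 2 + complex.Im z ^+ 2).
Proof. by case: z. Qed.

Lemma normc_sqr z : normc z ^+ 2 = complex.Re z ^+ 2 + complex.Im z ^+ 2.
Proof. by rewrite normc_sqrt sqr_sqrtr// addr_ge0 ?sqr_ge0. Qed.

Lemma normc_ge0 z : 0 <= normc z.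
Proof. by rewrite normc_sqrt sqrtr_ge0. Qed.

Lemma normcD z w : normc (z + w) <= normc z + normc w.
Proof. exact: le_normcD. Qed.

Lemma normc_opp z : normc (- z) = normc z.
Proof. exact: normcN. Qed.

Lemma normcB z w : normc (z - w) <= normc z + normc w.
Proof. by rewrite -(normc_opp w); exact: normcD. Qed.

Lemma normc_distrC z w : normc (z - w) = normc (w - z).
Proof. by rewrite -normc_opp opprB. Qed.

Lemma normcX z k : normc (z ^+ k) = normc z ^+ k.
Proof. by elim: k => [|k IH]; rewrite ?expr0 ?normc1// !exprS normcM IH. Qed.

Lemma normc_eq0 z : (normc z == 0) = (z == 0).
Proof. by apply/eqP/eqP => [/eq0_normc//|->]; exact: normc0. Qed.

Lemma normc_gt0 z : (0 < normc z) = (z != 0).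
Proof. by rewrite lt_def normc_ge0 normc_eq0 andbT. Qed.

Lemma normc_real (x : R) : normc x%:C%C = `|x|.
Proof. by rewrite normc_sqrt /= expr0n addr0 sqrtr_sqr. Qed.

Lemma normc_i : normc (Complex 0 1 : R[i]) = 1.
Proof. by rewrite normc_sqrt /= expr0n add0r expr1n sqrtr1. Qed.

Lemma normc_sum (I : Type) (r : seq I) (P : pred I) (F : I -> R[i]) :
  normc (\sum_(i <- r | P i) F i) <= \sum_(i <- r | P i) normc (F i).
Proof.
elim/big_ind2: _ => [|z a w b za wb|//]; first by rewrite normc0.
by apply: le_trans (normcD _ _) _; exact: lerD.
Qed.

Lemma cReD z w : complex.Re (z + w) = complex.Re z + complex.Re w.
Proof. by case: z; case: w. Qed.

Lemma cImD z w : complex.Im (z + w) = complex.Im z + complex.Im w.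
Proof. by case: z; case: w. Qed.

Lemma cReN z : complex.Re (- z) = - complex.Re z. Proof. by case: z. Qed.
Lemma cImN z : complex.Im (- z) = - complex.Im z. Proof. by case: z. Qed.

Lemma cReM z w : complex.Re (z * w) =
  complex.Re z * complex.Re w - complex.Im z * complex.Im w.
Proof. by case: z; case: w. Qed.

Lemma cImM z w : complex.Im (z * w) =
  complex.Re z * complex.Im w + complex.Im z * complex.Re w.
Proof. by case: z; case: w. Qed.

Lemma normc_Re z : `|complex.Re z| <= normc z.
Proof.
by rewrite normc_sqrt -sqrtr_sqr ler_wsqrtr// lerDl sqr_ge0.
Qed.

Lemma normc_Im z : `|complex.Im z| <= normc z.
Proof.
by rewrite normc_sqrt -sqrtr_sqr ler_wsqrtr// lerDr sqr_ge0.
Qed.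

Lemma normc_le_ReIm z : normc z <= `|complex.Re z| + `|complex.Im z|.
Proof.
rewrite normc_sqrt -[leRHS]ger0_norm ?addr_ge0// -sqrtr_sqr ler_wsqrtr//.
by rewrite sqrrD !real_normK ?num_real// lerD2r lerDl mulrn_wge0// mulr_ge0.
Qed.

Lemma complex_eq z w :
  complex.Re z = complex.Re w -> complex.Im z = complex.Im w -> z = w.
Proof. by case: z; case: w => ? ? ? ? /= -> ->. Qed.

Lemma eq_normcB z w : (forall e : R, 0 < e -> normc (z - w) <= e) -> z = w.
Proof.
move=> h; apply/eqP; rewrite -subr_eq0 -normc_eq0 eq_le normc_ge0 andbT.
by apply/ler_addgt0Pl => e /h; rewrite addr0.
Qed.

End ComplexModulus.

(** * Cauchy's theorem and power series *)

Section ComplexIntegral.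
Variable R : realType.
Notation C := R[i].
Notation mu := (@lebesgue_measure R).
Implicit Types (F G : R -> C) (a b x : R).

(** Stated with a real epsilon and the real modulus [normc], because the norm of R[i] takes its
    values in R[i]. *)
Definition ccont F x : Prop := forall e : R, 0 < e ->
  exists2 d : R, 0 < d & forall y, `|y - x| < d -> normc (F y - F x) <= e.

Definition ccont_itv F a b : Prop := forall x, a <= x <= b -> ccont F x.

Definition cint a b F : C :=
  Complex (\int[mu]_(x in `[a, b]) complex.Re (F x))
          (\int[mu]_(x in `[a, b]) complex.Im (F x)).

Lemma ccont_Re F x : ccont F x -> {for x, continuous (fun y => complex.Re (F y))}.
Proof.
move=> h; apply/cvgrPdist_le => e /h[d d0 hd]; near=> y.
rewrite -cReN -cReD; apply: le_trans (normc_Re _) _; rewrite normc_distrC; apply: hd.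
near: y; apply: filterS (@nbhsx_ballx _ _ x d d0) => y.
by rewrite /ball /= distrC.
Unshelve. all: by end_near. Qed.

Lemma ccont_Im F x : ccont F x -> {for x, continuous (fun y => complex.Im (F y))}.
Proof.
move=> h; apply/cvgrPdist_le => e /h[d d0 hd]; near=> y.
rewrite -cImN -cImD; apply: le_trans (normc_Im _) _; rewrite normc_distrC; apply: hd.
near: y; apply: filterS (@nbhsx_ballx _ _ x d d0) => y.
by rewrite /ball /= distrC.
Unshelve. all: by end_near. Qed.

Lemma cts_integrable (f : R -> R) a b :
  (forall x, a <= x <= b -> {for x, continuous f}) ->
  mu.-integrable `[a, b] (EFin \o f).
Proof.
move=> h; apply: continuous_compact_integrable; first exact: segment_compact.
apply: continuous_in_subspaceT => x; rewrite inE /= in_itv /= => /h; exact.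
Qed.

Lemma integrable_Re F a b : ccont_itv F a b ->
  mu.-integrable `[a, b] (EFin \o (fun x => complex.Re (F x))).
Proof. by move=> h; apply: cts_integrable => x /h; exact: ccont_Re. Qed.

Lemma integrable_Im F a b : ccont_itv F a b ->
  mu.-integrable `[a, b] (EFin \o (fun x => complex.Im (F x))).
Proof. by move=> h; apply: cts_integrable => x /h; exact: ccont_Im. Qed.

Lemma eq_cint F G a b : (forall x, a <= x <= b -> F x = G x) ->
  cint a b F = cint a b G.
Proof.
by move=> FG; congr Complex; apply: eq_Rintegral => x; rewrite inE /= in_itv /= => /FG ->.
Qed.

Lemma cintB F G a b : ccont_itv F a b -> ccont_itv G a b ->
  cint a b (fun x => F x - G x) = cint a b F - cint a b G.
Proof.
move=> cF cG; apply: complex_eq.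
  rewrite cReD cReN /= -RintegralB//; try exact: integrable_Re.
  by apply: eq_Rintegral => x _; rewrite cReD cReN.
rewrite cImD cImN /= -RintegralB//; try exact: integrable_Im.
by apply: eq_Rintegral => x _; rewrite cImD cImN.
Qed.

Lemma cintD F G a b : ccont_itv F a b -> ccont_itv G a b ->
  cint a b (fun x => F x + G x) = cint a b F + cint a b G.
Proof.
move=> cF cG; apply: complex_eq.
  rewrite cReD /= -RintegralD//; try exact: integrable_Re.
  by apply: eq_Rintegral => x _; rewrite cReD.
rewrite cImD /= -RintegralD//; try exact: integrable_Im.
by apply: eq_Rintegral => x _; rewrite cImD.
Qed.

Lemma cintZ (c : C) F a b : ccont_itv F a b ->
  cint a b (fun x => c * F x) = c * cint a b F.
Proof.
move=> cF; have iR := integrable_Re cF; have iI := integrable_Im cF.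
have iZ (r : R) (f : R -> R) : mu.-integrable `[a, b] (EFin \o f) ->
  mu.-integrable `[a, b] (EFin \o (fun x => r * f x)).
  move=> h; rewrite (_ : _ \o _ = (fun x => r%:E * (EFin \o f) x)%E); last first.
    by apply/funext => x /=; rewrite EFinM.
  exact: integrableZl.
apply: complex_eq.
  rewrite cReM /= -!RintegralZl// -RintegralB//; try exact: iZ.
  by apply: eq_Rintegral => x _; rewrite cReM.
rewrite cImM /= -!RintegralZl// -RintegralD//; try exact: iZ.
by apply: eq_Rintegral => x _; rewrite cImM.
Qed.

Lemma cint_cst (c : C) a b : a <= b -> cint a b (fun=> c) = (b - a)%:C%C * c.
Proof.
move=> ab; apply: complex_eq; rewrite ?cReM ?cImM /= Rintegral_cst//=;
  rewrite lebesgue_measure_itv /= lte_fin; case: ltgtP ab => //= [ab _|-> _];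
  rewrite /=; ring.
Qed.

Lemma Rintegral_split (f : R -> R) a b x : a <= x <= b ->
  mu.-integrable `[a, b] (EFin \o f) ->
  \int[mu]_(t in `[a, b]) f t =
  \int[mu]_(t in `[a, x]) f t + \int[mu]_(t in `[x, b]) f t.
Proof.
move=> /andP[ax xb] intf; apply/eqP; rewrite addrC -subr_eq; apply/eqP.
rewrite Rintegral_itvB//=.
rewrite Rintegral_itv_obnd_cbnd//.
apply: integrableS intf => //; apply: subset_itv => //; by rewrite bnd_simp.
Qed.

Lemma cint_split F a b x : a <= x <= b -> ccont_itv F a b ->
  cint a b F = cint a x F + cint x b F.
Proof.
move=> axb cF; apply: complex_eq.
  by rewrite cReD /=; apply: Rintegral_split => //; exact: integrable_Re.
by rewrite cImD /=; apply: Rintegral_split => //; exact: integrable_Im.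
Qed.

Lemma Rintegral_bound (f : R -> R) a b M : a <= b ->
  mu.-integrable `[a, b] (EFin \o f) ->
  (forall x, a <= x <= b -> `|f x| <= M) ->
  `|\int[mu]_(t in `[a, b]) f t| <= M * (b - a).
Proof.
move=> ab intf fM; apply: le_trans (le_normr_Rintegral _ _) _ => //.
have -> : M * (b - a) = \int[mu]_(t in `[a, b]) (cst M t).
  rewrite Rintegral_cst//= lebesgue_measure_itv /= lte_fin.
  by case: ltgtP ab => //= -> _; rewrite subrr.
apply: le_Rintegral => //.
- exact: integrable_norm.
- apply: cts_integrable => x _; exact: cst_continuous.
Qed.

(** The factor 2 comes from bounding the real and the imaginary part separately; all later estimates
    are up to constants. *)
Lemma normc_cint F a b M : a <= b -> ccont_itv F a b ->
  (forall x, a <= x <= b -> normc (F x) <= M) ->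
  normc (cint a b F) <= 2 * M * (b - a).
Proof.
move=> ab cF FM; apply: le_trans (normc_le_ReIm _) _ => /=.
rewrite mulrDl mul1r mulrDl; apply: lerD; apply: Rintegral_bound => //.
- exact: integrable_Re.
- by move=> x /FM; apply: le_trans; exact: normc_Re.
- exact: integrable_Im.
- by move=> x /FM; apply: le_trans; exact: normc_Im.
Qed.

End ComplexIntegral.

(** * Bisection of rectangles *)

Section Cousin.
Variable R : realType.
Implicit Types (P : R -> R -> R -> R -> Prop) (a b c d x y : R).

Lemma halving_lt (L e : R) : 0 < e -> exists n, L / 2 ^+ n < e.
Proof.
move=> e0; exists (Num.bound (L / e)).
by rewrite ltr_pdivrMr ?exprn_gt0// mulrC -ltr_pdivrMr//; exact: upper_nthrootP.
Qed.

Lemma bisection_step P a b c d : a <= b -> c <= d ->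
  (forall a b c d, a <= b -> c <= d ->
     P a ((a + b) / 2) c ((c + d) / 2) -> P ((a + b) / 2) b c ((c + d) / 2) ->
     P a ((a + b) / 2) ((c + d) / 2) d -> P ((a + b) / 2) b ((c + d) / 2) d ->
     P a b c d) ->
  ~ P a b c d -> exists a' b' c' d',
  [/\ ~ P a' b' c' d', a <= a' <= b' /\ b' <= b, c <= c' <= d' /\ d' <= d,
      b' - a' = (b - a) / 2 & d' - c' = (d - c) / 2].
Proof.
move=> ab cd hP nP; apply: contrapT => H; apply: nP.
have Q a' b' c' d' : a <= a' <= b' /\ b' <= b -> c <= c' <= d' /\ d' <= d ->
    b' - a' = (b - a) / 2 -> d' - c' = (d - c) / 2 -> P a' b' c' d'.
  move=> h1 h2 h3 h4; apply: contrapT => nP; apply: H.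
  by exists a', b', c', d'.
by apply: hP => //; apply: Q; try lra; split; try apply/andP; try split; lra.
Qed.

(** If P failed on the whole rectangle, repeated quartering would give nested rectangles on which it
    fails, shrinking to a point, against the local hypothesis there. This is the compactness
    argument of both Goursat's theorem and [circ_cts]. *)
Lemma cousin P a0 b0 c0 d0 : a0 <= b0 -> c0 <= d0 ->
  (forall a b c d, a <= b -> c <= d ->
     P a ((a + b) / 2) c ((c + d) / 2) -> P ((a + b) / 2) b c ((c + d) / 2) ->
     P a ((a + b) / 2) ((c + d) / 2) d -> P ((a + b) / 2) b ((c + d) / 2) d ->
     P a b c d) ->
  (forall x y, a0 <= x <= b0 -> c0 <= y <= d0 -> exists2 e : R, 0 < e &
     forall a b c d, a0 <= a -> a <= x <= b -> b <= b0 ->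
       c0 <= c -> c <= y <= d -> d <= d0 -> b - a < e -> d - c < e ->
     P a b c d) ->
  P a0 b0 c0 d0.
Proof.
move=> ab cd hP hloc; apply: contrapT => nP0.
pose V (q : R * R * R * R) := let: (a, b, c, d) := q in
  [/\ a <= b, c <= d & ~ P a b c d].
pose S (q q' : R * R * R * R) := let: (a, b, c, d) := q in
  let: (a', b', c', d') := q' in
  [/\ a <= a', b' <= b, c <= c', d' <= d & b' - a' = (b - a) / 2 /\ d' - c' = (d - c) / 2].
(* The condition [V q] stands inside the existential so that the step f is a total function and can
   be iterated. *)
have /choice[f fP] : forall q, exists q', V q -> V q' /\ S q q'.
  case=> [[[a b] c] d]; have [[ab' cd' nP]|nV] := pselect (V (a, b, c, d)); last first.
    by exists (a, b, c, d).
  have [a' [b' [c' [d' [nP' [/andP[? ?] ?] [/andP[? ?] ?] h1 h2]]]]] :=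
    bisection_step ab' cd' hP nP.
  by exists (a', b', c', d') => _; split.
pose u n := iter n f (a0, b0, c0, d0).
have Vu n : V (u n) by elim: n => [|n /fP[]].
have Su n : S (u n) (u n.+1) by case: (fP _ (Vu n)).
pose A n := (u n).1.1.1; pose B n := (u n).1.1.2.
pose E n := (u n).1.2; pose D n := (u n).2.
have uE n : u n = (A n, B n, E n, D n).
  by rewrite /A /B /E /D; case: (u n) => [[[]]].
have VA n : [/\ A n <= B n, E n <= D n & ~ P (A n) (B n) (E n) (D n)].
  by have := Vu n; rewrite uE.
have SA n : [/\ A n <= A n.+1, B n.+1 <= B n, E n <= E n.+1, D n.+1 <= D n &
     B n.+1 - A n.+1 = (B n - A n) / 2 /\ D n.+1 - E n.+1 = (D n - E n) / 2].
  by have := Su n; rewrite !uE.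
have mono n k : [/\ A n <= A (n + k)%N, B (n + k)%N <= B n, E n <= E (n + k)%N & D (n + k)%N <= D n].
  elim: k => [|k [h1 h2 h3 h4]]; first by rewrite addn0.
  by rewrite addnS; have [g1 g2 g3 g4 _] := SA (n + k)%N; split; lra.
have AB n k : A n <= B k.
  have [h1 _ _ _] := mono n k; have [_ h2 _ _] := mono k n; rewrite addnC in h2.
  by have [h3 _ _] := VA (n + k)%N; lra.
have ED n k : E n <= D k.
  have [_ _ h1 _] := mono n k; have [_ _ _ h2] := mono k n; rewrite addnC in h2.
  by have [_ h3 _] := VA (n + k)%N; lra.
have lenAB n : B n - A n = (b0 - a0) / 2 ^+ n.
  elim: n => [|n IH]; first by rewrite /A /B /= expr0 divr1.
  by have [_ _ _ _ [-> _]] := SA n; rewrite IH exprS invfM; ring.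
have lenED n : D n - E n = (d0 - c0) / 2 ^+ n.
  elim: n => [|n IH]; first by rewrite /D /E /= expr0 divr1.
  by have [_ _ _ _ [_ ->]] := SA n; rewrite IH exprS invfM; ring.
have nested (s t : nat -> R) : (forall n k, s n <= t k) ->
    exists x, forall n, s n <= x <= t n.
  move=> st; exists (sup (range s)) => n; apply/andP; split.
    apply: ub_le_sup; last by exists n.
    by exists (t 0%N) => _ [k _ <-].
  by apply: sup_le_ub; [exists (s 0%N), 0%N|move=> _ [k _ <-]].
have [x xP] := nested A B AB.
have [y yP] := nested E D ED.
have [e e0 he] := hloc x y (xP 0%N) (yP 0%N).
have [n1 hn1] := halving_lt (b0 - a0) e0.
have [n2 hn2] := halving_lt (d0 - c0) e0.
have [_ _] := VA (n1 + n2)%N; apply.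
have [m1 m2 m3 m4] := mono 0%N (n1 + n2)%N; rewrite add0n in m1 m2 m3 m4.
have [] := mono n1 n2 => q1 q2 _ _.
have [] := mono n2 n1; rewrite addnC => _ _ q3 q4.
apply: he => //.
  by move: hn1; rewrite -lenAB; lra.
by move: hn2; rewrite -lenED; lra.
Qed.

End Cousin.

(** * Goursat's theorem for rectangles *)

Section Goursat.
Variable R : realType.
Notation C := R[i].
Implicit Types (h : R -> R -> C) (a b c d x y : R).

(* 1/i times the integral of h dz along the boundary of the rectangle
   [a, b] x [c, d] *)
Definition boundary_int h a b c d : C :=
  cint c d (h b) - cint c d (h a) +
  Complex 0 1 * (cint a b (h^~ d) - cint a b (h^~ c)).

(** Complex differentiability at x + iy, with the error measured by the l^1 norm of the increment,
    which compares directly with the side lengths of rectangles. *)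
Definition hdiff h x y : Prop := exists q : C, forall e : R, 0 < e ->
  exists2 r : R, 0 < r & forall x' y', `|x' - x| < r -> `|y' - y| < r ->
  normc (h x' y' - h x y - q * Complex (x' - x) (y' - y)) <=
    e * (`|x' - x| + `|y' - y|).

Lemma normc_Complex x y : normc (Complex x y) <= `|x| + `|y|.
Proof. exact: normc_le_ReIm. Qed.

Lemma hdiff_cts h x y : hdiff h x y -> forall e : R, 0 < e ->
  exists2 r : R, 0 < r & forall x' y', `|x' - x| < r -> `|y' - y| < r ->
  normc (h x' y' - h x y) <= e.
Proof.
move=> [q hq] e e0; have [r r0 hr] := hq 1 ltr01.
have qp : 0 < 1 + normc q by rewrite ltr_wpDr ?normc_ge0.
pose s := e / (1 + normc q) / 2; have s0 : 0 < s by rewrite !divr_gt0.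
exists (Num.min r s); first by rewrite lt_min r0.
move=> x' y'; rewrite !lt_min => /andP[x1 x2] /andP[y1 y2].
have := hr _ _ x1 y1; set z := Complex _ _ => H.
have -> : h x' y' - h x y = (h x' y' - h x y - q * z) + q * z by rewrite subrK.
apply: le_trans (normcD _ _) _.
have nz : normc z <= `|x' - x| + `|y' - y| := normc_Complex _ _.
have nq : normc (q * z) <= normc q * (`|x' - x| + `|y' - y|).
  by rewrite normcM ler_wpM2l ?normc_ge0.
apply: le_trans (lerD H nq) _; rewrite -mulrDl.
apply: le_trans (_ : (1 + normc q) * (s + s) <= _).
  by rewrite ler_wpM2l ?ltW// ltrD.
by rewrite le_eqVlt /s; apply/orP; left; apply/eqP; field; rewrite gt_eqF.
Qed.

Lemma hdiff_cctsy h x y : hdiff h x y -> ccont (h x) y.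
Proof.
move=> /hdiff_cts H e /H[r r0 hr]; exists r => // y'; apply: hr.
by rewrite subrr normr0.
Qed.

Lemma hdiff_cctsx h x y : hdiff h x y -> ccont (h^~ y) x.
Proof.
move=> /hdiff_cts H e /H[r r0 hr]; exists r => // x' hx'; apply: hr => //.
by rewrite subrr normr0.
Qed.

Lemma eq_ccont (F G : R -> C) x : F =1 G -> ccont F x -> ccont G x.
Proof. by move=> /funext ->. Qed.

Lemma ccontB (F G : R -> C) x : ccont F x -> ccont G x ->
  ccont (fun y => F y - G y) x.
Proof.
move=> hF hG e e0; have e2 : 0 < e / 2 by rewrite divr_gt0.
have [d1 d10 h1] := hF _ e2; have [d2 d20 h2] := hG _ e2.
exists (Num.min d1 d2); first by rewrite lt_min d10.
move=> y; rewrite lt_min => /andP[/h1 {}h1 /h2 {}h2].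
rewrite opprD addrACA -opprD [leRHS]splitr.
by apply: le_trans (normcB _ _) _; exact: lerD.
Qed.

Lemma ccont_affine (p q r : C) x : ccont (fun x => p + q * (r + Complex 0 1 * x%:C%C)) x.
Proof.
move=> e e0; have qp : 0 < 1 + normc q by rewrite ltr_wpDr ?normc_ge0.
exists (e / (1 + normc q)); first by rewrite divr_gt0.
move=> y hy.
have -> : p + q * (r + Complex 0 1 * y%:C%C) - (p + q * (r + Complex 0 1 * x%:C%C))
   = q * (Complex 0 1 * (y - x)%:C%C) by rewrite rmorphB /=; ring.
rewrite normcM normcM normc_real normc_i mul1r.
apply: le_trans (_ : (1 + normc q) * `|y - x| <= _).
  by rewrite ler_wpM2r//; lra.
by rewrite mulrC -ler_pdivlMr// ltW.
Qed.

Lemma Complex_mulii : Complex 0 1 * Complex 0 1 = -1 :> C.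
Proof. by apply: complex_eq; rewrite ?cReM ?cImM /=; ring. Qed.

Lemma ccont_affine_im (p q : C) (s y x : R) :
  ccont (fun t => p + q * Complex s (t - y)) x.
Proof.
apply: eq_ccont (ccont_affine p q (Complex s (- y)) x) => t.
by congr (_ + _ * _); apply: complex_eq; rewrite ?cReD ?cImD ?cReM ?cImM /=; ring.
Qed.

Lemma ccont_affine_re (p q : C) (s y x : R) :
  ccont (fun t => p + q * Complex (t - y) s) x.
Proof.
apply: eq_ccont (ccont_affine p (- Complex 0 1 * q) (Complex (- s) (- y)) x) => t.
congr (_ + _); rewrite mulrAC mulrC; congr (_ * _).
by apply: complex_eq; rewrite ?cReN ?cImN ?cReD ?cImD ?cReM ?cImM ?cReN ?cImN /= ?cReD ?cImD ?cReM ?cImM /=; ring.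
Qed.

Lemma boundary_int_split h a b c d m n : a <= m <= b -> c <= n <= d ->
  (forall x y, a <= x <= b -> c <= y <= d -> hdiff h x y) ->
  boundary_int h a b c d = boundary_int h a m c n + boundary_int h m b c n +
    (boundary_int h a m n d + boundary_int h m b n d).
Proof.
move=> amb cnd H; have /andP[am mb] := amb; have /andP[cn nd] := cnd.
have aa : a <= a <= b by lra.
have bb : a <= b <= b by lra.
have cc : c <= c <= d by lra.
have dd : c <= d <= d by lra.
have Hy x : a <= x <= b -> cint c d (h x) = cint c n (h x) + cint n d (h x).
  by move=> hx; apply: cint_split => // y hy; apply: hdiff_cctsy; exact: H.
have Hx y : c <= y <= d -> cint a b (h^~ y) = cint a m (h^~ y) + cint m b (h^~ y).
  by move=> hy; apply: cint_split => // x hx; apply: hdiff_cctsx; exact: H.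
rewrite /boundary_int (Hy a)// (Hy b)// (Hx c)// (Hx d)//; ring.
Qed.

(** The affine approximation of h at (x, y) has boundary integral zero; what remains is small
    compared with the side lengths, and is integrated over edges of that length. *)
Lemma goursat_local h x y e : hdiff h x y -> 0 < e ->
  exists2 r : R, 0 < r & forall a b c d, a <= x <= b -> c <= y <= d ->
    b - a < r -> d - c < r ->
    (forall x y, a <= x <= b -> c <= y <= d -> hdiff h x y) ->
  normc (boundary_int h a b c d) <= e * ((b - a) + (d - c)) ^+ 2.
Proof.
(* Each of the four edges will contribute at most 2 * (e / 8 * L) * L. *)
move=> [q hq] e0; have e8 : 0 < e / 8 by rewrite divr_gt0.
have [r r0 hr] := hq _ e8; exists r => // a b c d axb cyd br dr H.
have /andP[ax xb] := axb; have /andP[cy yd] := cyd.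
pose L := (b - a) + (d - c).
pose aff s t := h x y + q * Complex (s - x) (t - y).
have caffy s t : ccont (aff s) t by exact: ccont_affine_im.
have caffx s t : ccont (aff^~ t) s by exact: ccont_affine_re.
have bnd s t : a <= s <= b -> c <= t <= d -> normc (h s t - aff s t) <= e / 8 * L.
  move=> /andP[s1 s2] /andP[t1 t2].
  have := hr s t; rewrite /aff opprD addrA => /(_ _ _)/le_trans; apply.
  - by rewrite ltr_norml; apply/andP; split; lra.
  - by rewrite ltr_norml; apply/andP; split; lra.
  rewrite ler_wpM2l ?(ltW e8)// /L; apply: lerD; rewrite ler_norml; apply/andP; split; lra.
have aa : a <= a <= b by lra.
have bb : a <= b <= b by lra.
have cc : c <= c <= d by lra.
have dd : c <= d <= d by lra.
have ab : a <= b by lra.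
have cd : c <= d by lra.
have Hy s : a <= s <= b -> ccont_itv (h s) c d.
  by move=> hs t ht; apply: hdiff_cctsy; exact: H.
have Hx t : c <= t <= d -> ccont_itv (h^~ t) a b.
  by move=> ht s hs; apply: hdiff_cctsx; exact: H.
pose Iy s := cint c d (fun t => h s t - aff s t).
pose Ix t := cint a b (fun s => h s t - aff s t).
have Ey s : a <= s <= b -> cint c d (h s) = Iy s + cint c d (aff s).
  by move=> hs; rewrite /Iy cintB ?subrK//; exact: Hy.
have Ex t : c <= t <= d -> cint a b (h^~ t) = Ix t + cint a b (aff^~ t).
  by move=> ht; rewrite /Ix cintB ?subrK//; exact: Hx.
have By s : a <= s <= b -> normc (Iy s) <= 2 * (e / 8 * L) * L.
  move=> hs; apply: le_trans (_ : 2 * (e / 8 * L) * (d - c) <= _).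
    apply: normc_cint => //; last by move=> t ht; exact: bnd.
    by move=> t ht; apply: ccontB => //; exact: Hy.
  have L0 : 0 <= L by rewrite /L; lra.
  by apply: ler_wpM2l; [rewrite !mulr_ge0// ltW|rewrite /L; lra].
have Bx t : c <= t <= d -> normc (Ix t) <= 2 * (e / 8 * L) * L.
  move=> hs; apply: le_trans (_ : 2 * (e / 8 * L) * (b - a) <= _).
    apply: normc_cint => //; last by move=> s hs'; exact: bnd.
    by move=> s hs'; apply: ccontB => //; exact: Hx.
  have L0 : 0 <= L by rewrite /L; lra.
  by apply: ler_wpM2l; [rewrite !mulr_ge0// ltW|rewrite /L; lra].
have A1 : cint c d (aff b) - cint c d (aff a) = (d - c)%:C%C * (q * (b - a)%:C%C).
  rewrite -cintB// -cint_cst//; apply: eq_cint => t _; rewrite /aff.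
  rewrite opprD addrACA subrr add0r -mulrBr; congr (_ * _).
  by apply: complex_eq; rewrite ?cReD ?cImD ?cReN ?cImN /=; ring.
have A2 : cint a b (aff^~ d) - cint a b (aff^~ c) =
    (b - a)%:C%C * (q * (Complex 0 1 * (d - c)%:C%C)).
  rewrite -cintB// -cint_cst//; apply: eq_cint => t _; rewrite /aff.
  rewrite opprD addrACA subrr add0r -mulrBr; congr (_ * _).
  by apply: complex_eq; rewrite ?cReD ?cImD ?cReN ?cImN ?cReM ?cImM /=; ring.
have -> : boundary_int h a b c d = Iy b - Iy a + Complex 0 1 * (Ix d - Ix c).
  rewrite /boundary_int (Ey a)// (Ey b)// (Ex c)// (Ex d)//.
  move/eqP: A1; rewrite subr_eq => /eqP ->.
  move/eqP: A2; rewrite subr_eq => /eqP ->.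
  set i := Complex 0 1; set u := (d - c)%:C%C; set v := (b - a)%:C%C.
  set Q := cint c d (aff a); set Q2 := cint a b _.
  (* The contribution of the affine part is a multiple of 1 + i * i. *)
  apply/eqP; rewrite -subr_eq0; set X := (X in X == 0).
  have -> : X = u * q * v * (1 + i * i) by rewrite /X; ring.
  by rewrite Complex_mulii subrr mulr0.
apply: le_trans (normcD _ _) _; rewrite normcM normc_i mul1r.
apply: le_trans (lerD (normcB _ _) (normcB _ _)) _.
apply: le_trans (lerD (lerD (By b bb) (By a aa)) (lerD (Bx d dd) (Bx c cc))) _.
by rewrite -/L; lra.
Qed.

(** The bound by e times the squared half-perimeter is stable under quartering, since the four
    quarters have half the half-perimeter each; so [cousin] carries it from small rectangles to the
    whole. *)
Lemma goursat h a b c d : a <= b -> c <= d ->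
  (forall x y, a <= x <= b -> c <= y <= d -> hdiff h x y) ->
  boundary_int h a b c d = 0.
Proof.
move=> ab cd H.
suff key e : 0 < e -> normc (boundary_int h a b c d) <= e * ((b - a) + (d - c)) ^+ 2.
  apply: eq_normcB => e e0; rewrite subr0.
  set L := (b - a + (d - c)) ^+ 2 in key; have L0 : 0 <= L by exact: sqr_ge0.
  have L1 : 0 < L + 1 by lra.
  apply: le_trans (key (e / (L + 1)) _) _; first by rewrite divr_gt0.
  by rewrite mulrAC ler_pdivrMr// ler_wpM2l ?ltW//; lra.
move=> e0.
pose P a' b' c' d' := a <= a' -> b' <= b -> c <= c' -> d' <= d ->
  normc (boundary_int h a' b' c' d') <= e * ((b' - a') + (d' - c')) ^+ 2.
suff : P a b c d by apply.
apply: cousin => //.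
  move=> a' b' c' d' ab' cd' P1 P2 P3 P4 h1 h2 h3 h4.
  rewrite (@boundary_int_split h a' b' c' d' ((a' + b') / 2) ((c' + d') / 2)).
  - have {}P1 := P1 h1 ltac:(lra) h3 ltac:(lra).
    have {}P2 := P2 ltac:(lra) h2 h3 ltac:(lra).
    have {}P3 := P3 h1 ltac:(lra) ltac:(lra) h4.
    have {}P4 := P4 ltac:(lra) h2 ltac:(lra) h4.
    apply: le_trans (normcD _ _) _; apply: le_trans (lerD (normcD _ _) (normcD _ _)) _.
    apply: le_trans (lerD (lerD P1 P2) (lerD P3 P4)) _.
    by lra.
  - lra.
  - lra.
  - by move=> x y hx hy; apply: H; lra.
move=> x y hx hy; have [r r0 hr] := goursat_local (H _ _ hx hy) e0.
exists r => // a' b' c' d' h1 h2 h3 h4 h5 h6 h7 h8 _ _ _ _.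
by apply: hr => // s t hs ht; apply: H; lra.
Qed.

End Goursat.

(** * Complex differentiability in one variable *)

Section ComplexDerivative.
Variable R : realType.
Notation C := R[i].
Implicit Types (F G : C -> C) (z w : C).

(** The epsilon form used in estimates; [derivable_cdiff] and [cdiff_derivable] identify it with
    [derivable], from which the rules for products, differences and inverses are inherited. *)
Definition cdiff F z : Prop := exists q : C, forall e : R, 0 < e ->
  exists2 r : R, 0 < r & forall w, normc (w - z) < r ->
    normc (F w - F z - q * (w - z)) <= e * normc (w - z).

Definition ccts F z : Prop := forall e : R, 0 < e ->
  exists2 r : R, 0 < r & forall w, normc (w - z) < r -> normc (F w - F z) <= e.

Lemma cdiff_ccts F z : cdiff F z -> ccts F z.
Proof.
move=> [q hq] e e0; have [r r0 hr] := hq 1 ltr01.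
have qp : 0 < 1 + normc q by rewrite ltr_wpDr ?normc_ge0.
exists (Num.min r (e / (1 + normc q))); first by rewrite lt_min r0 divr_gt0.
move=> w; rewrite lt_min => /andP[/hr H wz].
rewrite -(subrK (q * (w - z)) (F w - F z)); apply: le_trans (normcD _ _) _.
rewrite normcM; apply: le_trans (lerD H (lexx _)) _.
by rewrite -mulrDl mulrC -ler_pdivlMr// ltW.
Qed.

Lemma normc_ltc z (e : R) : (`|z| < e%:C%C) = (normc z < e).
Proof. by case: z => a b; rewrite /= ltcR. Qed.

Lemma posC (e : C) : 0 < e -> exists2 r : R, 0 < r & e = r%:C%C.
Proof.
case: e => a b; rewrite ltcE /= => /andP[/eqP b0 a0]; exists a => //.
by rewrite b0.
Qed.

Lemma nbhs_complexP (z : C) (A : set C) :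
  nbhs z A <-> exists2 r : R, 0 < r & forall w, normc (w - z) < r -> A w.
Proof.
split.
  move=> /nbhs_ballP[e /= /posC[r r0 ->] h]; exists r => // w hw.
  by apply: h; rewrite -ball_normE /= normc_ltc normc_distrC.
move=> [r r0 h]; apply/nbhs_ballP; exists r%:C%C => /=; first by rewrite ltcR.
by move=> w; rewrite -ball_normE /= normc_ltc normc_distrC; exact: h.
Qed.

Lemma derivable_cdiff F z : derivable (F : C^o -> C^o) z 1 -> cdiff F z.
Proof.
move=> /cvg_ex[/= q hq]; exists q => e e0.
have : nbhs (q : C^o) [set w | normc (w - q) <= e].
  by apply/nbhs_complexP; exists e => // w; exact: ltW.
move=> /hq /nbhs_complexP[r r0 hr]; exists r => // w wz.
have [->|nwz] := eqVneq w z; first by rewrite !subrr mulr0 subr0 normc0 mulr0.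
have nz : w - z != 0 by rewrite subr_eq0.
have := hr (w - z); rewrite subr0 => /(_ wz nz) /=.
rewrite /GRing.scale /= mulr1 subrK => H.
have -> : F w - F z - q * (w - z) = ((w - z)^-1 * (F w - F z) - q) * (w - z).
  by rewrite mulrBl mulrAC mulVf// mul1r.
by rewrite normcM ler_wpM2r// normc_ge0.
Qed.

Lemma eq_cdiff F G z (r : R) : 0 < r ->
  (forall w, normc (w - z) < r -> F w = G w) -> cdiff F z -> cdiff G z.
Proof.
move=> r0 FG [q hq]; exists q => e /hq[d d0 hd].
exists (Num.min d r); first by rewrite lt_min d0.
move=> w; rewrite lt_min => /andP[/hd wd wr]; rewrite -!FG//.
by rewrite subrr normc0.
Qed.

Lemma cdiff_derivable F z : cdiff F z -> derivable (F : C^o -> C^o) z 1.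
Proof.
move=> [q hq]; apply/cvg_ex; exists (q : C^o) => A /nbhs_complexP[e e0 he].
have e2 : 0 < e / 2 by rewrite divr_gt0.
have [r r0 hr] := hq _ e2; apply/nbhs_complexP; exists r => // w; rewrite subr0 => wr w0.
apply: he; rewrite /= /GRing.scale /= mulr1.
have := hr (w + z); rewrite addrK => /(_ wr) H.
have -> : w^-1 * (F (w + z) - F z) - q = w^-1 * (F (w + z) - F z - q * w).
  by rewrite [RHS]mulrBr; congr (_ - _); rewrite mulrCA mulVf// mulr1.
rewrite normcM normcV mulrC ltr_pdivrMr ?normc_gt0//.
by apply: le_lt_trans H _; rewrite ltr_pM2r ?normc_gt0//; lra.
Qed.

Lemma cdiff_id z : cdiff id z.
Proof. by apply: derivable_cdiff; exact: derivable_id. Qed.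

Lemma cdiff_cst (c : C) z : cdiff (fun=> c) z.
Proof. by apply: derivable_cdiff; exact: derivable_cst. Qed.

Lemma cdiffM F G z : cdiff F z -> cdiff G z -> cdiff (fun w => F w * G w) z.
Proof.
move=> /cdiff_derivable hF /cdiff_derivable hG; apply: derivable_cdiff.
exact (@derivableM C C^o F G z 1 hF hG).
Qed.

Lemma cdiffB F G z : cdiff F z -> cdiff G z -> cdiff (fun w => F w - G w) z.
Proof.
move=> /cdiff_derivable hF /cdiff_derivable hG; apply: derivable_cdiff.
exact (@derivableB C C^o C^o F G z 1 hF hG).
Qed.

Lemma cdiffV F z : F z != 0 -> cdiff F z -> cdiff (fun w => (F w)^-1) z.
Proof.
move=> Fz /cdiff_derivable hF; apply: derivable_cdiff; exact (@derivableV C C^o F z 1 Fz hF).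
Qed.

Lemma cdiffX F z k : cdiff F z -> cdiff (fun w => F w ^+ k) z.
Proof.
move=> h; elim: k => [|k IH]; first exact: cdiff_cst.
by under eq_fun do rewrite exprS; exact: cdiffM.
Qed.

End ComplexDerivative.

(** * The exponential map and polar coordinates *)

Section PolarCoordinates.
Variable R : realType.
Notation C := R[i].
Implicit Types (s t : R).

Definition expi t : C := Complex (cos t) (sin t).

Lemma expiD s t : expi (s + t) = expi s * expi t.
Proof.
by apply: complex_eq; rewrite ?cReM ?cImM /= ?cosD ?sinD// addrC [cos s * _]mulrC.
Qed.

Lemma expi0 : expi 0 = 1.
Proof. by rewrite /expi cos0 sin0. Qed.

Lemma expiX t k : expi t ^+ k = expi (t *+ k).
Proof. by elim: k => [|k IH]; rewrite ?expr0 ?mulr0n ?expi0// exprS mulrS expiD IH. Qed.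

Lemma normc_expi t : normc (expi t) = 1.
Proof. by rewrite normc_sqrt /= cos2Dsin2 sqrtr1. Qed.

Lemma expi_neq0 t : expi t != 0.
Proof. by rewrite -normc_gt0 normc_expi. Qed.

Lemma expi2pi : expi (pi *+ 2) = 1.
Proof. by rewrite /expi cos2pi sin2pi. Qed.

Lemma is_derive_approx (f : R -> R) (x df : R) : is_derive x 1 f df ->
  forall e : R, 0 < e -> exists2 r : R, 0 < r &
    forall h, `|h| < r -> `|f (x + h) - f x - df * h| <= e * `|h|.
Proof.
move=> [/cvg_ex[/= l hl] <-] e e0.
have -> : 'D_1 f x = l by apply: cvg_lim.
have : nbhs (l : R^o) [set w | `|w - l| <= e].
  by apply/nbhs_ballP; exists e => //= w; rewrite /ball /= distrC => /ltW.
move=> /hl /nbhs_ballP[r /= r0 hr]; exists r => // h hh.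
have [->|nh] := eqVneq h 0; first by rewrite addr0 subrr mulr0 subr0 normr0 mulr0.
have := hr h; rewrite /ball /= sub0r normrN => /(_ hh nh).
rewrite /GRing.scale /= mulr1 => H.
have -> : f (x + h) - f x - l * h = (h^-1 * (f (h + x) - f x) - l) * h.
  by rewrite mulrBl mulrAC mulVf// mul1r (addrC h x).
by rewrite normrM ler_wpM2r.
Qed.

(** The complex exponential of s + it. *)
Definition cexp s t : C := (expR s)%:C%C * expi t.

Lemma cexpD s t s' t' : cexp (s + s') (t + t') = cexp s t * cexp s' t'.
Proof. by rewrite /cexp expRD expiD rmorphM /=; ring. Qed.

Lemma normc_cexp s t : normc (cexp s t) = expR s.
Proof. by rewrite normcM normc_expi normc_real mulr1 ger0_norm ?expR_ge0. Qed.

Lemma cexp_approx (e : R) : 0 < e -> exists2 r : R, 0 < r &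
  forall s t, `|s| < r -> `|t| < r ->
    normc (cexp s t - 1 - Complex s t) <= e * (`|s| + `|t|).
Proof.
(* The exponential, cosine and sine are each approximated at 0 up to a factor d; the errors below
   add up to at most 6 * d times the increment. *)
move=> e0; pose d := Num.min (e / 6) 1.
have d0 : 0 < d by rewrite lt_min divr_gt0//=.
have d1 : d <= 1 by rewrite ge_min lexx orbT.
have de : 6 * d <= e.
  by apply: le_trans (_ : 6 * (e / 6) <= _); [rewrite ler_wpM2l// ge_min lexx|lra].
have [r1 r10 h1] := is_derive_approx (is_derive_expR (0 : R)) d0.
have [r2 r20 h2] := is_derive_approx (is_derive_cos (0 : R)) d0.
have [r3 r30 h3] := is_derive_approx (is_derive_sin (0 : R)) d0.
exists (Num.min (Num.min r1 r2) (Num.min r3 (d / 2))).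
  by rewrite !lt_min r10 r20 r30 divr_gt0.
move=> s t; rewrite !lt_min => /andP[/andP[s1 _] /andP[_ s4]] /andP[/andP[_ t2] /andP[t3 t4]].
have {}h1 := h1 _ s1; have {}h2 := h2 _ t2; have {}h3 := h3 _ t3.
rewrite add0r expR0 mul1r in h1; rewrite add0r cos0 sin0 oppr0 mul0r subr0 in h2.
rewrite add0r sin0 cos0 mul1r subr0 in h3.
have e1 : `|expR s - 1| <= 2 * `|s|.
  rewrite -[X in `|X|](subrK s) ; apply: le_trans (ler_normD _ _) _.
  have : d * `|s| <= `|s| by rewrite ler_piMl.
  by move: h1; lra.
have e2 : expR s <= 2.
  have := ler_norm (expR s - 1); lra.
apply: le_trans (normc_le_ReIm _) _.
rewrite !cReD !cImD !cReN !cImN cReM cImM /= !mul0r !subr0 !addr0.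
have -> : expR s * cos t - 1 - s = (expR s - 1 - s) + expR s * (cos t - 1) by ring.
have -> : expR s * sin t - t = expR s * (sin t - t) + (expR s - 1) * t by ring.
have b1 : `|expR s * (cos t - 1)| <= 2 * (d * `|t|).
  by rewrite normrM ger0_norm ?expR_ge0// ler_pM// expR_ge0.
have b2 : `|expR s * (sin t - t)| <= 2 * (d * `|t|).
  by rewrite normrM ger0_norm ?expR_ge0// ler_pM// expR_ge0.
have b3 : `|(expR s - 1) * t| <= d * `|t|.
  by rewrite normrM ler_wpM2r//; lra.
have b0 : `|expR s - 1 - s + expR s * (cos t - 1)| <= d * `|s| + 2 * (d * `|t|).
  by apply: le_trans (ler_normD _ _) _; exact: lerD.
have b4 : `|expR s * (sin t - t) + (expR s - 1) * t| <= 2 * (d * `|t|) + d * `|t|.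
  by apply: le_trans (ler_normD _ _) _; exact: lerD.
apply: le_trans (lerD b0 b4) _.
apply: le_trans (_ : 6 * d * (`|s| + `|t|) <= _); last by rewrite ler_wpM2r ?addr_ge0.
have : 0 <= d * `|s| by rewrite mulr_ge0 // ltW.
have : 0 <= d * `|t| by rewrite mulr_ge0 // ltW.
by lra.
Qed.

Lemma cexp_lip : exists2 r : R, 0 < r &
  forall s t, `|s| < r -> `|t| < r -> normc (cexp s t - 1) <= 2 * (`|s| + `|t|).
Proof.
have [r r0 h] := cexp_approx ltr01; exists r => // s t hs ht.
rewrite -(subrK (Complex s t) (_ - 1)); apply: le_trans (normcD _ _) _.
by have := h _ _ hs ht; have := normc_Complex s t; lra.
Qed.

(** The chain rule for w = e^(s + it), whose derivative is w itself. It moves functions on an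
    annulus to a rectangle. *)
Lemma hdiff_polar (F : C -> C) s t : cdiff F (cexp s t) ->
  hdiff (fun s t => F (cexp s t)) s t.
Proof.
move=> [q hq]; exists (q * cexp s t) => e e0.
pose K := expR s; have K0 : 0 < K := expR_gt0 _.
have q0 : 0 < 1 + normc q by rewrite ltr_wpDr ?normc_ge0.
(* By [cexp_lip] the increment of [cexp] is at most 2 * K times that of (s, t); the errors governed
   by [e1] and by [e2] account for e / 2 each. *)
pose e1 := e / (4 * K); have e10 : 0 < e1 by rewrite !divr_gt0 ?mulr_gt0.
pose e2 := e / (2 * K * (1 + normc q)).
have e20 : 0 < e2 by rewrite !divr_gt0 ?mulr_gt0.
have [r1 r10 h1] := hq _ e10.
have [r2 r20 h2] := cexp_approx e20.
have [r3 r30 h3] := cexp_lip.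
have r1K : 0 < r1 / (4 * K) by rewrite divr_gt0 ?mulr_gt0.
exists (Num.min (Num.min r2 r3) (r1 / (4 * K))).
  by rewrite !lt_min r20 r30.
move=> s' t'; rewrite !lt_min => /andP[/andP[s2 s3] s1] /andP[/andP[t2 t3] t1].
set ds := s' - s in s1 s2 s3 *; set dt := t' - t in t1 t2 t3 *.
have E' : cexp s' t' = cexp s t * cexp ds dt by rewrite -cexpD /ds /dt !(addrC _ (_ - _)) !subrK.
have {}h2 := h2 _ _ s2 t2; have {}h3 := h3 _ _ s3 t3.
have dE : normc (cexp s' t' - cexp s t) <= K * (2 * (`|ds| + `|dt|)).
  rewrite E' -{2}(mulr1 (cexp s t)) -mulrBr normcM normc_cexp.
  by rewrite ler_wpM2l ?(ltW K0).
have {}h1 := h1 (cexp s' t').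
have : normc (cexp s' t' - cexp s t) < r1.
  apply: le_lt_trans dE _; rewrite mulrA (mulrC K) -ltr_pdivlMl ?mulr_gt0//.
  apply: lt_le_trans (ltrD s1 t1) _; rewrite le_eqVlt; apply/orP; left; apply/eqP.
  by field; rewrite gt_eqF.
move=> /h1 {}h1.
have -> : F (cexp s' t') - F (cexp s t) - q * cexp s t * Complex ds dt =
  (F (cexp s' t') - F (cexp s t) - q * (cexp s' t' - cexp s t)) +
  q * cexp s t * (cexp ds dt - 1 - Complex ds dt).
  by rewrite E'; ring.
apply: le_trans (normcD _ _) _; rewrite (normcM (q * _)) (normcM q) normc_cexp -/K.
have a1 : e1 * normc (cexp s' t' - cexp s t) <= e / 2 * (`|ds| + `|dt|).
  apply: le_trans (_ : e1 * (K * (2 * (`|ds| + `|dt|))) <= _).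
    by rewrite ler_wpM2l ?(ltW e10).
  rewrite le_eqVlt /e1; apply/orP; left; apply/eqP; field; exact: lt0r_neq0.
have a2 : normc q * K * normc (cexp ds dt - 1 - Complex ds dt) <= e / 2 * (`|ds| + `|dt|).
  apply: le_trans (_ : (1 + normc q) * K * (e2 * (`|ds| + `|dt|)) <= _).
    apply: ler_pM => //; rewrite ?mulr_ge0 ?normc_ge0 ?(ltW K0)//.
    by rewrite ler_wpM2r ?(ltW K0)//; lra.
  rewrite le_eqVlt /e2; apply/orP; left; apply/eqP; field.
  by rewrite !lt0r_neq0.
by have := lerD (le_trans h1 a1) a2; lra.
Qed.

End PolarCoordinates.

(** * Means over circles *)

Section CircleMean.
Variable R : realType.
Notation C := R[i].
Notation T := (pi *+ 2 : R).
Implicit Types (F g : C -> C) (z : C).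

Lemma T_gt0 : 0 < T.
Proof. by rewrite pmulrn_lgt0// pi_gt0. Qed.

(** The integral of F(z) dz / (iz) over the circle, that is, 2 pi times the mean. *)
Definition circ F (r : R) : C := cint 0 T (fun t => F (r%:C%C * expi t)).

Lemma normc_circle (r t : R) : 0 <= r -> normc (r%:C%C * expi t) = r.
Proof. by move=> r0; rewrite normcM normc_expi mulr1 normc_real ger0_norm. Qed.

Lemma cexp_ln (r t : R) : 0 < r -> cexp (ln r) t = r%:C%C * expi t.
Proof. by move=> r0; rewrite /cexp lnK. Qed.

(** Goursat for F(e^(s + it)) on [ln r1, ln r2] x [0, 2 pi]: the edges t = 0 and t = 2 pi cancel by
    periodicity, and the other two are the circles. *)
Lemma circ_const F (r1 r2 : R) : 0 < r1 -> r1 <= r2 ->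
  (forall z, r1 <= normc z <= r2 -> cdiff F z) -> circ F r1 = circ F r2.
Proof.
move=> r10 r12 H; have r20 : 0 < r2 by lra.
have T0 := T_gt0.
have := @goursat R (fun s t => F (cexp s t)) (ln r1) (ln r2) 0 T.
rewrite ler_ln ?posrE// => /(_ r12 (ltW T0)).
rewrite /boundary_int.
have e0 : (fun s => F (cexp s T)) = (fun s => F (cexp s 0)).
  by apply/funext => s; rewrite /cexp expi2pi expi0.
have -> : (fun x => F (cexp x T)) = (fun s => F (cexp s 0)) := e0.
set K := cint (ln r1) (ln r2) _; rewrite (subrr K) mulr0 addr0 => h.
have {}h : circ F r2 - circ F r1 = 0.
  rewrite -[RHS]h; last first.
    move=> s t /andP[s1 s2] _; apply: hdiff_polar; apply: H.
    rewrite normc_cexp -{1}(lnK (_ : r1 \is Num.pos)) ?posrE// ler_expR s1 /=.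
    by rewrite -{1}(lnK (_ : r2 \is Num.pos)) ?posrE// ler_expR s2.
  by congr (_ - _); apply: eq_cint => t _; rewrite cexp_ln.
by apply/esym/eqP; rewrite -subr_eq0 h.
Qed.

Lemma expi_lip : exists2 r : R, 0 < r &
  forall t t', `|t' - t| < r -> normc (expi t' - expi t) <= 2 * `|t' - t|.
Proof.
have [r r0 h] := cexp_lip R; exists r => // t t' ht.
have -> : expi t' - expi t = expi t * (cexp 0 (t' - t) - 1).
  by rewrite mulrBr mulr1 /cexp expR0 mul1r -expiD (addrC t) subrK.
rewrite normcM normc_expi mul1r.
by have := h 0 (t' - t); rewrite normr0 add0r => /(_ r0 ht).
Qed.

Lemma circle_near (r t : R) (e : R) : 0 <= r -> 0 < e -> exists2 d : R, 0 < d &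
  forall r' t', `|r' - r| < d -> `|t' - t| < d ->
    normc (r'%:C%C * expi t' - r%:C%C * expi t) < e.
Proof.
move=> r0 e0; have [d d0 hd] := expi_lip.
have q0 : 0 < 1 + 2 * r by lra.
exists (Num.min d (e / (1 + 2 * r))); first by rewrite lt_min d0 divr_gt0.
move=> r' t'; rewrite !lt_min => /andP[_ r2] /andP[/hd t1 t2].
have -> : r'%:C%C * expi t' - r%:C%C * expi t =
   (r' - r)%:C%C * expi t' + r%:C%C * (expi t' - expi t).
  by rewrite rmorphB /=; ring.
apply: le_lt_trans (normcD _ _) _.
rewrite !normcM normc_expi mulr1 !normc_real (ger0_norm r0).
have h1 : r * normc (expi t' - expi t) <= r * (2 * `|t' - t|) by exact: ler_wpM2l.
apply: le_lt_trans (lerD (lexx _) h1) _.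
apply: lt_le_trans (_ : e / (1 + 2 * r) + r * (2 * (e / (1 + 2 * r))) <= _).
  by apply: ltr_leD => //; rewrite ler_wpM2l// ler_wpM2l// ltW.
by rewrite le_eqVlt; apply/orP; left; apply/eqP; field; exact: lt0r_neq0.
Qed.

Lemma ccont_circle F (r t : R) : 0 <= r -> ccts F (r%:C%C * expi t) ->
  ccont (fun t => F (r%:C%C * expi t)) t.
Proof.
move=> r0 h e /h[d d0 hd]; have [d' d'0 h'] := circle_near t r0 d0.
exists d' => // t' ht'; apply: hd; apply: h' => //.
by rewrite subrr normr0.
Qed.

Lemma circ_cts F (r : R) : 0 <= r -> (forall t, ccts F (r%:C%C * expi t)) ->
  forall e : R, 0 < e -> exists2 d : R, 0 < d & forall r', 0 <= r' -> `|r' - r| < d ->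
    (forall t, ccts F (r'%:C%C * expi t)) -> normc (circ F r' - circ F r) <= e.
Proof.
move=> r0 H e e0; have T0 := T_gt0.
pose e1 := e / (2 * T); have e10 : 0 < e1 by rewrite divr_gt0 ?mulr_gt0.
(* [cousin] on the degenerate rectangle {0} x [0, T] provides closeness uniform in the angle. *)
pose P (a b c d : R) := exists2 s : R, 0 < s & forall r', 0 <= r' -> `|r' - r| < s ->
  forall t, c <= t <= d -> normc (F (r'%:C%C * expi t) - F (r%:C%C * expi t)) <= e1.
have [s s0 hs] : P 0 0 0 T.
  apply: cousin => //; first exact: ltW.
    move=> a b c d ab cd [s1 s10 h1] _ [s2 s20 h2] _.
    exists (Num.min s1 s2); first by rewrite lt_min s10.
    move=> r' r'0; rewrite lt_min => /andP[k1 k2] t /andP[t1 t2].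
    have [tm|tm] := leP t ((c + d) / 2).
      by apply: h1 => //; rewrite t1.
    by apply: h2 => //; rewrite t2 ltW.
  move=> x0 t _ _; have e2 : 0 < e1 / 2 by rewrite divr_gt0.
  have [s s0 hs] := H t _ e2; have [s' s'0 hs'] := circle_near t r0 s0.
  exists s' => // a b c d _ _ _ _ /andP[ct td] _ _ dc; exists s' => // r' r'0 hr' u /andP[cu ud].
  have ut : `|u - t| < s' by rewrite ltr_norml; apply/andP; split; lra.
  have g1 := hs _ (hs' _ _ hr' ut).
  have g2 := hs _ (hs' r _ _ ut); rewrite subrr normr0 in g2; have {}g2 := g2 s'0.
  have -> : F (r'%:C%C * expi u) - F (r%:C%C * expi u) =
    (F (r'%:C%C * expi u) - F (r%:C%C * expi t)) - (F (r%:C%C * expi u) - F (r%:C%C * expi t)) by ring.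
  by apply: le_trans (normcB _ _) _; lra.
exists s => // r' r'0 r's H'; rewrite /circ -cintB//; try by move=> t _; apply: ccont_circle.
apply: le_trans (@normc_cint _ _ _ _ e1 _ _ _) _.
- exact: ltW.
- by move=> t _; apply: ccontB; apply: ccont_circle.
- by move=> t ht; exact: hs.
- by rewrite subr0 mulrAC mulrC /e1 divfK// lt0r_neq0// mulr_gt0.
Qed.

(** At z0 only continuity is known, which is the situation of a difference quotient filled in at one
    point. The circle mean is constant for radii on either side of |z0|; continuity in the radius
    joins the two ranges and also reaches radius 0. *)
Lemma circ_mean F z0 (R0 : R) :
  (forall z, normc z < R0 -> ccts F z) ->
  (forall z, z != z0 -> normc z < R0 -> cdiff F z) ->
  forall r, 0 < r < R0 -> circ F r = T%:C%C * F 0.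
Proof.
move=> cF dF; have T0 := T_gt0.
have ct (r t : R) : 0 <= r -> r < R0 -> ccts F (r%:C%C * expi t).
  by move=> r0 rR; apply: cF; rewrite normc_circle.
(* Continuity in the radius: a value constant strictly between l and r is also taken at r. *)
have lim (r l : R) : 0 <= r < R0 -> l != r -> 0 <= l < R0 ->
    (forall s, Num.min l r < s < Num.max l r -> circ F s = circ F l) ->
    circ F r = circ F l.
  move=> /andP[r0 rR] lr /andP[l0 lR] h; apply: eq_normcB => e e0.
  have [d d0 hd] := circ_cts r0 (fun t => ct r t r0 rR) e0.
  have [ltlr|gtlr|eqlr] := ltgtP l r; last by rewrite eqlr eqxx in lr.
    pose s := Num.max ((l + r) / 2) (r - d / 2).
    have s1 : (l + r) / 2 <= s by rewrite le_max lexx.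
    have s2 : r - d / 2 <= s by rewrite le_max lexx orbT.
    have s3 : s < r by rewrite gt_max; apply/andP; split; lra.
    rewrite -(h s); last first.
      by rewrite (min_idPl (ltW ltlr)) (max_idPr (ltW ltlr)) s3 andbT; lra.
    rewrite normc_distrC; apply: hd; first by lra.
      by rewrite ltr_norml; apply/andP; split; lra.
    by move=> t; apply: ct; lra.
  pose s := Num.min ((l + r) / 2) (r + d / 2).
  have s1 : s <= (l + r) / 2 by rewrite ge_min lexx.
  have s2 : s <= r + d / 2 by rewrite ge_min lexx orbT.
  have s3 : r < s by rewrite lt_min; apply/andP; split; lra.
  rewrite -(h s); last first.
    by rewrite (min_idPr (ltW gtlr)) (max_idPl (ltW gtlr)) s3 /=; lra.
  rewrite normc_distrC; apply: hd; first by lra.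
    by rewrite ltr_norml; apply/andP; split; lra.
  by move=> t; apply: ct; lra.
have const (r1 r2 : R) : 0 < r1 -> r1 <= r2 -> r2 < R0 ->
    ~ (r1 <= normc z0 <= r2) -> circ F r1 = circ F r2.
  move=> r10 r12 r2R nz; apply: circ_const => // z /andP[h1 h2]; apply: dF.
    by apply/eqP => zz; apply: nz; rewrite -zz h1.
  exact: le_lt_trans h2 r2R.
pose m := normc z0.
have below (r : R) : 0 < r -> r <= m -> m < R0 -> circ F m = circ F r.
  move=> r0; rewrite le_eqVlt => /orP[/eqP->//|rm] mR.
  apply: lim; [by rewrite mR normc_ge0|by rewrite lt_eqF|by lra|].
  rewrite (min_idPl (ltW rm)) (max_idPr (ltW rm)) => s /andP[s1 s2].
  by apply/esym/const; rewrite -?/m; lra.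
have above (r : R) : 0 < m -> m <= r -> r < R0 -> circ F m = circ F r.
  move=> m0; rewrite le_eqVlt => /orP[/eqP->//|rm] rR.
  apply: lim; [by lra|by rewrite gt_eqF|by lra|].
  rewrite (min_idPr (ltW rm)) (max_idPl (ltW rm)) => s /andP[s1 s2].
  by apply/const; rewrite -?/m; lra.
have all_const (r1 r2 : R) : 0 < r1 -> r1 <= r2 -> r2 < R0 -> circ F r1 = circ F r2.
  move=> r10 r12 r2R; have [mr|mr] := ltP m r1.
    by apply: const => //; rewrite -/m; lra.
  have [mr2|mr2] := ltP r2 m.
    by apply: const => //; rewrite -/m; lra.
  have <- := below r1 r10 mr ltac:(lra).
  by apply: above => //; lra.
move=> r /andP[r0 rR]; have <- : circ F 0 = T%:C%C * F 0.
  rewrite /circ (_ : (fun t => _) = fun=> F 0); last first.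
    by apply/funext => t; rewrite mul0r.
  by rewrite cint_cst ?subr0 ?(ltW T0).
apply/esym/lim; [by rewrite lexx /=; lra|by rewrite gt_eqF|by lra|].
rewrite (min_idPr (ltW r0)) (max_idPl (ltW r0)) => s /andP[s1 s2].
by apply: all_const; lra.
Qed.

End CircleMean.

(** * Cauchy's formula and power series *)

Section PowerSeries.
Variable R : realType.
Notation C := R[i].
Notation T := (pi *+ 2 : R).
Implicit Types (F g : C -> C) (z : C) (c : nat -> C).

(** For k > 0 the mean of z^(-k) agrees for the radii r and 2 r by [circ_const], but also scales by
    2^(-k); hence it vanishes. *)
Lemma circ_powV (r : R) k : 0 < r ->
  circ (fun z : C => (z ^+ k)^-1) r = if k == 0%N then T%:C%C else 0.
Proof.
move=> r0; case: k => [|k] /=.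
  rewrite /circ (_ : (fun=> _) = fun=> 1); last by apply/funext => t; rewrite expr0 invr1.
  by rewrite cint_cst ?subr0 ?mulr1// ltW// T_gt0.
pose F z := (z ^+ k.+1)^-1.
have dF z : z != 0 -> cdiff F z.
  by move=> z0; apply: cdiffV; [rewrite expf_neq0|apply: cdiffX; exact: cdiff_id].
have nF z (s : R) : 0 < s -> s <= normc z -> z != 0.
  by move=> s0 sz; rewrite -normc_gt0; exact: lt_le_trans sz.
have h1 : circ F r = circ F (r + r).
  apply: circ_const => //; first by lra.
  by move=> z /andP[/(nF _ _ r0) z0 _]; exact: dF.
have h2 : circ F (r + r) = (2 ^+ k.+1)^-1 * circ F r.
  rewrite /circ -cintZ.
    by apply: eq_cint => t _; rewrite /F -mulr2n rmorphMn /= -mulr_natl -mulrA exprMn invfM.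
  move=> t _; apply: ccont_circle; first exact: ltW.
  apply: cdiff_ccts; apply: dF; rewrite -normc_gt0 normc_circle; first exact: r0.
  exact: ltW.
have {h1 h2} : (1 - (2 ^+ k.+1)^-1) * circ F r = 0 by rewrite mulrBl mul1r -h2 -h1 subrr.
move/eqP; rewrite mulf_eq0 subr_eq0 => /orP[|/eqP//].
rewrite eq_sym invr_eq1 -natrX -[1]/(1%:R) eqr_nat.
have := @ltn_expl 2 k.+1 isT; move: (2 ^ k.+1)%N => m h /eqP m1; exfalso; by rewrite m1 in h.
Qed.

Lemma geometric_small (t K e : R) : 0 <= t < 1 -> 0 < e ->
  exists N, forall n, (N <= n)%N -> K * t ^+ n <= e.
Proof.
move=> /andP[t0 t1] e0.
have nt : `|t| < 1 by rewrite ger0_norm.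
have := @cvg_geometric R K t nt => /cvgrPdist_le/(_ e e0)[N _ hN].
exists N => n /hN; rewrite /= sub0r normrN; apply: le_trans.
exact: ler_norm.
Qed.

Lemma geometric_tail (t : R) k N : 0 <= t < 1 ->
  \sum_(k <= l < N) t ^+ l <= t ^+ k / (1 - t).
Proof.
move=> /andP[t0 t1]; have t1' : 0 < 1 - t by lra.
have [Nk|kN] := leqP N k.
  by rewrite big_geq// divr_ge0 ?exprn_ge0// ltW.
rewrite ler_pdivlMr// mulr_suml.
have -> : \sum_(k <= l < N) t ^+ l * (1 - t) = \sum_(k <= l < N) (- t ^+ l.+1 - - t ^+ l).
  by apply: eq_bigr => l _; rewrite exprS; ring.
rewrite telescope_sumr ?(ltnW kN)//.
by have := exprn_ge0 N t0; lra.
Qed.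

Definition psum c N z : C := \sum_(l < N) c l * z ^+ l.

(** The coefficients are the means of g(w) w^(-k). Cauchy's formula enters as the mean value
    property of w (g(w) - g(z)) / (w - z), which vanishes at w = 0. Dividing by powers of w gives a
    recursion for an exact Taylor remainder, so that no series is integrated term by term. *)
Lemma power_series g (R0 r B : R) : (forall z, normc z < R0 -> cdiff g z) ->
  0 < r < R0 -> (forall z, normc z = r -> normc (g z) <= B) ->
  exists c, (forall k, normc (c k) * r ^+ k <= 2 * B) /\
    forall z, normc z < r -> exists K, forall N,
      normc (g z - psum c N.+1 z) <= K * (normc z / r) ^+ N.+1.
Proof.
move=> dg /andP[r0 rR] gB.
pose u (t : R) : C := r%:C%C * expi t.
have nu t : normc (u t) = r by apply: normc_circle; exact: ltW.
have u0 t : u t != 0 by rewrite -normc_gt0 nu.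
have cu F (t : R) : ccts F (u t) -> ccont (fun t => F (u t)) t.
  by apply: ccont_circle; exact: ltW.
have dgu t : cdiff g (u t) by apply: dg; rewrite nu.
have dpow k t : cdiff (fun z : C => (z ^+ k)^-1) (u t).
  by apply: cdiffV; [rewrite expf_neq0|apply: cdiffX; exact: cdiff_id].
pose c k := (T^-1)%:C%C * circ (fun z => g z * (z ^+ k)^-1) r.
have npow k t : normc ((u t ^+ k)^-1) = (r ^+ k)^-1 by rewrite normcV normcX nu.
have rk k : 0 < r ^+ k by rewrite exprn_gt0.
have nT : normc ((T^-1)%:C%C : C) = T^-1.
  by rewrite normc_real ger0_norm// invr_ge0 ltW// T_gt0.
have TT : (T^-1)%:C%C * T%:C%C = 1 :> C by rewrite -rmorphM mulVf ?rmorph1// lt0r_neq0// T_gt0.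
have cirle F (S : R) : (forall t, ccts F (u t)) -> (forall t, normc (F (u t)) <= S) ->
    normc ((T^-1)%:C%C * circ F r) <= 2 * S.
  move=> cF FS; rewrite normcM nT mulrC ler_pdivrMr ?T_gt0//.
  apply: le_trans (@normc_cint _ _ _ _ S _ _ _) _; last by rewrite subr0.
  - exact/ltW/T_gt0.
  - by move=> t _; apply: cu.
  - by move=> t _; exact: FS.
exists c; split.
  move=> k; rewrite -ler_pdivlMr//  -mulrA; apply: cirle.
    by move=> t; apply: cdiff_ccts; apply: cdiffM.
  by move=> t; rewrite normcM npow ler_wpM2r ?gB// invr_ge0 ltW.
move=> z zr.
pose g0 := g z.
have zR : normc z < R0 by exact: lt_trans rR.
have [q hq] := dg _ zR.
(* The value z * q makes F continuous at z, as [circ_mean] requires. *)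
pose F w := if w == z then z * q else w * (g w - g0) / (w - z).
have Fz w : w != z -> normc w < R0 -> cdiff F w.
  move=> wz wR; have d0 : 0 < normc (w - z) by rewrite normc_gt0 subr_eq0.
  apply: (@eq_cdiff _ (fun w => w * (g w - g0) * (w - z)^-1) _ _ _ d0).
    move=> v vw; rewrite /F; case: eqP => // vz.
    by move: vw; rewrite vz normc_distrC ltxx.
  apply: cdiffM; last first.
    apply: cdiffV; first by rewrite subr_eq0.
    by apply: cdiffB; [exact: cdiff_id|exact: cdiff_cst].
  apply: cdiffM; first exact: cdiff_id.
  by apply: cdiffB; [exact: dg|exact: cdiff_cst].
have Fcz : ccts F z.
  move=> e e0; have z1 : 0 < 1 + normc z by rewrite ltr_wpDr ?normc_ge0.
  have q1 : 0 < 1 + normc q by rewrite ltr_wpDr ?normc_ge0.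
  have e1 : 0 < e / 2 / (1 + normc z) by rewrite !divr_gt0.
  have [d d0 hd] := hq _ e1.
  exists (Num.min (Num.min d 1) (e / 2 / (1 + normc q))).
    by rewrite !lt_min d0 ltr01 !divr_gt0.
  move=> w; rewrite !lt_min => /andP[/andP[/hd {}hd wz1] wz2].
  rewrite /F eqxx; case: eqP => [_|/eqP wz]; first by rewrite subrr normc0 ltW.
  have wz0 : w - z != 0 by rewrite subr_eq0.
  have -> : w * (g w - g0) / (w - z) - z * q =
      w * ((g w - g0 - q * (w - z)) / (w - z)) + (w - z) * q by field.
  apply: le_trans (normcD _ _) _; rewrite !normcM normcV.
  have a1 : normc (g w - g0 - q * (w - z)) / normc (w - z) <= e / 2 / (1 + normc z).
    by rewrite ler_pdivrMr ?normc_gt0.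
  have a2 : normc w <= 1 + normc z.
    by rewrite -(subrK z w); have := normcD (w - z) z; lra.
  have a3 : normc w * (normc (g w - g0 - q * (w - z)) / normc (w - z)) <= e / 2.
    apply: le_trans (_ : (1 + normc z) * (e / 2 / (1 + normc z)) <= _).
      by apply: ler_pM => //; rewrite ?normc_ge0// divr_ge0 ?normc_ge0.
    by rewrite mulrC divfK// lt0r_neq0.
  have a4 : normc (w - z) * normc q <= e / 2.
    apply: le_trans (_ : e / 2 / (1 + normc q) * (1 + normc q) <= _).
      apply: ler_pM; rewrite ?normc_ge0//; first exact: ltW.
      by lra.
    by rewrite divfK// lt0r_neq0.
  by lra.
have Fc w : normc w < R0 -> ccts F w.
  by move=> wR; have [->//|wz] := eqVneq w z; apply: cdiff_ccts; exact: Fz.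
have F0 : F 0 = 0 by rewrite /F; case: eqP => [<-|_]; rewrite !mul0r.
have uz t : u t - z != 0.
  by rewrite subr_eq0; apply/eqP => h; move: zr; rewrite -h nu ltxx.
have uz' t : u t != z by rewrite -subr_eq0.
have Fu t : ccts F (u t) by apply: Fc; rewrite nu.
pose S := r * (B + normc g0) / (r - normc z).
have rz0 : 0 < r - normc z by rewrite subr_gt0.
have FS t : normc (F (u t)) <= S.
  rewrite /F (negbTE (uz' t)) normcM (normcM (u t)) normcV nu /S.
  have B1 : normc (g (u t) - g0) <= B + normc g0.
    by apply: le_trans (normcB _ _) _; rewrite lerD2r gB.
  have B2 : r - normc z <= normc (u t - z).
    rewrite lerBlDr -{1}(nu t) -{1}(subrK z (u t)); exact: normcD.
  apply: ler_pM.
  - by rewrite mulr_ge0 ?normc_ge0 ?(ltW r0).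
  - by rewrite invr_ge0 normc_ge0.
  - by rewrite ler_wpM2l ?(ltW r0).
  - by rewrite lef_pV2 ?posrE//; exact: lt_le_trans B2.
pose G N := (T^-1)%:C%C * circ (fun w => (w ^+ N)^-1 * F w) r.
have cpow N t : ccts (fun w : C => (w ^+ N)^-1) (u t) by apply: cdiff_ccts; exact: dpow.
have cgp N t : ccts (fun w => g w * (w ^+ N)^-1) (u t).
  by apply: cdiff_ccts; apply: cdiffM.
have cFp N t : ccts (fun w => (w ^+ N)^-1 * F w) (u t).
  by apply: cdiff_ccts; apply: cdiffM => //; apply: Fz; rewrite ?nu.
have G0 : G 0%N = 0.
  rewrite /G (_ : (fun w => _) = F); last by apply/funext => w; rewrite expr0 invr1 mul1r.
  by rewrite (@circ_mean _ F z R0) ?F0 ?mulr0// r0.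
(* This is F(w) = (g(w) - g(z)) + z F(w) / w, divided by w^N and averaged. *)
have Grec N : G N = c N - (if N == 0%N then g0 else 0) + z * G N.+1.
  have -> : (if N == 0%N then g0 else 0) =
      (T^-1)%:C%C * (g0 * circ (fun w : C => (w ^+ N)^-1) r).
    by rewrite circ_powV// mulrCA; case: eqP => _; rewrite ?TT ?mulr0 ?mulr1.
  rewrite /G /c [z * (_ * _)]mulrCA -mulrBr -mulrDr; congr (_ * _).
  rewrite /circ -[g0 * _]cintZ; last by move=> t _; exact: (@cu (fun w : C => (w ^+ N)^-1)).
  rewrite -[z * _]cintZ; last by move=> t _; exact: (@cu (fun w => (w ^+ N.+1)^-1 * F w)).
  have cZ (a : C) (f : R -> C) x : ccont f x -> ccont (fun y => a * f y) x.
    move=> cf e e0; have a0 : 0 < 1 + normc a by rewrite ltr_wpDr ?normc_ge0.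
    have [|d d0 hd] := cf (e / (1 + normc a)); first by rewrite divr_gt0.
    exists d => // y /hd H; rewrite -mulrBr normcM.
    apply: le_trans (_ : (1 + normc a) * (e / (1 + normc a)) <= _).
      by apply: ler_pM; rewrite ?normc_ge0//; lra.
    by rewrite mulrC divfK// lt0r_neq0.
  rewrite -cintB; last 2 first.
  - by move=> t _; exact: (@cu (fun w => g w * (w ^+ N)^-1)).
  - by move=> t _; apply: cZ; exact: (@cu (fun w : C => (w ^+ N)^-1)).
  rewrite -cintD; last 2 first.
  - move=> t _; apply: ccontB; first exact: (@cu (fun w => g w * (w ^+ N)^-1)).
    by apply: cZ; exact: (@cu (fun w : C => (w ^+ N)^-1)).
  - by move=> t _; apply: cZ; exact: (@cu (fun w => (w ^+ N.+1)^-1 * F w)).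
  apply: eq_cint => t _; rewrite -/(u t) /F (negbTE (uz' t)) exprS.
  have := uz t; have := expf_neq0 N (u0 t); have := u0 t.
  move: (u t) (u t ^+ N) => w wN w0 wN0 wz; field; by rewrite w0 wN0 wz.
have key N : g z - psum c N.+1 z = z ^+ N.+1 * G N.+1.
  elim: N => [|N IH].
    have := G0; rewrite Grec /= /psum big_ord_recr big_ord0 /= add0r mulr1 expr1.
    rewrite -/g0 => h; apply/eqP; rewrite -subr_eq0 -oppr_eq0; apply/eqP.
    by rewrite -h; ring.
  rewrite /psum big_ord_recr /= -/(psum _ _ _) opprD addrA IH Grec /= !exprS; ring.
exists (2 * S) => N; rewrite key normcM normcX mulrC.
apply: le_trans (_ : 2 * ((r ^+ N.+1)^-1 * S) * normc z ^+ N.+1 <= _).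
  rewrite ler_wpM2r ?exprn_ge0 ?normc_ge0//; apply: cirle => // t.
  by rewrite normcM npow ler_wpM2l ?FS// invr_ge0 ltW.
by rewrite expr_div_n le_eqVlt; apply/orP; left; apply/eqP; ring.
Qed.

End PowerSeries.

(** * Averages over roots of unity in one variable *)

Section RootsOfUnity.
Variable R : realType.
Notation C := R[i].
Implicit Types (g : C -> C) (z : C) (c : nat -> C) (M k l : nat).

Definition omega M : C := expi (pi *+ 2 / M%:R).

Lemma normc_omega M : normc (omega M) = 1.
Proof. exact: normc_expi. Qed.

Lemma omega_neq0 M : omega M != 0.
Proof. exact: expi_neq0. Qed.

Lemma omegaM M : (0 < M)%N -> omega M ^+ M = 1.
Proof.
by move=> M0; rewrite expiX -[_ *+ M]mulr_natr divfK ?expi2pi// pnatr_eq0 -lt0n.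
Qed.

Lemma omega_neq1 M k : (0 < k < M)%N -> omega M ^+ k != 1.
Proof.
move=> /andP[k0 kM]; rewrite expiX; apply/eqP => -[h _]; move: h.
have M0 : (0 < M%:R :> R) by rewrite ltr0n (leq_trans _ kM).
have pi0 := pi_gt0 R.
(* Here 0 < x < pi, so that cos (2 x) = 1 - 2 sin(x)^2 is less than 1. *)
pose x : R := pi / M%:R *+ k.
have -> : pi *+ 2 / M%:R *+ k = x *+ 2 by rewrite /x mulrnAl mulrnAC.
rewrite cos_mulr2n cos2sin2; have : 0 < sin x.
  apply: sin_gt0_pi; apply/andP; split.
    by rewrite /x mulrn_wgt0 ?divr_gt0// k0.
  by rewrite /x -mulr_natr -mulrA gtr_pMr// mulrC ltr_pdivrMr// mul1r ltr_nat.
move=> s0; have : 0 < sin x ^+ 2 by rewrite exprn_gt0.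
by rewrite -mulr_natr; lra.
Qed.

Lemma omega_sum M k l : (k < M)%N ->
  \sum_(j < M) (omega M ^+ (j * k))^-1 * omega M ^+ (j * l) =
  if (l %% M == k)%N then M%:R else 0.
Proof.
move=> kM; have M0 : (0 < M)%N by rewrite (leq_trans _ kM).
pose w := omega M; have w0 : w != 0 := omega_neq0 M.
have wM : w ^+ M = 1 := omegaM M0.
have wl : w ^+ l = w ^+ (l %% M).
  by rewrite {1}(divn_eq l M) exprD mulnC exprM wM expr1n mul1r.
pose x := w ^+ (l %% M) / w ^+ k.
have -> : \sum_(j < M) (w ^+ (j * k))^-1 * w ^+ (j * l) = \sum_(j < M) x ^+ j.
  apply: eq_bigr => j _; rewrite ![(j * _)%N]mulnC !exprM wl /x expr_div_n.
  by rewrite mulrC.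
case: eqP => [lk|/eqP lk].
  rewrite /x lk divff ?expf_neq0//.
  under eq_bigr do rewrite expr1n.
  by rewrite sumr_const card_ord.
have xM : x ^+ M = 1 by rewrite /x expr_div_n -!exprM ![(_ * M)%N]mulnC !exprM wM !expr1n divr1.
have x1 : x != 1.
  have wk0 n : w ^+ n != 0 by rewrite expf_neq0.
  rewrite /x; apply/eqP => /divr1_eq; apply/eqP.
  have lM : (l %% M < M)%N by rewrite ltn_mod.
  have [lt|gt|eq] := ltngtP (l %% M) k; last by rewrite eq eqxx in lk.
    rewrite -(subnK (ltnW lt)) exprD -{1}[w ^+ _]mul1r eq_sym.
    rewrite (inj_eq (mulIf _))//; apply: omega_neq1.
    by rewrite subn_gt0 lt (leq_ltn_trans (leq_subr _ _)).
  rewrite -(subnK (ltnW gt)) exprD -[X in _ != X]mul1r.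
  rewrite (inj_eq (mulIf _))//; apply: omega_neq1.
  by rewrite subn_gt0 gt (leq_ltn_trans (leq_subr _ _)).
have : (x - 1) * \sum_(j < M) x ^+ j = 0 by rewrite -subrX1 xM subrr.
by move/eqP; rewrite mulf_eq0 subr_eq0 (negbTE x1) => /eqP.
Qed.

(** For k < M this keeps of a power series the terms of degree k, k + M, k + 2 M, ...; as M grows
    only the term of degree k survives. *)
Definition avg M k g z : C :=
  M%:R^-1 * \sum_(j < M) (omega M ^+ (j * k))^-1 * g (omega M ^+ j * z).

Lemma avg_psum c M k N z : (k < M)%N ->
  avg M k (psum c N) z = \sum_(l < N | (l %% M == k)%N) c l * z ^+ l.
Proof.
move=> kM; have M0 : (0 < M)%N by rewrite (leq_trans _ kM).
have Mn0 : M%:R != 0 :> C by rewrite pnatr_eq0 -lt0n.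
rewrite /avg /psum.
under eq_bigr do rewrite mulr_sumr.
rewrite exchange_big /= mulr_sumr [RHS]big_mkcond /=.
apply: eq_bigr => l _.
have -> : \sum_(j < M) (omega M ^+ (j * k))^-1 * (c l * (omega M ^+ j * z) ^+ l) =
  c l * z ^+ l * \sum_(j < M) (omega M ^+ (j * k))^-1 * omega M ^+ (j * l).
  rewrite mulr_sumr; apply: eq_bigr => j _; rewrite exprMn -exprM; ring.
rewrite omega_sum//; case: ifP => _; last by rewrite !mulr0.
by rewrite mulrC mulfK.
Qed.

Lemma normc_nat M : normc (M%:R : C) = M%:R.
Proof. by rewrite -(rmorph_nat (real_complex R)) normc_real ger0_norm. Qed.

Lemma avgB M k g1 g2 z : avg M k g1 z - avg M k g2 z = avg M k (fun z => g1 z - g2 z) z.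
Proof.
rewrite /avg -mulrBr -sumrB; congr (_ * _).
by apply: eq_bigr => j _; rewrite -mulrBr.
Qed.

Lemma normc_avg M k g z (B : R) : (0 < M)%N ->
  (forall w, normc w = normc z -> normc (g w) <= B) -> normc (avg M k g z) <= B.
Proof.
move=> M0 gB; rewrite /avg normcM normcV normc_nat mulrC.
rewrite ler_pdivrMr ?ltr0n//; apply: le_trans (normc_sum _ _ _) _.
apply: le_trans (_ : \sum_(j < M) B <= _).
  apply: ler_sum => j _; rewrite normcM normcV normcX normc_omega expr1n invr1 mul1r.
  by apply: gB; rewrite normcM normcX normc_omega expr1n mul1r.
by rewrite sumr_const card_ord mulr_natr.
Qed.

Lemma psum_tail c (r B : R) z n N : 0 < r ->
  (forall k, normc (c k) * r ^+ k <= B) -> normc z < r -> (n <= N)%N ->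
  normc (psum c N z - psum c n z) <= B * ((normc z / r) ^+ n / (1 - normc z / r)).
Proof.
move=> r0 cB zr nN; have B0 : 0 <= B.
  by apply: le_trans (cB 0%N); rewrite mulr_ge0 ?normc_ge0 ?exprn_ge0// ltW.
have t01 : 0 <= normc z / r < 1.
  by rewrite divr_ge0 ?normc_ge0 ?(ltW r0)//= ltr_pdivrMr// mul1r.
have -> : psum c N z - psum c n z = \sum_(n <= l < N) c l * z ^+ l.
  rewrite /psum -!(big_mkord xpredT (fun l => c l * z ^+ l)).
  by rewrite (@big_cat_nat _ _ _ n 0 N)//= addrAC subrr add0r.
apply: le_trans (normc_sum _ _ _) _.
apply: le_trans (ler_wpM2l B0 (geometric_tail n N t01)).
rewrite mulr_sumr; apply: ler_sum => l _.
rewrite normcM normcX expr_div_n mulrA mulrAC ler_wpM2r ?exprn_ge0 ?normc_ge0//.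
by rewrite ler_pdivlMr ?exprn_gt0// cB.
Qed.

(** The constant K of [power_series] depends on z. Comparison with a much longer partial sum
    replaces it by the Cauchy estimates, which are uniform on |z| <= s. *)
Lemma psum_approx g (R0 r s B : R) : (forall z, normc z < R0 -> cdiff g z) ->
  0 < r < R0 -> (forall z, normc z = r -> normc (g z) <= B) -> 0 <= s < r ->
  exists2 c, (forall k, normc (c k) * r ^+ k <= 2 * B) &
  forall z N, normc z <= s ->
    normc (g z - psum c N z) <= 2 * B / (1 - s / r) * (s / r) ^+ N.
Proof.
move=> dg /[dup] r0R /andP[r0 rR] gB /andP[s0 sr].
have [c [cB cg]] := power_series dg r0R gB; exists c => //.
have B0 : 0 <= 2 * B.
  by apply: le_trans (cB 0%N); rewrite mulr_ge0 ?normc_ge0 ?exprn_ge0// ltW.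
pose t := s / r; have /andP[t0 t1] : 0 <= t < 1.
  by rewrite /t divr_ge0 ?(ltW r0)//= ltr_pdivrMr// mul1r.
move=> v N vs; have vr : normc v < r by exact: le_lt_trans sr.
have [K hK] := cg _ vr.
have v01 : 0 <= normc v / r < 1.
  by rewrite divr_ge0 ?normc_ge0 ?(ltW r0)//= ltr_pdivrMr// mul1r.
have /andP[v0 v1] := v01.
have vt : normc v / r <= t by rewrite /t ler_pM2r ?invr_gt0.
apply/ler_addgt0Pl => e e0.
have [n0 hn0] := geometric_small K v01 e0.
pose n := maxn n0 N.
have -> : g v - psum c N v = (g v - psum c n.+1 v) + (psum c n.+1 v - psum c N v) by ring.
apply: le_trans (normcD _ _) _; apply: lerD.
  by apply: le_trans (hK n) _; apply: hn0; rewrite leqW// leq_maxl.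
apply: le_trans (psum_tail r0 cB vr _) _; first by rewrite leqW// leq_maxr.
rewrite mulrA [leRHS]mulrAC -/t; apply: ler_pM.
- by rewrite mulr_ge0// exprn_ge0.
- by rewrite invr_ge0; lra.
- by rewrite ler_wpM2l// lerXn2r// nnegrE.
- by rewrite lef_pV2 ?posrE; lra.
Qed.

(** With t = s / r, and up to the distance of g from a partial sum, the average consists of the term
    of degree k, which is homogeneous and of size t^k, and of terms of degree at least M, which
    together have size t^M. *)
Lemma avg_bounds g (R0 r s B : R) : (forall z, normc z < R0 -> cdiff g z) ->
  0 < r < R0 -> (forall z, normc z = r -> normc (g z) <= B) -> 0 <= s < r ->
  forall M k z, (k < M)%N -> normc z <= s ->
  [/\ normc (avg M k g z) <= 4 * B / (1 - s / r) * (s / r) ^+ k,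
    forall w, normc w <= 1 ->
      normc (avg M k g (w * z) - w ^+ k * avg M k g z) <=
        4 * B / (1 - s / r) * (s / r) ^+ M &
    forall M', (k < M')%N -> normc (avg M k g z - avg M' k g z) <=
        4 * B / (1 - s / r) * ((s / r) ^+ M + (s / r) ^+ M')].
Proof.
move=> dg /[dup] r0R /andP[r0 rR] gB /[dup] s0r /andP[s0 sr] M k z kM zs.
have M0 : (0 < M)%N by rewrite (leq_trans _ kM).
have [c cB near] := psum_approx dg r0R gB s0r.
have B0 : 0 <= 2 * B.
  by apply: le_trans (cB 0%N); rewrite mulr_ge0 ?normc_ge0 ?exprn_ge0// ltW.
pose t := s / r; have t01 : 0 <= t < 1.
  by rewrite /t divr_ge0 ?(ltW r0)//= ltr_pdivrMr// mul1r.
have /andP[t0 t1] := t01; have t1' : 0 < 1 - t by lra.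
pose D := 2 * B / (1 - t).
have D0 : 0 <= D by rewrite divr_ge0// ltW.
have tN N : 0 <= t ^+ N by rewrite exprn_ge0.
have navg M' v N : (0 < M')%N -> normc v <= s ->
    normc (avg M' k g v - avg M' k (psum c N) v) <= D * t ^+ N.
  by move=> M'0 vs; rewrite avgB; apply: normc_avg => // v' v'v; apply: near; rewrite v'v.
have cl l v : normc v <= s -> normc (c l * v ^+ l) <= 2 * B * t ^+ l.
  move=> vs; rewrite normcM normcX /t expr_div_n mulrA mulrAC.
  apply: ler_pM; rewrite ?normc_ge0 ?exprn_ge0 ?normc_ge0//.
    by rewrite ler_pdivlMr ?exprn_gt0// cB.
  by rewrite lerXn2r ?nnegrE ?normc_ge0.
(* Lets the length N of the partial sum tend to infinity. *)
have small (a b : R) : (forall N, a <= b + D * t ^+ N) -> a <= b.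
  move=> h; apply/ler_addgt0Pr => e e0; have [N hN] := geometric_small D t01 e0.
  by apply: le_trans (h N) _; rewrite lerD2l hN.
have big2D : D <= 4 * B / (1 - t).
  by rewrite /D ler_wpM2r ?invr_ge0 ?(ltW t1')//; lra.
split; last first.
- move=> M' kM'; have M'0 : (0 < M')%N by rewrite (leq_trans _ kM').
  (* Both averages are compared with their common limit, the term of degree k. *)
  have lim M1 : (k < M1)%N -> normc (avg M1 k g z - c k * z ^+ k) <= 2 * D * t ^+ M1.
    move=> kM1; have M10 : (0 < M1)%N by rewrite (leq_trans _ kM1).
    apply: small => N0; pose N := (N0 + M1)%N.
    have NM1 : (M1 <= N)%N by rewrite leq_addl.
    have h1 : normc (avg M1 k g z - avg M1 k (psum c N) z) <= D * t ^+ N0.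
      apply: le_trans (navg _ _ N M10 zs) _; rewrite ler_wpM2l// /N exprD.
      by rewrite ler_piMr// exprn_ile1// ltW.
    have -> : avg M1 k g z - c k * z ^+ k = (avg M1 k (psum c N) z - c k * z ^+ k) +
      (avg M1 k g z - avg M1 k (psum c N) z) by ring.
    apply: le_trans (normcD _ _) _; apply: lerD => //.
    apply: (@le_trans _ _ (D * t ^+ M1)); last first.
      by have : 0 <= D * t ^+ M1 by [rewrite mulr_ge0]; lra.
    have kN : (k < N)%N := leq_trans kM1 NM1.
    rewrite avg_psum// (bigD1 (Ordinal kN)) /= ?modn_small//.
    rewrite addrAC subrr add0r.
    apply: le_trans (normc_sum _ _ _) _.
    apply: (@le_trans _ _ (\sum_(M1 <= l < N) 2 * B * t ^+ l)); last first.
      by rewrite -mulr_sumr /D [leRHS]mulrAC -[leRHS]mulrA ler_wpM2l//; exact: geometric_tail.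
    rewrite big_geq_mkord; apply: (@le_trans _ _ (\sum_(l < N | (M1 <= l)%N) normc (c l * z ^+ l))).
      rewrite [leLHS]big_mkcond [leRHS]big_mkcond; apply: ler_sum => l _.
      case: ifP => [/andP[/eqP lk lk']|_]; last by case: ifP => // _; exact: normc_ge0.
      rewrite ifT// leqNgt; apply/negP => lM.
      by move: lk'; rewrite -val_eqE /= -lk modn_small// eqxx.
    by apply: ler_sum => l _; exact: cl.
  have -> : avg M k g z - avg M' k g z =
    (avg M k g z - c k * z ^+ k) - (avg M' k g z - c k * z ^+ k) by ring.
  apply: le_trans (normcB _ _) _; apply: le_trans (lerD (lim M kM) (lim M' kM')) _.
  by rewrite /D -/t; lra.
- move=> w w1.
  have wzs : normc (w * z) <= s.
    by rewrite normcM; apply: le_trans zs; rewrite ler_piMl ?normc_ge0.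
  have wX n : normc (w ^+ n) <= 1 by rewrite normcX exprn_ile1// normc_ge0.
  suff H N : normc (avg M k (psum c N) (w * z) - w ^+ k * avg M k (psum c N) z) <=
      4 * B / (1 - t) * t ^+ M.
    have {}small (a b : R) : (forall N, a <= b + (D * t ^+ N + D * t ^+ N)) -> a <= b.
      move=> h; apply/ler_addgt0Pr => e e0.
      have e2 : 0 < e / 2 by lra.
      have [N hN] := geometric_small D t01 e2.
      by apply: le_trans (h N) _; rewrite lerD2l; have := hN N (leqnn _); lra.
    apply: small => N.
    have -> : avg M k g (w * z) - w ^+ k * avg M k g z =
      (avg M k (psum c N) (w * z) - w ^+ k * avg M k (psum c N) z) +
      ((avg M k g (w * z) - avg M k (psum c N) (w * z)) -
       w ^+ k * (avg M k g z - avg M k (psum c N) z)) by ring.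
    apply: le_trans (normcD _ _) _; apply: lerD => //.
    apply: le_trans (normcB _ _) _; apply: lerD; first exact: navg.
    rewrite normcM; apply: le_trans (navg _ _ N M0 zs).
    by rewrite ler_piMl ?normc_ge0.
  rewrite !avg_psum// mulr_sumr -sumrB.
  apply: le_trans (normc_sum _ _ _) _.
  apply: le_trans (_ : \sum_(M <= l < N) 4 * B * t ^+ l <= _); last first.
    rewrite -mulr_sumr [leRHS]mulrAC -[leRHS]mulrA ler_wpM2l//; last exact: geometric_tail.
    by lra.
  have term l : (l %% M == k)%N ->
      normc (c l * (w * z) ^+ l - w ^+ k * (c l * z ^+ l)) <=
      if (M <= l)%N then 4 * B * t ^+ l else 0.
    move=> /eqP lk; case: leqP => [Ml|lM]; last first.
      move: lk; rewrite modn_small// => ->.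
      by rewrite exprMn mulrCA subrr normc0.
    have -> : c l * (w * z) ^+ l - w ^+ k * (c l * z ^+ l) =
      w ^+ l * (c l * z ^+ l) - w ^+ k * (c l * z ^+ l) by rewrite exprMn; ring.
    apply: le_trans (normcB _ _) _; rewrite !(normcM (w ^+ _)).
    have h := cl l z zs.
    have : normc (w ^+ l) * normc (c l * z ^+ l) <= normc (c l * z ^+ l).
      by rewrite ler_piMl ?normc_ge0.
    have : normc (w ^+ k) * normc (c l * z ^+ l) <= normc (c l * z ^+ l).
      by rewrite ler_piMl ?normc_ge0.
    by lra.
  apply: le_trans (_ : \sum_(l < N) (if (M <= l)%N then 4 * B * t ^+ l else 0) <= _).
    rewrite big_mkcond /=; apply: ler_sum => l _; case: ifP => [/term//|_].
    by case: ifP => // _; rewrite mulr_ge0//; lra.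
  rewrite -(big_mkord xpredT (fun l => if (M <= l)%N then 4 * B * t ^+ l else 0)).
  have [NM|MN] := leqP N M.
    rewrite [leRHS]big_geq// big_nat_cond big1// => l /andP[/andP[_ lN] _].
    by rewrite leqNgt (leq_trans lN NM).
  rewrite (@big_cat_nat _ _ _ M)//=; last exact: ltnW.
  rewrite [X in X + _]big_nat_cond big1 ?add0r; last first.
    by move=> l /andP[/andP[_ lk'] _]; rewrite leqNgt lk'.
  rewrite big_nat_cond [leRHS]big_nat_cond; apply: ler_sum => l /andP[/andP[-> _] _].
  by [].
- apply: small => N.
  rewrite -(subrK (avg M k (psum c N) z) (avg M k g z)).
  apply: le_trans (normcD _ _) _; rewrite addrC; apply: lerD; last exact: navg.
  rewrite avg_psum//; apply: le_trans (normc_sum _ _ _) _.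
  apply: le_trans (_ : D * t ^+ k <= _); last by rewrite ler_wpM2r.
  apply: le_trans (_ : \sum_(k <= l < N) 2 * B * t ^+ l <= _); last first.
    rewrite -mulr_sumr /D [leRHS]mulrAC -[leRHS]mulrA ler_wpM2l//; exact: geometric_tail.
  rewrite -(big_mkord (fun l => l %% M == k)%N (fun l => normc (c l * z ^+ l))).
  have [Nk|kN] := leqP N k.
    rewrite [leRHS]big_geq// big_nat_cond big1// => l /andP[/andP[_ lN] /eqP lk].
    by move: (leq_mod l M); rewrite lk leqNgt (leq_trans lN Nk).
  rewrite (@big_cat_nat _ _ _ k)//=; last exact: ltnW.
  rewrite [X in X + _]big_nat_cond big1 ?add0r; last first.
    move=> l /andP[/andP[_ lk'] /eqP lk].
    by move: (leq_mod l M); rewrite lk leqNgt lk'.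
  rewrite big_mkcond /=; apply: ler_sum => l _; case: ifP => _; first exact: cl.
  by rewrite mulr_ge0.
Qed.

End RootsOfUnity.

(** * Rotation invariance and finiteness of the weighted measure *)

Section Translation.
Variable R : realType.
Notation mu := (@lebesgue_measure R).

Lemma measurable_affine (s a : R) :
  measurable_fun setT ((fun x => s * x + a) : measurableTypeR R -> measurableTypeR R).
Proof. by apply: measurable_funD => //; apply: measurable_funM. Qed.

(** By uniqueness half-open intervals suffice; a reflection exchanges their open and closed ends but
    keeps the length. Shears use s = 1, and the reflection s = -1 is used in [pospow_slice]. *)
Lemma lebesgue_affine (s a : R) (A : set (measurableTypeR R)) : `|s| = 1 ->
  measurable A -> mu ((fun x => s * x + a) @^-1` A) = mu A.
Proof.
move=> s1 mA; apply/esym.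
have H := @lebesgue_measure_unique R
  (measure_function_pushforward__canonical__measure_function_Measure
     mu (measurable_affine s a)).
rewrite (H _ _ mA)// => X -[[b c] /= bc <-]; rewrite /pushforward.
have -> : mu `]b, c]%classic = if b < c then (c - b)%:E else 0%E.
  by rewrite lebesgue_measure_itv /= lte_fin; case: ifP.
have [s0|s0] := leP 0 s.
  have {}s1 : s = 1 by rewrite -s1 ger0_norm.
  rewrite (_ : _ @^-1` _ = `]b - a, c - a]%classic); last first.
    by apply/seteqP; split => x /=; rewrite !in_itv /= s1; lra.
  rewrite lebesgue_measure_itv /= lte_fin ltrD2r; case: ifP => //.
  by move=> _; rewrite -EFinB; congr (_%:E); ring.
have {}s1 : s = -1 by move: s1; rewrite ltr0_norm// => <-; rewrite opprK.
rewrite (_ : _ @^-1` _ = `[a - c, a - b[%classic); last first.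
  by apply/seteqP; split => x /=; rewrite !in_itv /= s1; lra.
rewrite lebesgue_measure_itv /= lte_fin ltrD2l ltrN2; case: ifP => //.
by move=> _; rewrite -EFinB; congr (_%:E); ring.
Qed.

Lemma integral_affine (s a : R) (f : measurableTypeR R -> \bar R) : `|s| = 1 ->
  measurable_fun setT f -> (forall x, 0 <= f x)%E ->
  (\int[mu]_x f (s * x + a)%R = \int[mu]_x f x)%E.
Proof.
move=> s1 mf f0; have mphi := measurable_affine s a.
have := ge0_integral_pushforward mphi mu measurableT mf (fun x _ => f0 x).
rewrite preimage_setT => <-.
apply: (@eq_measure_integral _ _ _ _ mu
   (measure_function_pushforward__canonical__measure_function_Measure
     mu mphi)) => A mA _.
exact: lebesgue_affine.
Qed.

End Translation.

(** * Rotations of the coordinates preserve Lebesgue measure *)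

Section Rotation.
Variable R : realType.
Notation RR := (RR R).
Notation mu := (@lebesgue_measure R).
Notation area := (@area R).
Notation C := R[i].

Definition cmul (c : C) (p : RR) : RR :=
  (complex.Re c * p.1 - complex.Im c * p.2, complex.Re c * p.2 + complex.Im c * p.1).

(** Phrased with integrals of nonnegative functions instead of measures of sets, so that it combines
    directly with Tonelli's theorem. *)
Definition preserves d (T : measurableType d) (m : {measure set T -> \bar R})
    (phi : T -> T) : Prop :=
  measurable_fun setT phi /\
  forall f : T -> \bar R, measurable_fun setT f -> (forall x, 0 <= f x)%E ->
    (\int[m]_x f (phi x) = \int[m]_x f x)%E.

Lemma preserves_comp d (T : measurableType d) (m : {measure set T -> \bar R})
    (phi psi : T -> T) :
  preserves m phi -> preserves m psi -> preserves m (psi \o phi).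
Proof.
move=> [mphi h1] [mpsi h2]; split; first exact: measurableT_comp.
move=> f mf f0; rewrite -(h2 f)//.
by apply: (h1 (f \o psi)) => [|x]; [exact: measurableT_comp mf mpsi|exact: f0].
Qed.

Definition shear2 (a : R) (p : RR) : RR := (p.1, p.2 + a * p.1).
Definition shear1 (a : R) (p : RR) : RR := (p.1 + a * p.2, p.2).

Lemma measurable_shear2 a : measurable_fun setT (shear2 a).
Proof.
apply: measurable_fun_pair => //.
by apply: measurable_funD => //; apply: measurable_funM.
Qed.

Lemma measurable_shear1 a : measurable_fun setT (shear1 a).
Proof.
apply: measurable_fun_pair => //.
by apply: measurable_funD => //; apply: measurable_funM.
Qed.

(** For a fixed first coordinate a shear is a translation of the second, so Tonelli's theorem
    reduces the claim to [integral_affine]. *)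
Lemma preserves_shear2 a : preserves area (shear2 a).
Proof.
split; first exact: measurable_shear2.
move=> f mf f0.
have mf' : measurable_fun setT (f \o shear2 a).
  exact: measurableT_comp mf (measurable_shear2 a).
rewrite [LHS](@fubini_tonelli1 _ _ _ _ R mu mu (f \o shear2 a) mf' (fun p => f0 _)).
rewrite [RHS](@fubini_tonelli1 _ _ _ _ R mu mu f mf f0).
apply: eq_integral => x _; rewrite /fubini_F /shear2 /=.
have mfx : measurable_fun setT (fun y => f (x, y)).
  exact: measurableT_comp mf (measurable_pair1 x).
rewrite -(integral_affine (a * x) (normr1 R) mfx (fun y => f0 (x, y))).
by apply: eq_integral => y _; rewrite mul1r.
Qed.

Lemma preserves_shear1 a : preserves area (shear1 a).
Proof.
split; first exact: measurable_shear1.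
move=> f mf f0.
have mf' : measurable_fun setT (f \o shear1 a).
  exact: measurableT_comp mf (measurable_shear1 a).
rewrite [LHS](@fubini_tonelli2 _ _ _ _ R mu mu (f \o shear1 a) mf' (fun p => f0 _)).
rewrite [RHS](@fubini_tonelli2 _ _ _ _ R mu mu f mf f0).
apply: eq_integral => y _; rewrite /fubini_G /shear1 /=.
have mfy : measurable_fun setT (fun x => f (x, y)).
  exact: measurableT_comp mf (measurable_pair2 y).
rewrite -(integral_affine (a * y) (normr1 R) mfy (fun x => f0 (x, y))).
by apply: eq_integral => x _; rewrite mul1r.
Qed.

(* A rotation of angle t <> pi is the product of the shears of parameters
   - tan (t / 2), sin t and - tan (t / 2) *)
Lemma preserves_cmul (c : C) : normc c = 1 -> preserves area (cmul c).
Proof.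
suff H (b : C) : normc b = 1 -> complex.Re b != -1 -> preserves area (cmul b).
  move=> c1; have [cN|] := eqVneq (complex.Re c) (-1); last exact: H.
  have cI : complex.Im c = 0.
    have := normc_sqr c; rewrite c1 cN sqrrN expr1n => h.
    by apply/eqP; rewrite -sqrf_eq0; apply/eqP; lra.
  have -> : cmul c = cmul 'i%C \o cmul 'i%C.
    by apply/funext => -[x y]; rewrite /cmul /= cN cI; congr pair; ring.
  by apply: preserves_comp; apply: H; rewrite ?normc_i//= gt_eqF// ltrN10.
move=> b1 bN; set a := complex.Re b in bN *; pose s := complex.Im b.
have as1 : a ^+ 2 + s ^+ 2 = 1 by rewrite -normc_sqr b1 expr1n.
have a1 : 1 + a != 0 by rewrite addrC -(opprK 1) subr_eq0.
pose t := s / (1 + a).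
have -> : cmul b = shear1 (- t) \o (shear2 s \o shear1 (- t)).
  apply/funext => -[x y]; rewrite /cmul /shear1 /shear2 /= -/a -/s.
  have ts : t * s = 1 - a.
    apply: (mulIf a1); rewrite /t mulrAC divfK//.
    by rewrite -expr2; lra.
  have ta : t * (1 + a) = s by rewrite /t divfK.
  congr pair; first last.
    have -> : y + s * (x + - t * y) = y - (t * s) * y + s * x by ring.
    by rewrite ts; ring.
  have -> : x + - t * y + - t * (y + s * (x + - t * y)) =
     x - t * s * x - t * y * (2 - t * s) by ring.
  have -> : t * y * (2 - t * s) = y * (t * (1 + a)) by rewrite ts; ring.
  by rewrite ta ts; ring.
apply: preserves_comp; last exact: preserves_shear1.
apply: preserves_comp; [exact: preserves_shear1|exact: preserves_shear2].
Qed.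

(* The family c is indexed by nat so that inductions on n need no casts. *)
Definition rotx n (c : nat -> C) (x : n.-tuple RR) : n.-tuple RR :=
  [tuple cmul (c i) (tnth x i) | i < n].

Lemma measurable_cmul c : measurable_fun setT (cmul c).
Proof.
apply: measurable_fun_pair.
  by apply: measurable_funB; apply: measurable_funM => //.
by apply: measurable_funD; apply: measurable_funM => //.
Qed.

Lemma measurable_rotx n c : measurable_fun setT (@rotx n c).
Proof.
apply/measurable_fun_tnthP => i.
rewrite (_ : _ \o _ = cmul (c i) \o (fun x : n.-tuple RR => tnth x i)).
  exact: measurableT_comp (measurable_cmul _) (measurable_tnth i).
by apply/funext => x; rewrite /= tnth_mktuple.
Qed.

Lemma rotx_cons n c (p : RR * n.-tuple RR) :
  rotx c (cons_pair p) = cons_pair (cmul (c 0%N) p.1, rotx (fun i => c i.+1) p.2).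
Proof.
apply: eq_from_tnth => i; rewrite tnth_mktuple.
case: (unliftP ord0 i) => [j ->|->].
  by rewrite /cons_pair /= !tnthS tnth_mktuple.
by rewrite /cons_pair /= !tnth0.
Qed.

Lemma integral_lebesgue_CnS n (f : n.+1.-tuple RR -> \bar R) :
  measurable_fun setT f -> (forall x, 0 <= f x)%E ->
  (\int[lebesgue_Cn R n.+1]_x f x =
   \int[area]_p \int[lebesgue_Cn R n]_t f (cons_pair (p, t)))%E.
Proof.
move=> mf f0.
have mc := @measurable_cons_pair _ RR n.
have := ge0_integral_pushforward mc (area \x lebesgue_Cn R n)%E measurableT mf (fun x _ => f0 x).
rewrite preimage_setT => E; rewrite [LHS]E.
have mfc : measurable_fun setT (f \o @cons_pair _ RR n) by exact: measurableT_comp mf mc.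
by rewrite (fubini_tonelli1 _ mfc (fun p => f0 _)).
Qed.

Lemma preserves_rotx n (c : nat -> C) : (forall i, normc (c i) = 1) ->
  preserves (lebesgue_Cn R n) (rotx c).
Proof.
elim: n c => [|n IH] c c1; split; try exact: measurable_rotx.
  by move=> f mf f0; apply: eq_integral => x _; rewrite [rotx c x]tuple0 [x in RHS]tuple0.
move=> f mf f0.
have mfr : measurable_fun setT (f \o rotx c) := measurableT_comp mf (measurable_rotx c).
rewrite [LHS](integral_lebesgue_CnS mfr (fun x => f0 _)) [RHS](integral_lebesgue_CnS mf f0).
have [_ hn] := IH (fun i => c i.+1) (fun i => c1 i.+1).
have [_ h1] := preserves_cmul (c1 0%N).
pose F p := (\int[lebesgue_Cn R n]_t f (cons_pair (p, t)))%E.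
have mfc : measurable_fun setT (f \o @cons_pair _ RR n).
  exact: measurableT_comp mf (@measurable_cons_pair _ RR n).
have mF : measurable_fun setT F.
  exact: (measurable_fun_fubini_tonelli_F (f \o @cons_pair _ RR n) mfc (fun p => f0 _)).
rewrite -[RHS](h1 F)//; last by move=> p; apply: integral_ge0.
apply: eq_integral => p _; rewrite /F.
have mft : measurable_fun setT (fun t => f (cons_pair (cmul (c 0%N) p, t))).
  exact: measurableT_comp mfc (measurable_pair1 _).
rewrite -(hn _ mft (fun t => f0 _)).
by apply: eq_integral => t _; rewrite -(rotx_cons c (p, t)).
Qed.

End Rotation.

(** * Integrals of powers of the distance to the sphere *)

Section PowerIntegrals.
Variable R : realType.
Notation mu := (@lebesgue_measure R).
Implicit Types (a s u x : R).

Lemma continuous_powR a x : 0 < x -> {for x, continuous (@powR R ^~ a)}.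
Proof.
move=> x0; apply: differentiable_continuous; apply/derivable1_diffP.
have H : is_derive x 1 (@powR R ^~ a) (a * x `^ (a - 1)) by exact: is_derive1_powR.
by case: H.
Qed.

Lemma integral_powR_segment a s e : -1 < a -> 0 < e -> e < s ->
  (\int[mu]_(x in `[e, s]) (x `^ a)%:E <= (s `^ (a + 1) / (a + 1))%:E)%E.
Proof.
move=> a1 e0 es; have a10 : 0 < a + 1 by lra.
pose F x := x `^ (a + 1) / (a + 1).
have dF x : 0 < x -> is_derive x 1 F (x `^ a).
  move=> x0; have -> : x `^ a = (a + 1)^-1 * ((a + 1) * x `^ (a + 1 - 1)).
    by rewrite mulrA mulVf ?lt0r_neq0// mul1r addrK.
  rewrite /F (_ : (fun x => _) = (a + 1)^-1 *: (@powR R ^~ (a + 1))); last first.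
    by apply/funext => y; rewrite /= mulrC.
  by apply: is_deriveZ; exact: is_derive1_powR.
have cf : {within `[e, s], continuous (@powR R ^~ a)}.
  apply: continuous_in_subspaceT => x; rewrite inE /= in_itv /= => /andP[ex _].
  by apply: continuous_powR; exact: lt_le_trans ex.
have dFoo : derivable_oo_LRcontinuous F e s.
  have cF x : 0 < x -> {for x, continuous F}.
    move=> x0; apply: differentiable_continuous; apply/derivable1_diffP.
    by case: (dF _ x0).
  split.
  - by move=> x; rewrite in_itv /= => /andP[ex _]; case: (dF x (lt_trans e0 ex)).
  - by apply: cvg_at_right_filter; exact: cF.
  - by apply: cvg_at_left_filter; apply: cF; exact: lt_trans es.
have dFE : {in `]e, s[, derive1 F =1 (@powR R ^~ a)}.
  move=> x; rewrite in_itv /= => /andP[ex _].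
  by rewrite derive1E; have H := dF x (lt_trans e0 ex); exact: derive_val.
rewrite (continuous_FTC2 es cf dFoo dFE).
by rewrite -EFinB lee_fin gerBl /F divr_ge0 ?powR_ge0// ltW.
Qed.

Lemma integral_powR_0 a s : -1 < a -> 0 < s ->
  (\int[mu]_(x in `]0%R, s]) (x `^ a)%:E <= (s `^ (a + 1) / (a + 1))%:E)%E.
Proof.
(* Monotone convergence along [s / (i + 2), s]; the shift by 2 keeps the left end strictly below
   s. *)
move=> a1 s0; pose F (i : nat) : set R := `[s / (i.+2)%:R, s]%classic.
have -> : (`]0, s]%classic : set R) = \bigcup_i F i.
  apply/seteqP; split => x.
    rewrite /= in_itv /= => /andP[x0 xs]; exists (Num.bound (s / x)) => //.
    rewrite /F /= in_itv /= xs andbT ler_pdivrMr ?ltr0n//.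
    rewrite mulrC -ler_pdivrMr//; apply: ltW.
    apply: lt_le_trans (archi_boundP _) _; first by rewrite divr_ge0 ?ltW.
    by rewrite ler_nat; apply/leqW/leqW.
  move=> [i _]; rewrite /F /= !in_itv /= => /andP[x1 ->]; rewrite andbT.
  by apply: lt_le_trans x1; rewrite divr_gt0 ?ltr0n.
have mpow : measurable_fun setT (fun x => (x `^ a)%:E).
  by apply/measurable_EFinP; exact: measurable_powR.
have cv : (\int[mu]_(x in F i) (x `^ a)%:E @[i --> \oo] -->
    \int[mu]_(x in \bigcup_i F i) (x `^ a)%:E)%E.
  apply: ge0_nondecreasing_set_cvg_integral.
  - apply/nondecreasing_seqP => i; rewrite subsetEset /F; apply: subset_itvr.
    by rewrite bnd_simp ler_pM2l// lef_pV2 ?posrE ?ltr0n// ler_nat.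
  - by move=> i; exact: measurable_itv.
  - by move=> i; apply: measurable_funTS.
  - by move=> i x _; rewrite lee_fin powR_ge0.
rewrite -(cvg_lim (@ereal_hausdorff R) cv); apply: lime_le; first by apply/cvg_ex; eexists; exact: cv.
near=> i; apply: integral_powR_segment => //; first by rewrite divr_gt0 ?ltr0n.
by rewrite ltr_pdivrMr ?ltr0n// ltr_pMr// ltr1n.
Unshelve. all: by end_near. Qed.

(** The power is cut off at u <= 0, where [powR] itself need not vanish; integrals over a ball
    thereby become integrals over the whole space. *)
Definition pospow u a : R := \1_(`]0, +oo[%classic : set R) u * u `^ a.

Lemma pospow_pos u a : 0 < u -> pospow u a = u `^ a.
Proof. by move=> u0; rewrite /pospow indicE mem_set ?mul1r//= in_itv /= u0. Qed.

Lemma pospow_neg u a : u <= 0 -> pospow u a = 0.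
Proof.
move=> u0; rewrite /pospow indicE memNset ?mul0r//= in_itv /= andbT.
by rewrite ltNge u0.
Qed.

Lemma pospow_ge0 u a : 0 <= pospow u a.
Proof. by rewrite mulr_ge0 ?powR_ge0// indicE. Qed.

Lemma measurable_pospow a : measurable_fun setT (fun u => pospow u a).
Proof.
by apply: measurable_funM; [exact: measurable_indic|exact: measurable_powR].
Qed.

Lemma measurable_pospow_comp d (T : measurableType d) (f : T -> R) a :
  measurable_fun setT f -> measurable_fun setT (fun p => (pospow (f p) a)%:E).
Proof.
move=> mf; apply/measurable_EFinP.
exact: measurableT_comp (measurable_pospow a) mf.
Qed.

Lemma measurable_subsqr u : measurable_fun setT ((fun x => u - x ^+ 2) : measurableTypeR R -> R).
Proof.
apply: measurable_funB => //; exact: (measurable_funX 2 (@measurable_id _ _ _)).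
Qed.

(** With s = sqrt u the integrand lives on |x| < s. For a >= 0 it is at most u^a there. For a < 0 it
    is unbounded; in u - x^2 = (s - x) (s + x) one factor is at least s, depending on the sign of x,
    and the power of the other one is integrable by [integral_powR_0]. *)
Lemma pospow_slice a : -1 < a -> exists2 K : R, 0 <= K & forall u,
  (\int[mu]_x (pospow (u - x ^+ 2) a)%:E <= (K * pospow u (a + 2^-1))%:E)%E.
Proof.
move=> a1; have a10 : 0 < a + 1 by lra.
have nonpos K u : u <= 0 ->
    (\int[mu]_x (pospow (u - x ^+ 2) a)%:E <= (K * pospow u (a + 2^-1))%:E)%E.
  move=> u0; rewrite integral0_eq; first by rewrite pospow_neg// mulr0.
  by move=> x _; rewrite pospow_neg//; have := sqr_ge0 x; lra.
have sqrtE u : 0 < u -> u `^ 2^-1 = Num.sqrt u by move=> u0; rewrite powR12_sqrt ?ltW.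
have [a0|a0] := leP 0 a.
  exists 2 => // u; have [u0|u0] := leP u 0; first exact: nonpos.
  pose s := Num.sqrt u; have s0 : 0 < s by rewrite sqrtr_gt0.
  have ss : s ^+ 2 = u by rewrite sqr_sqrtr ?ltW.
  apply: (@le_trans _ _ (\int[mu]_x ((u `^ a)%:E * (\1_(`[- s, s]%classic : set R) x)%:E))%E).
    apply: ge0_le_integral => //.
    - by move=> x _; rewrite lee_fin pospow_ge0.
    - apply: measurable_pospow_comp; exact: measurable_subsqr.
    - by apply: measurable_funeM; apply/measurable_EFinP; exact: measurable_indic.
    - move=> x _; rewrite -EFinM lee_fin.
      have [xu|xu] := leP (u - x ^+ 2) 0.
        by rewrite pospow_neg// mulr_ge0 ?powR_ge0// indicE.
      rewrite pospow_pos// indicE mem_set ?mulr1.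
        by rewrite ge0_ler_powR// ?nnegrE ?(ltW xu) ?(ltW u0)//; have := sqr_ge0 x; lra.
      rewrite /= in_itv /= -ler_norml -(ler_pXn2r (_ : 0 < 2)%N) ?nnegrE ?(ltW s0)//.
      by rewrite real_normK ?num_real// ss; lra.
  rewrite ge0_integralZl//; last 2 first.
  - by apply/measurable_EFinP; exact: measurable_indic.
  - by rewrite lee_fin powR_ge0.
  rewrite integral_indic// setIT [X in (_ * X)%E](lebesgue_measure_itv `[(- s)%R, s]) /= lte_fin gtrN//.
  rewrite -EFinD -EFinM lee_fin pospow_pos// powRD; last by rewrite lt0r_neq0 ?implybT.
  by rewrite sqrtE// -/s; lra.
exists (2 / (a + 1)); first by rewrite divr_ge0// ltW.
move=> u; have [u0|u0] := leP u 0; first exact: nonpos.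
pose s := Num.sqrt u; have s0 : 0 < s by rewrite sqrtr_gt0.
have ss : s ^+ 2 = u by rewrite sqr_sqrtr ?ltW.
pose h y := \1_(`]0, s]%classic : set R) y * y `^ a.
have mh : measurable_fun setT (fun y => (h y)%:E).
  apply/measurable_EFinP; apply: measurable_funM; [exact: measurable_indic|exact: measurable_powR].
have h0 y : 0 <= h y by rewrite mulr_ge0 ?powR_ge0// indicE.
have hE y : 0 < y <= s -> h y = y `^ a.
  by move=> ys; rewrite /h indicE mem_set ?mul1r//= in_itv.
have ih : (\int[mu]_y (h y)%:E <= (s `^ (a + 1) / (a + 1))%:E)%E.
  apply: le_trans (integral_powR_0 a1 s0).
  rewrite [leRHS]integral_mkcond le_eqVlt; apply/orP; left; apply/eqP.
  apply: eq_integral => y _; rewrite patchE /h indicE; case: ifP => _; last by rewrite mul0r.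
  by rewrite mul1r.
have ihr (r b : R) : `|r| = 1 -> (\int[mu]_y (h (r * y + b))%:E <= (s `^ (a + 1) / (a + 1))%:E)%E.
  move=> r1; apply: le_trans ih; rewrite (integral_affine b r1 mh)//.
have mhr (r b : R) : measurable_fun setT (fun y => (h (r * y + b))%:E).
  exact: measurableT_comp mh (measurable_affine r b).
apply: (@le_trans _ _ (\int[mu]_x ((s `^ a)%:E * ((h (1 * x + s))%:E + (h (-1 * x + s))%:E)))%E).
  apply: ge0_le_integral => //.
  - by move=> x _; rewrite lee_fin pospow_ge0.
  - apply: measurable_pospow_comp; exact: measurable_subsqr.
  - by apply: measurable_funeM; apply: emeasurable_funD; exact: mhr.
  - move=> x _; rewrite -EFinD -EFinM lee_fin mul1r mulN1r.
    have [xu|xu] := leP (u - x ^+ 2) 0.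
      by rewrite pospow_neg// mulr_ge0 ?powR_ge0// addr_ge0.
    have xs : `|x| < s.
      rewrite -(ltr_pXn2r (_ : 0 < 2)%N) ?nnegrE ?(ltW s0)//.
      by rewrite real_normK ?num_real// ss; lra.
    have /andP[xs1 xs2] : - s < x < s by rewrite -ltr_norml.
    rewrite pospow_pos//.
    have -> : u - x ^+ 2 = (s - x) * (x + s) by rewrite -ss; ring.
    rewrite powRM; try lra.
    have decr y : s <= y -> y `^ a <= s `^ a.
      move=> sy; have -> : a = - (- a) by rewrite opprK.
      rewrite [y `^ _]powRN [s `^ _]powRN lef_pV2 ?posrE ?powR_gt0//; last by lra.
      by rewrite ge0_ler_powR ?nnegrE//; lra.
    have [x0|x0] := leP x 0.
      rewrite (hE (x + s)); last by lra.
      apply: ler_pM; rewrite ?powR_ge0//; first by apply: decr; lra.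
      by rewrite lerDl h0.
    rewrite mulrC (hE (- x + s)); last by lra.
    apply: ler_pM; rewrite ?powR_ge0//; first by apply: decr; lra.
    by rewrite (addrC s) lerDr h0.
rewrite ge0_integralZl//; last 3 first.
- by apply: emeasurable_funD; exact: mhr.
- by move=> x _; rewrite adde_ge0 ?lee_fin.
- by rewrite lee_fin powR_ge0.
rewrite ge0_integralD//; try by [exact: mhr|move=> x _; rewrite lee_fin].
apply: (@le_trans _ _ ((s `^ a)%:E * ((s `^ (a + 1) / (a + 1))%:E + (s `^ (a + 1) / (a + 1))%:E))%E).
  apply: lee_wpmul2l; first by rewrite lee_fin powR_ge0.
  by apply: leeD; apply: ihr; rewrite ?normrN1 ?normr1.
rewrite -EFinD -EFinM lee_fin pospow_pos// le_eqVlt; apply/orP; left; apply/eqP.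
have -> : u `^ (a + 2^-1) = s `^ a * s `^ (a + 1).
  rewrite -powRD ?lt0r_neq0 ?implybT// /s -sqrtE// -powRrM; congr (_ `^ _); lra.
by lra.
Qed.

(** Two slices, each raising the exponent by 1/2. The bound has the shape of the integrand again,
    which is what makes iteration over the coordinates possible. *)
Lemma pospow_disc a : -1 < a -> exists2 K : R, 0 <= K & forall u,
  (\int[@area R]_p (pospow (u - (p.1 ^+ 2 + p.2 ^+ 2)) a)%:E <=
     (K * pospow u (a + 1))%:E)%E.
Proof.
move=> a1; have [K1 K10 h1] := pospow_slice a1.
have a2 : -1 < a + 2^-1 by lra.
have [K2 K20 h2] := pospow_slice a2.
exists (K1 * K2); first exact: mulr_ge0.
move=> u.
pose f (p : RR R) := (pospow (u - (p.1 ^+ 2 + p.2 ^+ 2)) a)%:E.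
have mf : measurable_fun setT f.
  apply: measurable_pospow_comp; apply: measurable_funB => //.
  by apply: measurable_funD; apply: measurable_funX.
have f0 p : (0 <= f p)%E by rewrite lee_fin pospow_ge0.
rewrite [leLHS](@fubini_tonelli1 _ _ _ _ R mu mu f mf f0).
have m2 : measurable_fun setT (fun x => (pospow (u - x ^+ 2) (a + 2^-1))%:E).
  by apply: measurable_pospow_comp; exact: measurable_subsqr.
apply: (@le_trans _ _ (\int[mu]_x (K1%:E * (pospow (u - x ^+ 2) (a + 2^-1))%:E))%E).
  apply: ge0_le_integral => //.
  - by move=> x _; apply: integral_ge0.
  - exact: (measurable_fun_fubini_tonelli_F f mf f0).
  - exact: measurable_funeM.
  - move=> x _; rewrite -EFinM; apply: le_trans (h1 _).
    rewrite le_eqVlt; apply/orP; left; apply/eqP; apply: eq_integral => y _.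
    by rewrite /f /= opprD addrA.
rewrite ge0_integralZl//; last first.
  by move=> x _; rewrite lee_fin pospow_ge0.
rewrite -mulrA [leRHS]EFinM lee_wpmul2l ?lee_fin//.
by apply: le_trans (h2 u) _; rewrite (_ : a + 2^-1 + 2^-1 = a + 1)//; lra.
Qed.

Definition sqsum n (x : n.-tuple (RR R)) : R :=
  \sum_(i < n) ((tnth x i).1 ^+ 2 + (tnth x i).2 ^+ 2).

Lemma sqsum_cons n p (t : n.-tuple (RR R)) :
  sqsum (cons_pair (p, t)) = p.1 ^+ 2 + p.2 ^+ 2 + sqsum t.
Proof.
rewrite /sqsum big_ord_recl; congr (_ + _).
by apply: eq_bigr => i _; rewrite !(tnth_nth (0, 0)).
Qed.

Lemma measurable_sqsum n : measurable_fun setT (@sqsum n).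
Proof.
apply: measurable_sum => i; apply: measurable_funD; apply: measurable_funX.
  exact: measurableT_comp measurable_fst (measurable_tnth i).
exact: measurableT_comp measurable_snd (measurable_tnth i).
Qed.

Lemma pospow_ball n a : -1 < a -> exists2 K : R, 0 <= K & forall u,
  (\int[lebesgue_Cn R n]_x (pospow (u - sqsum x) a)%:E <=
     (K * pospow u (a + n%:R))%:E)%E.
Proof.
move=> a1; elim: n => [|n [K K0 IH]].
  exists 1 => // u; rewrite integral_dirac//; last first.
    by apply: measurable_pospow_comp; apply: measurable_funB => //; exact: measurable_sqsum.
  by rewrite diracE in_setT mul1e mul1r addr0 /sqsum big_ord0 subr0.
have a2 : -1 < a + n%:R by rewrite ltr_wpDr ?ler0n.
have [K2 K20 h2] := pospow_disc a2.
exists (K * K2); first exact: mulr_ge0.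
move=> u; have mf : measurable_fun setT (fun x : n.+1.-tuple (RR R) => (pospow (u - sqsum x) a)%:E).
  by apply: measurable_pospow_comp; apply: measurable_funB => //; exact: measurable_sqsum.
have f0 t : (0 <= (pospow (u - @sqsum n.+1 t) a)%:E)%E by rewrite lee_fin pospow_ge0.
rewrite (integral_lebesgue_CnS mf f0).
have m2 : measurable_fun setT (fun p : RR R =>
    (pospow (u - (p.1 ^+ 2 + p.2 ^+ 2)) (a + n%:R))%:E).
  apply: measurable_pospow_comp; apply: measurable_funB => //.
  by apply: measurable_funD; apply: measurable_funX.
apply: (@le_trans _ _ (\int[@area R]_p (K%:E * (pospow (u - (p.1 ^+ 2 + p.2 ^+ 2)) (a + n%:R))%:E))%E).
  apply: ge0_le_integral => //.
  - by move=> x _; apply: integral_ge0.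
  - have mfc := measurableT_comp mf (@measurable_cons_pair _ (RR R) n).
    exact: (measurable_fun_fubini_tonelli_F _ mfc (fun p => f0 _)).
  - exact: measurable_funeM.
  - move=> p _; rewrite -EFinM; apply: le_trans (IH _).
    rewrite le_eqVlt; apply/orP; left; apply/eqP; apply: eq_integral => t _.
    by rewrite sqsum_cons opprD addrA.
rewrite ge0_integralZl//; last first.
  by move=> x _; rewrite lee_fin pospow_ge0.
rewrite -mulrA [leRHS]EFinM lee_wpmul2l ?lee_fin//.
by apply: le_trans (h2 u) _; rewrite -natr1 addrA.
Qed.

End PowerIntegrals.

(** * Convergence and positivity of the Gamma integral *)

Section GammaFunction.
Variable R : realType.
Notation mu := (@lebesgue_measure R).
Implicit Types (x t : R).

Definition gamma_integrand x t : R := t `^ (x - 1) * expR (- t).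

Lemma measurable_gamma_integrand x : measurable_fun setT (gamma_integrand x).
Proof.
apply: measurable_funM; first exact: measurable_powR.
by apply: measurableT_comp; [exact: measurable_expR|exact: oppr_measurable].
Qed.

Lemma gamma_integrand_ge0 x t : 0 <= gamma_integrand x t.
Proof. by rewrite mulr_ge0 ?powR_ge0 ?expR_ge0. Qed.

(** On ]0, 1] the integrand is at most t^(x - 1). Beyond 1 the power of t is at most K e^(t / 2),
    which leaves a multiple of the exponential density of rate 1/2, whose integral is 1. *)
Lemma gamma_lty x : 0 < x ->
  (\int[mu]_(t in `]0%R, +oo[) (gamma_integrand x t)%:E < +oo)%E.
Proof.
move=> x0; have x1 : -1 < x - 1 by lra.
pose N := Num.bound (x - 1).
(* One term of the exponential series at t / 2 gives t^(N + 1) <= K e^(t / 2), and N bounds the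
   exponent x - 1. *)
pose K : R := 2 ^+ N.+1 * (N.+1)`!%:R.
have K0 : 0 <= K by rewrite mulr_ge0 ?exprn_ge0.
pose h t := \1_(`]0, 1]%classic : set R) t * t `^ (x - 1).
have h0 t : 0 <= h t by rewrite mulr_ge0 ?powR_ge0// indicE.
have mh : measurable_fun setT h.
  by apply: measurable_funM; [exact: measurable_indic|exact: measurable_powR].
pose e t := exponential_pdf (2^-1 : R) t.
have e0 t : 0 <= e t by apply: exponential_pdf_ge0; lra.
have me : measurable_fun setT e by exact: measurable_exponential_pdf.
apply: (@le_lt_trans _ _ (\int[mu]_(t in `]0%R, +oo[) ((h t)%:E + (2 * K)%:E * (e t)%:E)%E)%E).
  apply: ge0_le_integral => //.
  - by move=> t _; rewrite lee_fin gamma_integrand_ge0.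
  - apply: measurable_funTS; apply/measurable_EFinP; exact: measurable_gamma_integrand.
  - apply: measurable_funTS; apply: emeasurable_funD; first exact/measurable_EFinP.
    by apply: measurable_funeM; exact/measurable_EFinP.
  - move=> t; rewrite /= in_itv /= andbT => t0; rewrite -EFinM -EFinD lee_fin.
    have eE : e t = 2^-1 * expR (- 2^-1 * t).
      rewrite /e exponential_pdfE//; exact: ltW.
    have [t1|t1] := leP t 1.
      apply: ler_wpDr; first by rewrite mulr_ge0// mulr_ge0.
      rewrite /h indicE mem_set ?mul1r; last by rewrite /= in_itv /= t0.
      by rewrite /gamma_integrand ler_piMr ?powR_ge0// -expR0 ler_expR; lra.
    apply: ler_wpDl; first exact: h0.
    have -> : 2 * K * e t = K * expR (t / 2) * expR (- t).
      have E2 : expR (- 2^-1 * t) = expR (t / 2) * expR (- t).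
        by rewrite -expRD; congr expR; lra.
      by rewrite eE E2; lra.
    rewrite /gamma_integrand ler_wpM2r ?expR_ge0//.
    apply: (@le_trans _ _ (t `^ (N.+1)%:R)).
      apply: ler_powR; first exact: ltW.
      have [xs|xs] := leP 0 (x - 1); last by apply: le_trans (ltW xs) _.
      apply: le_trans (ltW (archi_boundP xs)) _.
      by rewrite ler_nat /N leqnSn.
    rewrite powR_mulrn ?(ltW t0)//.
    have := @expR_ge1Dxn R (t / 2) N; rewrite divr_ge0 ?(ltW t0)// => /(_ isT) H.
    have {}H : (t / 2) ^+ N.+1 / (N.+1)`!%:R <= expR (t / 2) by lra.
    rewrite ler_pdivrMr ?ltr0n ?fact_gt0// in H.
    rewrite expr_div_n ler_pdivrMr ?exprn_gt0// in H.
    by apply: le_trans H _; rewrite /K; lra.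
rewrite ge0_integralD//; last 4 first.
- by move=> t _; rewrite lee_fin.
- by apply: measurable_funTS; exact/measurable_EFinP.
- by move=> t _; rewrite mule_ge0// lee_fin// mulr_ge0.
- by apply: measurable_funTS; apply: measurable_funeM; exact/measurable_EFinP.
apply: lte_add_pinfty.
  apply: (@le_lt_trans _ _ (\int[mu]_t (h t)%:E)%E).
    apply: ge0_subset_integral => //; first exact/measurable_EFinP.
    by move=> t _; rewrite lee_fin.
  apply: le_lt_trans (ltry (1 `^ (x - 1 + 1) / (x - 1 + 1))).
  apply: le_trans (integral_powR_0 x1 ltr01).
  rewrite [leRHS]integral_mkcond le_eqVlt; apply/orP; left; apply/eqP.
  apply: eq_integral => y _; rewrite patchE /h indicE; case: ifP => _; last by rewrite mul0r.
  by rewrite mul1r.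
apply: (@le_lt_trans _ _ (\int[mu]_t ((2 * K)%:E * (e t)%:E))%E).
  apply: ge0_subset_integral => //.
    by apply: measurable_funeM; exact/measurable_EFinP.
  by move=> t _; rewrite mule_ge0// lee_fin// mulr_ge0.
rewrite ge0_integralZl//; last 3 first.
- exact/measurable_EFinP.
- by move=> t _; rewrite lee_fin.
- by rewrite lee_fin mulr_ge0.
by rewrite integral_exponential_pdf ?mule1 ?ltry//; lra.
Qed.

(** Both finiteness and a lower bound are called for, as [fine] sends an infinite integral to 0.
    From below, t^(x - 1) >= 1/t >= 1/2 and e^(-t) >= e^(-2) on [1, 2]. *)
Lemma Gamma_gt0 x : 0 < x -> 0 < Gamma x.
Proof.
move=> x0; rewrite /Gamma /Rintegral fine_gt0//.
apply/andP; split; last exact: gamma_lty.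
pose c : R := expR (- 2) / 2.
have c0 : 0 < c by rewrite divr_gt0 ?expR_gt0.
apply: (@lt_le_trans _ _ (\int[mu]_(t in `[1%R, 2%R]) (gamma_integrand x t)%:E)%E).
  apply: (@lt_le_trans _ _ (\int[mu]_(t in `[1%R, 2%R]) c%:E)%E).
    rewrite integral_cst//= [X in (_ * X)%E](lebesgue_measure_itv `[1%R, 2%R]) /=.
    by rewrite lte_fin ltr1n -EFinD -EFinM lte_fin; lra.
  apply: ge0_le_integral => //.
  - by move=> t _; rewrite lee_fin ltW.
  - apply: measurable_funTS; apply/measurable_EFinP; exact: measurable_gamma_integrand.
  - move=> t; rewrite /= in_itv /= => /andP[t1 t2]; rewrite lee_fin /c /gamma_integrand mulrC.
    apply: ler_pM => //; rewrite ?expR_ge0//; last by rewrite ler_expR; lra.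
    apply: (@le_trans _ _ (t `^ (-1))); last by apply: ler_powR => //; lra.
    by rewrite powR_inv1 ?lef_pV2 ?posrE//; lra.
apply: ge0_subset_integral => //.
- apply: measurable_funTS; apply/measurable_EFinP; exact: measurable_gamma_integrand.
- by move=> t _; rewrite lee_fin gamma_integrand_ge0.
- by move=> t; rewrite /= !in_itv /= andbT; lra.
Qed.

Lemma c_gt0 n (lambda : R) : -1 < lambda -> 0 < c_ n lambda.
Proof.
move=> l1; rewrite /c_ divr_gt0//.
  by apply: Gamma_gt0; have := ler0n R n; lra.
by rewrite mulr_gt0 ?exprn_gt0 ?pi_gt0//; apply: Gamma_gt0; lra.
Qed.

End GammaFunction.

(** * The weighted measure of the ball is finite *)

Section BallMeasure.
Variables (R : realType) (n : nat) (lambda : R).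
Hypothesis lambda1 : -1 < lambda.
Notation C := R[i].
Notation leb := (lebesgue_Cn R n).
Implicit Types x : n.-tuple (RR R).

Lemma sqnorm_Cn_of x : sqnorm (Cn_of x) = sqsum x.
Proof. by apply: eq_bigr => i _; rewrite mxE normc_sqr. Qed.

Lemma Bnr_sqsum x : Bnr x = (sqsum x < 1) :> Prop.
Proof. by rewrite /Bnr /Bn /= sqnorm_Cn_of. Qed.

Lemma measurable_Bnr : measurable (@Bnr R n).
Proof.
have -> : @Bnr R n = @sqsum R n @^-1` `]-oo, 1[%classic.
  by apply/seteqP; split => x; rewrite Bnr_sqsum /= in_itv.
by rewrite -[X in measurable X]setTI; apply: measurable_sqsum.
Qed.

Definition weight x : R := density lambda (Cn_of x).

Lemma measurable_weight : measurable_fun setT weight.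
Proof.
rewrite /weight (_ : (fun x => _) = (fun x => c_ n lambda * (1 - sqsum x) `^ lambda)); last first.
  by apply/funext => x; rewrite /density sqnorm_Cn_of.
apply: measurable_funM => //.
have m1 : measurable_fun setT (fun x => 1 - sqsum x : R).
  by apply: measurable_funB => //; exact: measurable_sqsum.
have m2 : measurable_fun setT (fun u : R => u `^ lambda) by exact: measurable_powR.
exact: measurableT_comp m2 m1.
Qed.

Lemma weight_ge0 x : 0 <= weight x.
Proof. by rewrite mulr_ge0 ?powR_ge0// ltW// c_gt0. Qed.

Lemma weight_gt0 x : Bnr x -> 0 < weight x.
Proof.
by rewrite Bnr_sqsum => xB; rewrite mulr_gt0 ?c_gt0// powR_gt0// sqnorm_Cn_of subr_gt0.
Qed.

Lemma weight_lty : (\int[leb]_(x in @Bnr R n) (weight x)%:E < +oo)%E.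
Proof.
have [K K0 hK] := pospow_ball n lambda1.
apply: (@le_lt_trans _ _ (\int[leb]_x ((c_ n lambda)%:E * (pospow (1 - sqsum x) lambda)%:E))%E).
  rewrite integral_mkcond; apply: ge0_le_integral => //.
  - by move=> x _; apply: erestrict_ge0 => y _; rewrite lee_fin weight_ge0.
  - apply/(measurable_restrictT _ measurable_Bnr); apply: measurable_funTS.
    by apply/measurable_EFinP; exact: measurable_weight.
  - apply: measurable_funeM; apply: measurable_pospow_comp.
    by apply: measurable_funB => //; exact: measurable_sqsum.
  - move=> x _; rewrite patchE; case: ifPn => [|_]; last first.
      by rewrite -EFinM lee_fin mulr_ge0 ?pospow_ge0// ltW// c_gt0.
    rewrite inE Bnr_sqsum => xB; rewrite pospow_pos ?subr_gt0//.
    by rewrite /weight /density sqnorm_Cn_of.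
rewrite ge0_integralZl//; last 3 first.
- apply: measurable_pospow_comp.
  by apply: measurable_funB => //; exact: measurable_sqsum.
- by move=> x _; rewrite lee_fin pospow_ge0.
- by rewrite lee_fin ltW// c_gt0.
apply: (@le_lt_trans _ _ ((c_ n lambda)%:E * (K * pospow 1 (lambda + n%:R))%:E)%E).
  by apply: lee_wpmul2l; [rewrite lee_fin ltW// c_gt0|exact: hK].
by rewrite -EFinM ltry.
Qed.

End BallMeasure.

(** * Boxes have positive measure *)

Section Boxes.
Variable R : realType.
Notation C := R[i].

Definition square (p : RR R) (e : R) : set (RR R) :=
  `]p.1 - e, p.1 + e[%classic `*` `]p.2 - e, p.2 + e[%classic.

Definition box n (x : n.-tuple (RR R)) (e : R) : set (n.-tuple (RR R)) :=
  [set y | forall i, square (tnth x i) e (tnth y i)].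

Lemma measurable_square p e : measurable (square p e).
Proof. by apply: measurableX; exact: measurable_itv. Qed.

Lemma measurable_box n (x : n.-tuple (RR R)) e : measurable (box x e).
Proof.
have -> : box x e = \bigcap_(i in [set: 'I_n]) ((fun y : n.-tuple (RR R) => tnth y i) @^-1` square (tnth x i) e).
  by apply/seteqP; split => y h; [move=> i _|move=> i]; apply: h.
apply: fin_bigcap_measurable; first exact: finite_finset.
move=> i _; rewrite -[X in measurable X]setTI.
by apply: measurable_tnth => //; exact: measurable_square.
Qed.

Lemma area_square p (e : R) : 0 < e -> (0 < @area R (square p e))%E.
Proof.
move=> e0; rewrite /square.
have := @product_measure1E _ _ _ _ R (@lebesgue_measure R) (@lebesgue_measure R)
  `]p.1 - e, p.1 + e[%classic `]p.2 - e, p.2 + e[%classic (measurable_itv _) (measurable_itv _).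
move=> E; rewrite [ltRHS]E.
rewrite [X in (X * _)%E](lebesgue_measure_itv `]p.1 - e, p.1 + e[).
rewrite [X in (_ * X)%E](lebesgue_measure_itv `]p.2 - e, p.2 + e[) /= !lte_fin.
have -> : p.1 - e < p.1 + e by lra.
have -> : p.2 - e < p.2 + e by lra.
by rewrite -!EFinD -EFinM lte_fin mulr_gt0//; lra.
Qed.

Lemma lebesgue_box n (x : n.-tuple (RR R)) (e : R) : 0 < e ->
  (0 < lebesgue_Cn R n (box x e))%E.
Proof.
move=> e0; elim: n x => [|n IH] x.
  rewrite /= diracE mem_set ?lte_fin// => i.
  by case: i.
pose x' : n.-tuple (RR R) := [tuple tnth x (lift ord0 i) | i < n].
have E : @cons_pair _ (RR R) n @^-1` box x e = square (tnth x ord0) e `*` box x' e.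
  apply/seteqP; split => -[p t] /=.
    move=> h; split; first by have := h ord0; rewrite /cons_pair /= tnth0.
    move=> i; have := h (lift ord0 i); rewrite /cons_pair /= tnthS.
    by rewrite /x' tnth_mktuple.
  move=> [h1 h2] i; case: (unliftP ord0 i) => [j ->|->].
    by rewrite /cons_pair /= tnthS; have := h2 j; rewrite /x' tnth_mktuple.
  by rewrite /cons_pair /= tnth0.
rewrite /= /power_step /pushforward E.
have := @product_measure1E _ _ _ _ R (@area R) (lebesgue_Cn R n)
  (square (tnth x ord0) e) (box x' e) (measurable_square _ _) (measurable_box _ _).
move=> F; rewrite [ltRHS]F; apply: mule_gt0; [exact: area_square|exact: IH].
Qed.

Lemma nbhs_cV n (z : 'cV[C]_n) (A : set 'cV[C]_n) :
  nbhs z A <-> exists2 e : R, 0 < e &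
    forall w : 'cV[C]_n, (forall i, normc (w i 0 - z i 0) < e) -> A w.
Proof.
split.
  move=> /nbhs_ballP[e /= /posC[r r0 ->] h]; exists r => // w hw; apply: h.
  split; first by rewrite ltcR.
  by move=> i j; rewrite ord1 -ball_normE /= normc_ltc normc_distrC.
move=> [r r0 h]; apply/nbhs_ballP; exists r%:C%C => /=; first by rewrite ltcR.
move=> w [_ hw]; apply: h => i.
by have := hw i 0; rewrite -ball_normE /= normc_ltc normc_distrC.
Qed.

Lemma nbhs_Bn n (z : 'cV[C]_n) : Bn z -> nbhs z (@Bn R n).
Proof.
rewrite /Bn /= => zB; apply/nbhs_cV.
(* From |w_i| <= |z_i| + e and e <= 1 follows |w_i|^2 <= |z_i|^2 + e (2 |z_i| + 1). *)
pose S := \sum_(i < n) (2 * normc (z i 0) + 1).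
have S0 : 0 <= S by apply: sumr_ge0 => i _; have := normc_ge0 (z i 0); lra.
pose e := Num.min 1 ((1 - sqnorm z) / (S + 1)).
have e0 : 0 < e by rewrite lt_min ltr01 divr_gt0//; lra.
exists e => // w hw.
have e1 : e <= 1 by rewrite ge_min lexx.
have eS : e * (S + 1) <= 1 - sqnorm z.
  by rewrite -ler_pdivlMr ?ge_min ?lexx ?orbT//; lra.
apply: (@le_lt_trans _ _ (sqnorm z + e * S)).
  rewrite /sqnorm /S mulr_sumr -big_split /=; apply: ler_sum => i _.
  have h : normc (w i 0) <= normc (z i 0) + e.
    by rewrite -(subrK (z i 0) (w i 0)); apply: le_trans (normcD _ _) _; have := hw i; lra.
  apply: (@le_trans _ _ ((normc (z i 0) + e) ^+ 2)).
    by rewrite lerXn2r ?nnegrE ?normc_ge0//; have := normc_ge0 (z i 0); lra.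
  have : e * e <= e * 1 by rewrite ler_wpM2l// ltW.
  rewrite !expr2; lra.
by lra.
Qed.

End Boxes.

(** * Definiteness of the norm on continuous functions *)

Section ZeroIntegral.
Variables (R : realType) (n : nat) (lambda : R).
Hypothesis lambda1 : -1 < lambda.
Notation C := R[i].
Notation Cn := 'cV[C]_n.

Lemma Cn_of_surj (z : Cn) : exists x : n.-tuple (RR R), Cn_of x = z.
Proof.
exists [tuple (complex.Re (z i 0), complex.Im (z i 0)) | i < n].
by apply/matrixP => i j; rewrite ord1 mxE tnth_mktuple /=; case: (z i 0).
Qed.

(** If f is nonzero at z, it is nonzero on a box around z inside the ball; the box has positive
    measure and the weight is positive on it. *)
Lemma sqint_eq0 (f : Cn -> C^o) : L2 lambda f ->
  (forall z, Bn z -> {for z, continuous f}) -> sqint lambda f = 0%E ->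
  forall z, Bn z -> f z = 0.
Proof.
move=> [mRe mIm _] cf f0 z zB; apply: contrapT => fz.
have [x xz] := Cn_of_surj z.
have : nbhs z [set w | Bn w /\ f w <> 0].
  apply: filterI; first exact: nbhs_Bn.
  have nb : nbhs (f z : C^o) [set w : C | w <> 0].
    apply/nbhs_complexP; exists (normc (f z)); first by rewrite normc_gt0; exact/eqP.
    by move=> w hw w0; move: hw; rewrite w0 sub0r normc_opp ltxx.
  exact: (cf z zB _ nb).
move=> /nbhs_cV[e e0 he].
pose F y : \bar R := (normc (f (Cn_of y)) ^+ 2 * density lambda (Cn_of y))%:E.
have F0 y : (0 <= F y)%E by rewrite lee_fin mulr_ge0 ?sqr_ge0// (weight_ge0 lambda1).
have mF : measurable_fun (@Bnr R n) F.
  apply/measurable_EFinP; apply: measurable_funM; last by apply: measurable_funTS; exact: measurable_weight.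
  rewrite (_ : (fun y => _) = (fun y => complex.Re (f (Cn_of y)) ^+ 2 + complex.Im (f (Cn_of y)) ^+ 2)).
    by apply: measurable_funD; apply: measurable_funX.
  by apply/funext => y; rewrite normc_sqr.
have [] := @ae_eq_integral_abs _ _ R (lebesgue_Cn R n) _ (@measurable_Bnr R n) F mF.
move=> H _.
have : (\int[lebesgue_Cn R n]_(y in @Bnr R n) `|F y|)%E = 0%E.
  by rewrite -f0; apply: eq_integral => y _; rewrite gee0_abs.
move=> /H[N [mN N0 sub]].
have : (lebesgue_Cn R n (box x (e / 2)) <= 0)%E.
  rewrite -N0; apply: le_measure; rewrite ?inE//; first exact: measurable_box.
  move=> y hy; apply: sub => /= h.
  have [yB fy] : Bn (Cn_of y) /\ f (Cn_of y) <> 0.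
    apply: he => i; have [/= a1 a2] : square (tnth x i) (e / 2) (tnth y i) := hy i.
    move: a1 a2; rewrite !in_itv /= => /andP[a1 a2] /andP[b1 b2].
    rewrite -xz !mxE; apply: le_lt_trans (normc_le_ReIm _) _ => /=.
    have : `|(tnth y i).1 - (tnth x i).1| < e / 2 by rewrite ltr_norml; apply/andP; split; lra.
    have : `|(tnth y i).2 - (tnth x i).2| < e / 2 by rewrite ltr_norml; apply/andP; split; lra.
    by lra.
  have /eqP := h yB; rewrite /F /cst /= eqe mulf_eq0 sqrf_eq0 normc_eq0.
  by move=> /orP[/eqP//|]; rewrite gt_eqF// (weight_gt0 lambda1).
by apply/negP; rewrite -ltNge lebesgue_box// divr_gt0.
Qed.

End ZeroIntegral.

(** * Geometry of the weighted L^2 space *)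

Section L2Space.
Variables (R : realType) (n : nat) (lambda : R).
Hypothesis lambda1 : -1 < lambda.
Notation C := R[i].
Notation Cn := 'cV[C]_n.
Notation Fun := (Cn -> C^o).
Notation leb := (lebesgue_Cn R n).
Notation B := (@Bnr R n).
Notation w := (@weight R n lambda).
Notation L2 := (@L2 R n lambda).
Notation dot := (@A2dot R n lambda).
Notation norm := (@A2norm R n lambda).
Implicit Types (f g h : Fun) (a : C).

Definition wint (h : n.-tuple (RR R) -> C) : C :=
  Complex (\int[leb]_(x in B) (complex.Re (h x) * w x))
          (\int[leb]_(x in B) (complex.Im (h x) * w x)).

Definition wintegrable (h : n.-tuple (RR R) -> C) : Prop :=
  leb.-integrable B (EFin \o (fun x => complex.Re (h x) * w x)) /\
  leb.-integrable B (EFin \o (fun x => complex.Im (h x) * w x)).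

Lemma integrable_lin (r s : R) (u v : n.-tuple (RR R) -> R) :
  leb.-integrable B (EFin \o u) -> leb.-integrable B (EFin \o v) ->
  leb.-integrable B (EFin \o (fun x => r * u x + s * v x)).
Proof.
move=> iu iv; have mB := @measurable_Bnr R n.
rewrite (_ : _ \o _ = ((fun x => r%:E * (EFin \o u) x) \+ (fun x => s%:E * (EFin \o v) x))%E).
  by apply: integrableD => //; exact: integrableZl.
by apply/funext => x /=; rewrite EFinD !EFinM.
Qed.

Lemma Rintegral_lin (r s : R) (u v : n.-tuple (RR R) -> R) :
  leb.-integrable B (EFin \o u) -> leb.-integrable B (EFin \o v) ->
  \int[leb]_(x in B) (r * u x + s * v x) =
  r * \int[leb]_(x in B) u x + s * \int[leb]_(x in B) v x.
Proof.
move=> iu iv; have mB := @measurable_Bnr R n.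
have iZ (t : R) (f : n.-tuple (RR R) -> R) : leb.-integrable B (EFin \o f) ->
    leb.-integrable B (EFin \o (fun x => t * f x)).
  move=> h; rewrite (_ : _ \o _ = (fun x => t%:E * (EFin \o f) x)%E); last first.
    by apply/funext => x /=; rewrite EFinM.
  exact: integrableZl.
by rewrite RintegralD ?RintegralZl//; exact: iZ.
Qed.

Lemma wint_lin a (h1 h2 : n.-tuple (RR R) -> C) :
  wintegrable h1 -> wintegrable h2 ->
  wint (fun x => a * h1 x + h2 x) = a * wint h1 + wint h2.
Proof.
move=> [i1 j1] [i2 j2]; apply: complex_eq; rewrite ?cReD ?cImD ?cReM ?cImM /=.
  rewrite (_ : (fun x => _) = (fun x => 1 * (complex.Re a * (complex.Re (h1 x) * w x) +
      - complex.Im a * (complex.Im (h1 x) * w x)) + 1 * (complex.Re (h2 x) * w x))).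
    by rewrite !Rintegral_lin//; [ring|exact: integrable_lin].
  by apply/funext => x; rewrite cReD cReM; ring.
rewrite (_ : (fun x => _) = (fun x => 1 * (complex.Re a * (complex.Im (h1 x) * w x) +
      complex.Im a * (complex.Re (h1 x) * w x)) + 1 * (complex.Im (h2 x) * w x))).
  by rewrite !Rintegral_lin//; [ring|exact: integrable_lin].
by apply/funext => x; rewrite cImD cImM; ring.
Qed.

Lemma conjE (z : C) : z^* = Complex (complex.Re z) (- complex.Im z).
Proof. by case: z. Qed.

Lemma cRe_conj (z : C) : complex.Re z^* = complex.Re z. Proof. by case: z. Qed.
Lemma cIm_conj (z : C) : complex.Im z^* = - complex.Im z. Proof. by case: z. Qed.

Lemma normc_conj (z : C) : normc z^* = normc z.
Proof. by rewrite !normc_sqrt cRe_conj cIm_conj sqrrN. Qed.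

Lemma A2dotE f g : dot f g = wint (fun x => f (Cn_of x) * (g (Cn_of x))^*).
Proof. by []. Qed.

Definition sqf f (x : n.-tuple (RR R)) : R := normc (f (Cn_of x)) ^+ 2 * w x.

Lemma sqf_ge0 f x : 0 <= sqf f x.
Proof. by rewrite mulr_ge0 ?sqr_ge0// weight_ge0. Qed.

Lemma measurable_weightB : measurable_fun B w.
Proof. by apply: measurable_funTS; exact: measurable_weight. Qed.

Definition cmeasurable f : Prop :=
  measurable_fun B (fun x => complex.Re (f (Cn_of x)) : R) /\
  measurable_fun B (fun x => complex.Im (f (Cn_of x)) : R).

Lemma measurable_sqf f : cmeasurable f -> measurable_fun B (sqf f).
Proof.
move=> [mR mI]; apply: measurable_funM; last exact: measurable_weightB.
rewrite (_ : (fun x => _) = (fun x => complex.Re (f (Cn_of x)) ^+ 2 + complex.Im (f (Cn_of x)) ^+ 2)).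
  by apply: measurable_funD; apply: measurable_funX.
by apply/funext => x; rewrite normc_sqr.
Qed.

Lemma cmeasurable_lin a f g : cmeasurable f -> cmeasurable g -> cmeasurable (a *: f + g).
Proof.
move=> [fR fI] [gR gI]; split.
  rewrite (_ : (fun x => _) = (fun x => (complex.Re a * complex.Re (f (Cn_of x)) -
     complex.Im a * complex.Im (f (Cn_of x))) + complex.Re (g (Cn_of x)))).
    by apply: measurable_funD => //; apply: measurable_funB; apply: measurable_funM.
  by apply/funext => x; rewrite /= cReD cReM.
rewrite (_ : (fun x => _) = (fun x => (complex.Re a * complex.Im (f (Cn_of x)) +
     complex.Im a * complex.Re (f (Cn_of x))) + complex.Im (g (Cn_of x)))).
  by apply: measurable_funD => //; apply: measurable_funD; apply: measurable_funM.
by apply/funext => x; rewrite /= cImD cImM.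
Qed.

Lemma L2P f : L2 f <-> cmeasurable f /\ (sqint lambda f < +oo)%E.
Proof. by split=> [[]|[[]]]. Qed.

Lemma sqintE f : sqint lambda f = (\int[leb]_(x in B) (sqf f x)%:E)%E.
Proof. by []. Qed.

Lemma sqint_ge0 f : (0 <= sqint lambda f)%E.
Proof. by apply: integral_ge0 => x _; rewrite lee_fin sqf_ge0. Qed.

Lemma A2norm_ge0 f : 0 <= norm f. Proof. exact: sqrtr_ge0. Qed.

Lemma A2normsq f : norm f ^+ 2 = fine (sqint lambda f).
Proof. by rewrite sqr_sqrtr// fine_ge0// sqint_ge0. Qed.

(** As the norm is a [fine] value, it determines the integral only when that is finite; this is how
    membership in L2 enters the computations with norms. *)
Lemma L2_sqint f : L2 f -> sqint lambda f = (norm f ^+ 2)%:E.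
Proof.
move=> [_ _ h]; rewrite A2normsq fineK// ge0_fin_numE//; exact: sqint_ge0.
Qed.

Lemma L2_integrable f : L2 f -> leb.-integrable B (EFin \o sqf f).
Proof.
move=> /L2P[mf h]; apply/integrableP; split.
  by apply/measurable_EFinP; exact: measurable_sqf.
rewrite (eq_integral (EFin \o sqf f))// => x _ /=.
by rewrite ger0_norm// sqf_ge0.
Qed.

(** Rests on the pointwise inequality |f| |g| <= (|f|^2 + |g|^2) / 2. *)
Lemma L2_dominated (u : n.-tuple (RR R) -> R) f g : L2 f -> L2 g ->
  measurable_fun B u ->
  (forall x, `|u x| <= normc (f (Cn_of x)) * normc (g (Cn_of x))) ->
  leb.-integrable B (EFin \o (fun x => u x * w x)).
Proof.
move=> Lf Lg mu hu; have mB := @measurable_Bnr R n.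
apply: (@le_integrable _ _ _ _ _ mB _ (EFin \o (fun x => 2^-1 * sqf f x + 2^-1 * sqf g x))).
- apply/measurable_EFinP; apply: measurable_funM => //; exact: measurable_weightB.
- move=> x _ /=; rewrite lee_fin normrM (ger0_norm (weight_ge0 lambda1 _)).
  apply: le_trans (ler_norm _); rewrite /sqf.
  have -> : forall p q r : R, 2^-1 * (p * r) + 2^-1 * (q * r) = (p + q) / 2 * r.
    by move=> p q r; lra.
  rewrite ler_wpM2r ?weight_ge0//; apply: le_trans (hu x) _.
  have := sqr_ge0 (normc (f (Cn_of x)) - normc (g (Cn_of x))).
  by rewrite sqrrB; lra.
- by apply: integrable_lin; exact: L2_integrable.
Qed.

Lemma L2_wintegrable f g : L2 f -> L2 g ->
  wintegrable (fun x => f (Cn_of x) * (g (Cn_of x))^*).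
Proof.
move=> Lf Lg; have [[fR fI] _] := (L2P _).1 Lf; have [[gR gI] _] := (L2P _).1 Lg.
split; apply: (L2_dominated Lf Lg).
- rewrite (_ : (fun x => _) = (fun x => complex.Re (f (Cn_of x)) * complex.Re (g (Cn_of x)) +
     complex.Im (f (Cn_of x)) * complex.Im (g (Cn_of x)))).
    by apply: measurable_funD; apply: measurable_funM.
  by apply/funext => x; rewrite cReM cRe_conj cIm_conj mulrN opprK.
- by move=> x; apply: le_trans (normc_Re _) _; rewrite normcM normc_conj.
- rewrite (_ : (fun x => _) = (fun x => complex.Im (f (Cn_of x)) * complex.Re (g (Cn_of x)) -
     complex.Re (f (Cn_of x)) * complex.Im (g (Cn_of x)))).
    by apply: measurable_funB; apply: measurable_funM.
  by apply/funext => x; rewrite cImM cRe_conj cIm_conj; ring.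
- by move=> x; apply: le_trans (normc_Im _) _; rewrite normcM normc_conj.
Qed.

Lemma L2_0 : L2 0.
Proof.
split; try exact: measurable_cst.
rewrite sqintE integral0_eq ?ltry// => x _.
by rewrite /sqf normc0 expr0n mul0r.
Qed.

Lemma L2_lin a f g : L2 f -> L2 g -> L2 (a *: f + g).
Proof.
move=> Lf Lg; have [mf _] := (L2P _).1 Lf; have [mg _] := (L2P _).1 Lg.
have ml := cmeasurable_lin a mf mg; apply/L2P; split => //.
have mB := @measurable_Bnr R n.
have i : leb.-integrable B (EFin \o sqf (a *: f + g)).
  apply: (@le_integrable _ _ _ _ _ mB _ (EFin \o (fun x => 2 * normc a ^+ 2 * sqf f x + 2 * sqf g x))).
  - by apply/measurable_EFinP; exact: measurable_sqf.
  - move=> x _ /=; rewrite lee_fin ger0_norm ?sqf_ge0//.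
    apply: le_trans (ler_norm _); rewrite /sqf.
    move: (w x) (weight_ge0 lambda1 x) => wx wx0.
    pose p := a * f (Cn_of x); pose q := g (Cn_of x); have h := normcD p q.
    have -> : 2 * normc a ^+ 2 * (normc (f (Cn_of x)) ^+ 2 * wx) + 2 * (normc q ^+ 2 * wx) =
        (2 * normc p ^+ 2 + 2 * normc q ^+ 2) * wx.
      by rewrite /p normcM exprMn; ring.
    apply: ler_wpM2r => //; rewrite -[(a *: f + g) (Cn_of x)]/(p + q).
    apply: (@le_trans _ _ ((normc p + normc q) ^+ 2)).
      by rewrite lerXn2r// nnegrE ?addr_ge0 ?normc_ge0.
    by have := sqr_ge0 (normc p - normc q); rewrite sqrrB sqrrD; lra.
  - by apply: integrable_lin; exact: L2_integrable.
have /integrableP[_] := i.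
rewrite (eq_integral (EFin \o sqf (a *: f + g)))// => x _ /=.
by rewrite ger0_norm// sqf_ge0.
Qed.

Lemma L2Z a f : L2 f -> L2 (a *: f).
Proof. by move=> Lf; rewrite -[_ *: _]addr0; apply: L2_lin => //; exact: L2_0. Qed.

Lemma L2D f g : L2 f -> L2 g -> L2 (f + g).
Proof. by move=> Lf Lg; rewrite -[f]scale1r; exact: L2_lin. Qed.

Lemma L2B f g : L2 f -> L2 g -> L2 (f - g).
Proof. by move=> Lf Lg; rewrite -scaleN1r; apply: L2D => //; exact: L2Z. Qed.

Lemma L2_sum (I : Type) (r : seq I) (P : pred I) (F : I -> Fun) :
  (forall i, P i -> L2 (F i)) -> L2 (\sum_(i <- r | P i) F i).
Proof. by move=> h; elim/big_ind: _ => //; [exact: L2_0|exact: L2D]. Qed.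

Lemma dot_linl a f g h : L2 f -> L2 g -> L2 h ->
  dot (a *: f + g) h = a * dot f h + dot g h.
Proof.
move=> Lf Lg Lh; rewrite !A2dotE -wint_lin; try exact: L2_wintegrable.
congr wint; apply/funext => x /=; rewrite mulrDl; congr (_ + _).
by rewrite [RHS]mulrA.
Qed.

Lemma dotC f g : L2 f -> L2 g -> dot g f = (dot f g)^*.
Proof.
move=> Lf Lg; rewrite conjE !A2dotE; have [_ iI] := L2_wintegrable Lf Lg.
have mB := @measurable_Bnr R n.
congr Complex.
  by apply: eq_Rintegral => x _; rewrite !cReM !cRe_conj !cIm_conj; ring.
rewrite /= -mulN1r -RintegralZl//; apply: eq_Rintegral => x _.
by rewrite !cImM !cRe_conj !cIm_conj; ring.
Qed.

Lemma dotff f : L2 f -> dot f f = (norm f ^+ 2)%:C%C.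
Proof.
move=> Lf; rewrite A2normsq; apply: complex_eq => /=.
  congr fine; apply: eq_integral => x _.
  by rewrite cReM cRe_conj cIm_conj /sqf normc_sqr mulrN opprK -!expr2.
rewrite /Rintegral integral0_eq//= => x _; rewrite cImM cRe_conj cIm_conj.
by rewrite (_ : _ + _ = 0) ?mul0r//; ring.
Qed.

End L2Space.

(** * Orthogonality, unitarity of rotations and Fatou's lemma *)

Section Geometry.
Variables (R : realType) (n : nat) (lambda : R).
Hypothesis lambda1 : -1 < lambda.
Notation C := R[i].
Notation Cn := 'cV[C]_n.
Notation Fun := (Cn -> C^o).
Notation leb := (lebesgue_Cn R n).
Notation B := (@Bnr R n).
Notation w := (@weight R n lambda).
Notation L2 := (@L2 R n lambda).
Notation dot := (@A2dot R n lambda).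
Notation norm := (@A2norm R n lambda).
Implicit Types (f g h e : Fun) (a : C).

Lemma dotDl f g h : L2 f -> L2 g -> L2 h -> dot (f + g) h = dot f h + dot g h.
Proof. by move=> Lf Lg Lh; rewrite -[f]scale1r dot_linl// scale1r mul1r. Qed.

Lemma dot0l h : L2 h -> dot 0 h = 0.
Proof.
move=> Lh; have L0 := L2_0 n lambda.
have := dotDl L0 L0 Lh; rewrite addr0 => /esym/eqP.
by rewrite -subr_eq0 addrK => /eqP.
Qed.

Lemma dotZl a f h : L2 f -> L2 h -> dot (a *: f) h = a * dot f h.
Proof.
move=> Lf Lh; have L0 := L2_0 n lambda.
by have := dot_linl lambda1 a Lf L0 Lh; rewrite addr0 dot0l// addr0.
Qed.

Lemma dotBl f g h : L2 f -> L2 g -> L2 h -> dot (f - g) h = dot f h - dot g h.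
Proof.
move=> Lf Lg Lh; rewrite -scaleN1r dotDl ?dotZl ?mulN1r//.
exact: L2Z.
Qed.

Lemma dot_suml (I : Type) (r : seq I) (P : pred I) (F : I -> Fun) h :
  (forall i, P i -> L2 (F i)) -> L2 h ->
  dot (\sum_(i <- r | P i) F i) h = \sum_(i <- r | P i) dot (F i) h.
Proof.
move=> LF Lh.
have [_ //] : L2 (\sum_(i <- r | P i) F i) /\
  dot (\sum_(i <- r | P i) F i) h = \sum_(i <- r | P i) dot (F i) h.
elim/big_ind2: _ => [|f a g b [Lf <-] [Lg <-]|i Pi].
- by split; [exact: L2_0|exact: dot0l].
- by split; [exact: L2D|exact: dotDl].
- by split; [exact: LF|].
Qed.

Lemma conjcD (x y : C) : (x + y)^* = x^* + y^*. Proof. exact: rmorphD. Qed.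
Lemma conjcM (x y : C) : (x * y)^* = x^* * y^*. Proof. exact: rmorphM. Qed.

Lemma dotDr f g h : L2 f -> L2 g -> L2 h -> dot h (f + g) = dot h f + dot h g.
Proof.
move=> Lf Lg Lh; rewrite (dotC lambda1 (L2D lambda1 Lf Lg) Lh) dotDl// conjcD.
by rewrite -!(dotC lambda1).
Qed.

Lemma dotZr a f h : L2 f -> L2 h -> dot h (a *: f) = a^* * dot h f.
Proof.
move=> Lf Lh; rewrite (dotC lambda1 (L2Z lambda1 a Lf) Lh) dotZl// conjcM.
by rewrite -(dotC lambda1).
Qed.

Lemma dot_eq0C f g : L2 f -> L2 g -> dot f g = 0 -> dot g f = 0.
Proof. by move=> Lf Lg fg; rewrite (dotC lambda1 Lf Lg) fg conjC0. Qed.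

Lemma normsqD f g : L2 f -> L2 g ->
  norm (f + g) ^+ 2 = norm f ^+ 2 + norm g ^+ 2 + 2 * complex.Re (dot f g).
Proof.
move=> Lf Lg; have Lfg := L2D lambda1 Lf Lg.
have := dotff lambda1 Lfg; rewrite dotDl// !dotDr// !dotff// (dotC lambda1 Lf Lg).
move=> /(congr1 (@complex.Re R)); rewrite !cReD cRe_conj /=; lra.
Qed.

Lemma normsqZ a f : L2 f -> norm (a *: f) ^+ 2 = normc a ^+ 2 * norm f ^+ 2.
Proof.
move=> Lf; have := dotff lambda1 (L2Z lambda1 a Lf).
rewrite dotZl//; last exact: L2Z.
rewrite dotZr// dotff// mulrA => /(congr1 (@complex.Re R)) /= <-.
rewrite cReM /= mulr0 subr0; congr (_ * _).
by rewrite cReM cRe_conj cIm_conj normc_sqr !expr2; ring.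
Qed.

Lemma normZ a f : L2 f -> norm (a *: f) = normc a * norm f.
Proof.
move=> Lf; apply/eqP; rewrite -(@eqrXn2 _ 2)// ?mulr_ge0 ?normc_ge0 ?A2norm_ge0//.
by rewrite normsqZ// exprMn.
Qed.

Lemma pythagoras f g : L2 f -> L2 g -> dot f g = 0 ->
  norm (f + g) ^+ 2 = norm f ^+ 2 + norm g ^+ 2.
Proof. by move=> Lf Lg fg; rewrite normsqD// fg mulr0 addr0. Qed.

(** The parallelogram law with the term of f - g dropped; it stands in for the triangle inequality
    when squared norms are estimated. *)
Lemma normsq_le f g : L2 f -> L2 g ->
  norm (f + g) ^+ 2 <= 2 * norm f ^+ 2 + 2 * norm g ^+ 2.
Proof.
move=> Lf Lg; rewrite normsqD//.
have LN : L2 ((-1) *: g) by exact: L2Z.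
have n1 : normc (-1 : C) = 1 by rewrite normc_opp normc1.
have hZ := normsqZ (-1) Lg; rewrite n1 expr1n mul1r in hZ.
have hd : complex.Re (dot f (-1 *: g)) = - complex.Re (dot f g).
  by rewrite (dotZr (-1) Lg Lf) rmorphN rmorph1 mulN1r cReN.
have := normsqD Lf LN; rewrite hZ hd.
by have := sqr_ge0 (norm (f + -1 *: g)); lra.
Qed.

(** The Cauchy-Schwarz inequality. A function of norm 0 need not vanish here, so that case is
    separate: with b = -t <h, e> the squared norm of h + b e is linear in t and nonnegative, which
    forces <h, e> = 0. *)
Lemma bessel1 h e : L2 h -> L2 e -> normc (dot h e) ^+ 2 <= norm h ^+ 2 * norm e ^+ 2.
Proof.
move=> Lh Le; have [e0|e0] := eqVneq (norm e) 0.
  rewrite e0 expr0n mulr0.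
  have small t : 2 * t * normc (dot h e) ^+ 2 <= norm h ^+ 2.
    pose b : C := - t%:C%C * dot h e.
    have Lb : L2 (b *: e) by exact: L2Z.
    have := normsqD Lh Lb; rewrite normsqZ// e0 expr0n mulr0 addr0.
    have := sqr_ge0 (norm (h + b *: e)).
    have -> : complex.Re (dot h (b *: e)) = - (t * normc (dot h e) ^+ 2).
      rewrite dotZr// /b conjcM -mulrA cReM normc_sqr.
      rewrite cReM cImM !cRe_conj !cIm_conj !cReN !cImN /=; ring.
    by lra.
  have q0 := sqr_ge0 (normc (dot h e)).
  rewrite leNgt; apply/negP => q1.
  have := small (norm h ^+ 2 / normc (dot h e) ^+ 2); rewrite -mulrA divfK ?gt_eqF//.
  have := small (norm h ^+ 2 / normc (dot h e) ^+ 2 + 1 ).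
  rewrite mulrDr mulrDl -mulrA divfK ?gt_eqF//.
  by have := sqr_ge0 (norm h); lra.
have ep : 0 < norm e ^+ 2 by rewrite exprn_gt0// lt_def e0 A2norm_ge0.
pose c : C := dot h e / (norm e ^+ 2)%:C%C.
have Lc : L2 (c *: e) by exact: L2Z.
have o : dot (h - c *: e) (c *: e) = 0.
  rewrite dotZr//; last exact: L2B.
  rewrite dotBl// dotZl// dotff// /c divfK ?subrr ?mulr0//.
  by rewrite -normc_eq0 normc_real normr_eq0 gt_eqF.
have := pythagoras (L2B lambda1 Lh Lc) Lc o; rewrite subrK normsqZ//.
have := sqr_ge0 (norm (h - c *: e)).
rewrite /c normcM normcV normc_real ger0_norm ?(ltW ep)// expr_div_n => h1 h2.
suff : normc (dot h e) ^+ 2 / (norm e ^+ 2) <= norm h ^+ 2 by rewrite ler_pdivrMr.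
move: h2; rewrite (_ : _ / _ * _ = normc (dot h e) ^+ 2 / norm e ^+ 2); first by lra.
by field; rewrite e0.
Qed.

Definition rotv (c : nat -> C) (z : Cn) : Cn := \col_i (c i * z i 0).
Definition rotf (c : nat -> C) f : Fun := fun z => f (rotv c z).

Lemma Cn_of_rotx c (x : n.-tuple (RR R)) : Cn_of (rotx c x) = rotv c (Cn_of x).
Proof.
apply/matrixP => i j; rewrite !mxE tnth_mktuple.
by apply: complex_eq; rewrite ?cReM ?cImM.
Qed.

Lemma sqnorm_rotv c z : (forall i, normc (c i) = 1) -> sqnorm (rotv c z) = sqnorm z.
Proof. by move=> c1; apply: eq_bigr => i _; rewrite mxE normcM c1 mul1r. Qed.

Lemma Bn_rotv c z : (forall i, normc (c i) = 1) -> Bn (rotv c z) = Bn z :> Prop.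
Proof. by move=> c1; rewrite /Bn /= sqnorm_rotv. Qed.

Lemma Bnr_rotx c x : (forall i, normc (c i) = 1) -> B (rotx c x) = B x :> Prop.
Proof. by move=> c1; rewrite /Bnr /= Cn_of_rotx Bn_rotv. Qed.

Lemma weight_rotx c x : (forall i, normc (c i) = 1) -> w (rotx c x) = w x.
Proof. by move=> c1; rewrite /weight /density Cn_of_rotx sqnorm_rotv. Qed.

Lemma measurable_rotB c (F : n.-tuple (RR R) -> \bar R) : (forall i, normc (c i) = 1) ->
  measurable_fun B F -> measurable_fun B (F \o rotx c).
Proof.
move=> c1 mF; have mB := @measurable_Bnr R n.
apply: (@measurable_comp _ _ _ _ _ _ B) => //.
  by move=> _ [x xB <-]; rewrite Bnr_rotx.
by apply: measurable_funTS; exact: measurable_rotx.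
Qed.

Lemma ge0_integral_rotB c (F : n.-tuple (RR R) -> \bar R) : (forall i, normc (c i) = 1) ->
  measurable_fun B F -> (forall x, 0 <= F x)%E ->
  (\int[leb]_(x in B) F (rotx c x) = \int[leb]_(x in B) F x)%E.
Proof.
move=> c1 mF F0; have mB := @measurable_Bnr R n.
rewrite integral_mkcond [RHS]integral_mkcond.
have [_ h] := preserves_rotx n c1.
rewrite -(h (F \_ B)).
- apply: eq_integral => x _; rewrite !patchE.
  rewrite (_ : (rotx c x \in B) = (x \in B))//.
  by apply/idP/idP; rewrite !inE Bnr_rotx.
- exact/(measurable_restrictT _ mB).
- by move=> x; apply: erestrict_ge0.
Qed.

Lemma integral_rotB c (F : n.-tuple (RR R) -> \bar R) : (forall i, normc (c i) = 1) ->
  measurable_fun B F ->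
  (\int[leb]_(x in B) F (rotx c x) = \int[leb]_(x in B) F x)%E.
Proof.
move=> c1 mF; rewrite integralE [RHS]integralE; congr (_ - _)%E.
  rewrite -(ge0_integral_rotB c1 (measurable_funepos mF)).
    by apply: eq_integral => x _; rewrite !funeposE.
  by move=> x; exact: funepos_ge0.
rewrite -(ge0_integral_rotB c1 (measurable_funeneg mF)).
  by apply: eq_integral => x _; rewrite !funenegE.
by move=> x; exact: funeneg_ge0.
Qed.

Lemma Rintegral_rotB c (F : n.-tuple (RR R) -> R) : (forall i, normc (c i) = 1) ->
  measurable_fun B F ->
  \int[leb]_(x in B) F (rotx c x) = \int[leb]_(x in B) F x.
Proof.
by move=> c1 mF; congr fine; apply: (integral_rotB (F := EFin \o F)) => //; exact/measurable_EFinP.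
Qed.

Lemma cmeasurable_rotf c f : (forall i, normc (c i) = 1) -> cmeasurable f -> cmeasurable (rotf c f).
Proof.
move=> c1 [mR mI]; split.
  rewrite (_ : (fun x => _) = (fun x => complex.Re (f (Cn_of (rotx c x))))); last first.
    by apply/funext => x; rewrite Cn_of_rotx.
  by apply/measurable_EFinP; apply: (measurable_rotB (F := EFin \o (fun x => complex.Re (f (Cn_of x))))) => //; exact/measurable_EFinP.
rewrite (_ : (fun x => _) = (fun x => complex.Im (f (Cn_of (rotx c x))))); last first.
  by apply/funext => x; rewrite Cn_of_rotx.
by apply/measurable_EFinP; apply: (measurable_rotB (F := EFin \o (fun x => complex.Im (f (Cn_of x))))) => //; exact/measurable_EFinP.
Qed.

Lemma sqint_rotf c f : (forall i, normc (c i) = 1) -> cmeasurable f ->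
  sqint lambda (rotf c f) = sqint lambda f.
Proof.
move=> c1 mf; rewrite !sqintE -(ge0_integral_rotB (F := EFin \o sqf lambda f) c1).
- by apply: eq_integral => x _; rewrite /= /sqf weight_rotx// Cn_of_rotx.
- by apply/measurable_EFinP; exact: measurable_sqf.
- by move=> x; rewrite lee_fin sqf_ge0.
Qed.

Lemma L2_rotf c f : (forall i, normc (c i) = 1) -> L2 f -> L2 (rotf c f).
Proof.
move=> c1 /L2P[mf h]; apply/L2P; split; first exact: cmeasurable_rotf.
by rewrite sqint_rotf.
Qed.

Lemma dot_rotf c f g : (forall i, normc (c i) = 1) -> L2 f -> L2 g ->
  dot (rotf c f) (rotf c g) = dot f g.
Proof.
move=> c1 Lf Lg; rewrite !A2dotE /wint.
have [/integrableP[/measurable_EFinP mR _] /integrableP[/measurable_EFinP mI _]] :=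
  L2_wintegrable lambda1 Lf Lg.
by congr Complex; [rewrite -[RHS](Rintegral_rotB c1 mR)|rewrite -[RHS](Rintegral_rotB c1 mI)];
  apply: eq_Rintegral => x _; rewrite weight_rotx// Cn_of_rotx.
Qed.

(** For the unitary rotation U one has <f, g> = <Uf, Ug> = a b^* <f, g>. *)
Lemma dot_eigen c f g a b : (forall i, normc (c i) = 1) -> L2 f -> L2 g ->
  rotf c f = a *: f -> rotf c g = b *: g -> a * b^* != 1 -> dot f g = 0.
Proof.
move=> c1 Lf Lg fa gb ab; have := dot_rotf c1 Lf Lg.
rewrite fa gb dotZl ?dotZr//; last exact: L2Z.
rewrite mulrA => /eqP; rewrite -subr_eq0 -{2}[dot f g]mul1r -mulrBl mulf_eq0.
by rewrite subr_eq0 (negbTE ab) => /eqP.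
Qed.

Lemma cmeasurable_lim (F : nat -> Fun) f : (forall k, cmeasurable (F k)) ->
  (forall z, Bn z -> forall e : R, 0 < e -> exists N, forall k, (N <= k)%N -> normc (F k z - f z) <= e) ->
  cmeasurable f.
Proof.
move=> mF lim.
have cv (p : C -> R) : (forall z u, `|p z - p u| <= normc (z - u)) ->
    forall x, B x -> (fun k => p (F k (Cn_of x))) @ \oo --> p (f (Cn_of x)).
  move=> hp x xB; apply/cvgrPdist_le => e e0; have [N hN] := lim _ xB e e0.
  exists N => // k /hN; apply: le_trans; rewrite normc_distrC; exact: hp.
have mB := @measurable_Bnr R n.
split.
  apply: (measurable_fun_cvg (h := fun k x => complex.Re (F k (Cn_of x)))).
    by move=> k; case: (mF k).
  by apply: cv => z u; rewrite -cReN -cReD; exact: normc_Re.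
apply: (measurable_fun_cvg (h := fun k x => complex.Im (F k (Cn_of x)))).
  by move=> k; case: (mF k).
by apply: cv => z u; rewrite -cImN -cImD; exact: normc_Im.
Qed.

(** Fatou's lemma in the form used for averages: a pointwise limit on the ball inherits square
    integrability together with the bound. *)
Lemma L2_fatou (F : nat -> Fun) f (K : R) : (forall k, L2 (F k)) ->
  (forall z, Bn z -> forall e : R, 0 < e -> exists N, forall k, (N <= k)%N -> normc (F k z - f z) <= e) ->
  (exists N, forall k, (N <= k)%N -> norm (F k) ^+ 2 <= K) ->
  L2 f /\ norm f ^+ 2 <= K.
Proof.
move=> LF lim [N hN].
have mf : cmeasurable f by apply: cmeasurable_lim lim => k; have /L2P[] := LF k.
have mB := @measurable_Bnr R n.
have H : (sqint lambda f <= K%:E)%E.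
  (* The shift by N makes the bound on the norms hold for every index. *)
  pose G k x := (sqf lambda (F (k + N)%N) x)%:E.
  have cvG x : B x -> (G k x) @[k --> \oo] --> (sqf lambda f x)%:E.
    move=> xB; apply: cvg_EFin; first by near=> k.
    suff H : normc (F (k + N)%N (Cn_of x)) @[k --> \oo] --> normc (f (Cn_of x)).
      by apply: cvgM; [exact: (cvgM H H)|exact: cvg_cst].
    apply/cvgrPdist_le => e e0.
    have [M hM] := lim _ xB e e0; exists M => // k /= Mk.
    have {}hM := hM (k + N)%N (leq_trans Mk (leq_addr _ _)).
    rewrite ler_norml; apply/andP; split.
      have := normcD (F (k + N)%N (Cn_of x) - f (Cn_of x)) (f (Cn_of x)); rewrite subrK.
      by lra.
    have := normcD (f (Cn_of x) - F (k + N)%N (Cn_of x)) (F (k + N)%N (Cn_of x)).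
    by rewrite subrK normc_distrC; lra.
  have := @fatou _ _ R leb B mB G.
  move=> /(_ _ _)/le_trans ft.
  rewrite sqintE (eq_integral (fun x => limn_einf (G ^~ x))); last first.
    by move=> x; rewrite inE => xB; rewrite (cvg_limn_einf_sup (cvG _ xB)).1.
  apply: ft.
  - by move=> k; apply/measurable_EFinP; apply: measurable_sqf; have /L2P[] := LF (k + N)%N.
  - by move=> k x _; rewrite lee_fin sqf_ge0.
  - rewrite limn_einf_lim; apply: lime_le; first exact: is_cvg_einfs.
    apply: nearW => k; apply: (@le_trans _ _ (\int[leb]_(x in B) G k x)%E).
      by apply: ereal_inf_lbound; exists k => //=.
    rewrite -[leLHS]/(sqint lambda (F (k + N)%N)) L2_sqint// lee_fin.
    by apply: hN; rewrite leq_addl.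
split; first by apply/L2P; split => //; exact: le_lt_trans H (ltry _).
have fq : sqint lambda f \is a fin_num.
  by rewrite ge0_fin_numE ?sqint_ge0//; exact: le_lt_trans H (ltry _).
by move: H; rewrite (A2normsq lambda1) -{1}(fineK fq) lee_fin.
Unshelve. all: by end_near. Qed.

End Geometry.

(** * Averages over rotations of a coordinate *)

Section CoordinateAverages.
Variables (R : realType) (n : nat).
Notation C := R[i].
Notation Cn := 'cV[C]_n.
Notation Fun := (Cn -> C^o).
Implicit Types (f g : Fun) (z v : Cn) (u : C) (i l : 'I_n) (M k : nat).

Definition one_at i u : nat -> C := fun m => if m == i :> nat then u else 1.

Definition scl i u z : Cn := rotv (one_at i u) z.

Lemma sclE i u z l : scl i u z l 0 = (if l == i then u else 1) * z l 0.
Proof. by rewrite mxE. Qed.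

Lemma scl_comp i u u' z : scl i u (scl i u' z) = scl i (u * u') z.
Proof.
by apply/matrixP => l j; rewrite ord1 !sclE; case: eqP => _; ring.
Qed.

Lemma scl_comm i l u u' z : scl i u (scl l u' z) = scl l u' (scl i u z).
Proof. by apply/matrixP => m j; rewrite ord1 !sclE; ring. Qed.

Lemma scl1 i z : scl i 1 z = z.
Proof. by apply/matrixP => l j; rewrite ord1 sclE if_same mul1r. Qed.

Lemma one_at1 i u : normc u = 1 -> forall m, normc (one_at i u m) = 1.
Proof. by move=> u1 m; rewrite /one_at; case: ifP => _ //; exact: normc1. Qed.

Definition polydisc z : set Cn := [set v | forall l, normc (v l 0) <= normc (z l 0)].

Lemma polydisc_refl z : polydisc z z. Proof. by move=> l. Qed.

Lemma polydisc_scl z v i u : normc u <= 1 -> polydisc z v -> polydisc z (scl i u v).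
Proof.
move=> u1 zv l; rewrite sclE normcM; apply: le_trans (zv l).
by case: eqP => _; rewrite ?normc1 ?mul1r// ler_piMl ?normc_ge0.
Qed.

Lemma polydisc_Bn z v : Bn z -> polydisc z v -> Bn v.
Proof.
rewrite /Bn /= => zB zv; apply: le_lt_trans zB; apply: ler_sum => l _.
by rewrite lerXn2r ?nnegrE ?normc_ge0.
Qed.

Lemma Bn_scl z i u : normc u <= 1 -> Bn z -> Bn (scl i u z).
Proof.
by move=> u1 zB; apply: (polydisc_Bn zB); apply: polydisc_scl => //; exact: polydisc_refl.
Qed.

Definition Av M i k f : Fun := fun z =>
  M%:R^-1 * \sum_(j < M) (omega R M ^+ (j * k))^-1 * f (scl i (omega R M ^+ j) z).

Lemma normc_omegaX M j : normc (omega R M ^+ j) = 1.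
Proof. by rewrite normcX normc_omega expr1n. Qed.

Lemma normc_Av M i k f z (K : R) : (0 < M)%N ->
  (forall u, normc u = 1 -> normc (f (scl i u z)) <= K) -> normc (Av M i k f z) <= K.
Proof.
move=> M0 fK; rewrite /Av normcM normcV normc_nat mulrC.
rewrite ler_pdivrMr ?ltr0n//; apply: le_trans (normc_sum _ _ _) _.
apply: (@le_trans _ _ (\sum_(j < M) K)).
  apply: ler_sum => j _; rewrite normcM normcV normc_omegaX invr1 mul1r.
  by apply: fK; exact: normc_omegaX.
by rewrite sumr_const card_ord mulr_natr.
Qed.

Lemma Av_lin M i k a f g z : Av M i k (a *: f + g) z = a * Av M i k f z + Av M i k g z.
Proof.
rewrite /Av mulrCA -mulrDr; congr (_ * _).
rewrite mulr_sumr -big_split /=; apply: eq_bigr => j _.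
by rewrite -[(a *: f + g) _]/(a * f _ + g _) mulrDr mulrCA.
Qed.

Lemma Av_comm M M' i l k k' f z :
  Av M i k (Av M' l k' f) z = Av M' l k' (Av M i k f) z.
Proof.
rewrite /Av; under eq_bigr do rewrite mulrCA.
rewrite -mulr_sumr mulrCA; congr (_ * _).
under [RHS]eq_bigr do rewrite mulrCA.
rewrite -mulr_sumr; congr (_ * _).
under eq_bigr do rewrite mulr_sumr.
under [RHS]eq_bigr do rewrite mulr_sumr.
rewrite exchange_big /=; apply: eq_bigr => j _; apply: eq_bigr => j' _.
by rewrite mulrCA scl_comm.
Qed.

Lemma Av_scl M i l k u f z : Av M i k (fun v => f (scl l u v)) z = Av M i k f (scl l u z).
Proof. by congr (_ * _); apply: eq_bigr => j _; rewrite scl_comm. Qed.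

(** Summing over the characters k leaves only the rotation j = 0, which is the identity. *)
Lemma Av_total M i f z : (0 < M)%N -> \sum_(k < M) Av M i k f z = f z.
Proof.
move=> M0; rewrite /Av -mulr_sumr exchange_big /=.
rewrite (eq_bigr (fun j : 'I_M => (if j == Ordinal M0 then M%:R else 0) * f (scl i (omega R M ^+ j) z))).
  rewrite (bigD1 (Ordinal M0)) //= big1 ?addr0; last first.
    by move=> j /negbTE ->; rewrite mul0r.
  by rewrite expr0 scl1 mulrA mulVf ?mul1r// pnatr_eq0 -lt0n.
move=> j _; rewrite -mulr_suml; congr (_ * _).
have := @omega_sum R M j 0 (ltn_ord j); rewrite mod0n.
rewrite -val_eqE eq_sym /= => <-; apply: eq_bigr => k _.
by rewrite muln0 expr0 mulr1 mulnC.
Qed.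

Lemma omega_shift M (F : nat -> C) : (0 < M)%N -> F M = F 0%N ->
  \sum_(j < M) F j.+1 = \sum_(j < M) F j.
Proof.
move=> M0 FM; case: M M0 FM => // M _ FM.
by rewrite big_ord_recr /= FM [RHS]big_ord_recl addrC.
Qed.

(** Shifting j by one is cyclic, as omega^M = 1. At finite M the homogeneity is exact for such
    rotations only; it becomes full homogeneity in the limit. *)
Lemma Av_eigen M i k f z : (0 < M)%N ->
  Av M i k f (scl i (omega R M) z) = omega R M ^+ k * Av M i k f z.
Proof.
move=> M0; rewrite /Av mulrCA; congr (_ * _); rewrite mulr_sumr.
pose F j := omega R M ^+ k * ((omega R M ^+ (j * k))^-1 * f (scl i (omega R M ^+ j) z)).
have FM : F M = F 0%N.
  by rewrite /F mul0n expr0 exprM omegaM// expr1n.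
rewrite -(omega_shift M0 FM); apply: eq_bigr => j _; rewrite /F scl_comp -exprSr.
rewrite mulrA mulSn exprD invfM mulrA mulfV ?mul1r//.
by rewrite expf_neq0// omega_neq0.
Qed.

(* Unlike holomorphy, these estimates pass directly to pointwise limits of
   averages in another coordinate. *)
Definition good i f : Prop := forall z, Bn z -> exists K t : R,
  [/\ 0 <= K, 0 <= t < 1 & forall v, polydisc z v -> forall M k, (k < M)%N ->
    [/\ normc (Av M i k f v) <= K * t ^+ k,
        forall u, normc u <= 1 ->
          normc (Av M i k f (scl i u v) - u ^+ k * Av M i k f v) <= K * t ^+ M &
        forall M', (k < M')%N ->
          normc (Av M i k f v - Av M' i k f v) <= K * (t ^+ M + t ^+ M')]].

Definition climit (s : nat -> C) (a : C) : Prop := forall e : R, 0 < e ->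
  exists N, forall k, (N <= k)%N -> normc (s k - a) <= e.

Lemma climit_unique s a b : climit s a -> climit s b -> a = b.
Proof.
move=> sa sb; apply: eq_normcB => e e0; have e2 : 0 < e / 2 by lra.
have [N hN] := sa _ e2; have [N' hN'] := sb _ e2.
have h1 := hN (N + N')%N (leq_addr _ _); have h2 := hN' (N + N')%N (leq_addl _ _).
have -> : a - b = (s (N + N')%N - b) - (s (N + N')%N - a) by ring.
by apply: le_trans (normcB _ _) _; lra.
Qed.

Lemma climit_cauchy s :
  (forall e : R, 0 < e -> exists N, forall k k', (N <= k)%N -> (N <= k')%N -> normc (s k - s k') <= e) ->
  exists a, climit s a.
Proof.
move=> h.
have real_lim (p : C -> R) : (forall x y, `|p x - p y| <= normc (x - y)) ->
    exists a : R, forall e, 0 < e -> exists N, forall k, (N <= k)%N -> `|p (s k) - a| <= e.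
  move=> hp.
  have /cvg_ex[a ha] : cvg ((p \o s) @ \oo).
    apply/cauchy_cvgP; apply/cauchy_ballP => e e0.
    have e2 : 0 < e / 2 by lra.
    have [N hN] := h _ e2.
    pose S := [set p (s k) | k in [set k | (N <= k)%N]].
    exists (S, S); first by split; exists N => // k Nk; exists k.
    move=> [_ _] [/= [k Nk <-] [k' Nk' <-]]; rewrite /ball /=.
    by apply: le_lt_trans (hp _ _) _; apply: le_lt_trans (hN _ _ Nk Nk') _; lra.
  exists a => e e0; move/cvgrPdist_le : ha => /(_ e e0)[N _ hN].
  by exists N => k /hN; rewrite distrC.
have [a ha] := real_lim (@complex.Re R) (fun x y => ltac:(by rewrite -cReN -cReD; exact: normc_Re)).
have [b hb] := real_lim (@complex.Im R) (fun x y => ltac:(by rewrite -cImN -cImD; exact: normc_Im)).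
exists (Complex a b) => e e0; have e2 : 0 < e / 2 by lra.
have [N hN] := ha _ e2; have [N' hN'] := hb _ e2.
exists (N + N')%N => k Nk.
have h1 := hN k (leq_trans (leq_addr _ _) Nk).
have h2 := hN' k (leq_trans (leq_addl _ _) Nk).
apply: le_trans (normc_le_ReIm _) _; rewrite cReD cImD cReN cImN /=; lra.
Qed.

Lemma climit_le s a (K : R) : climit s a ->
  (exists N, forall k, (N <= k)%N -> normc (s k) <= K) -> normc a <= K.
Proof.
move=> sa [N hN]; apply/ler_addgt0Pl => e e0; have [N' hN'] := sa e e0.
have h1 := hN (N + N')%N (leq_addr _ _); have h2 := hN' (N + N')%N (leq_addl _ _).
have -> : a = s (N + N')%N - (s (N + N')%N - a) by ring.
by apply: le_trans (normcB _ _) _; lra.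
Qed.

Lemma climit_cst a : climit (fun=> a) a.
Proof. by move=> e e0; exists 0%N => k _; rewrite subrr normc0 ltW. Qed.

Lemma climit_lin c s1 s2 a b : climit s1 a -> climit s2 b ->
  climit (fun k => c * s1 k + s2 k) (c * a + b).
Proof.
move=> h1 h2 e e0; have c1 : 0 < 1 + normc c by rewrite ltr_wpDr ?normc_ge0.
have ec : 0 < e / 2 / (1 + normc c) by rewrite !divr_gt0.
have e2 : 0 < e / 2 by lra.
have [N hN] := h1 _ ec; have [N' hN'] := h2 _ e2.
exists (N + N')%N => k Nk.
have g1 := hN k (leq_trans (leq_addr _ _) Nk).
have g2 := hN' k (leq_trans (leq_addl _ _) Nk).
have -> : c * s1 k + s2 k - (c * a + b) = c * (s1 k - a) + (s2 k - b) by ring.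
apply: le_trans (normcD _ _) _; rewrite normcM.
apply: (@le_trans _ _ ((1 + normc c) * (e / 2 / (1 + normc c)) + e / 2)).
  by apply: lerD => //; apply: ler_pM; rewrite ?normc_ge0//; lra.
by rewrite mulrC divfK ?lt0r_neq0//; lra.
Qed.

Lemma climit_Av M i k (F : nat -> Fun) f z : (0 < M)%N ->
  (forall u, normc u = 1 -> climit (fun m => F m (scl i u z)) (f (scl i u z))) ->
  climit (fun m => Av M i k (F m) z) (Av M i k f z).
Proof.
move=> M0 h; rewrite /Av.
have sumlim : climit (fun m => \sum_(j < M) (omega R M ^+ (j * k))^-1 * F m (scl i (omega R M ^+ j) z))
    (\sum_(j < M) (omega R M ^+ (j * k))^-1 * f (scl i (omega R M ^+ j) z)).
  elim: (index_enum _) => [|j r IH].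
    rewrite big_nil (_ : (fun m => _) = fun=> 0); first exact: climit_cst.
    by apply/funext => m; rewrite big_nil.
  rewrite big_cons (_ : (fun m => _) = fun m =>
     (omega R M ^+ (j * k))^-1 * F m (scl i (omega R M ^+ j) z) +
     \sum_(j <- r) (omega R M ^+ (j * k))^-1 * F m (scl i (omega R M ^+ j) z)); last first.
    by apply/funext => m; rewrite big_cons.
  by apply: climit_lin => //; apply: h; exact: normc_omegaX.
have := climit_lin (M%:R^-1) sumlim (climit_cst 0); rewrite addr0.
by under eq_fun do rewrite addr0.
Qed.

Definition homog i d f : Prop := forall z u, Bn z -> normc u <= 1 ->
  f (scl i u z) = u ^+ d * f z.

(* The part of degree k of f in the coordinate i *)
Lemma coordinate_part i k f : good i f -> (forall z, ~ Bn z -> f z = 0) ->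
  exists g, [/\ forall z, ~ Bn z -> g z = 0,
    forall z, Bn z -> climit (fun M => Av M i k f z) (g z),
    homog i k g &
    forall z, Bn z -> exists K t : R, [/\ 0 <= K, 0 <= t < 1 &
      forall v, polydisc z v -> normc (g v) <= K * t ^+ k /\
        forall M, (k < M)%N -> normc (Av M i k f v - g v) <= K * t ^+ M]].
Proof.
move=> gf f0.
have Av0 M z : ~ Bn z -> Av M i k f z = 0.
  move=> zB; rewrite /Av big1 ?mulr0// => j _; rewrite f0 ?mulr0//.
  by rewrite Bn_rotv//; apply: one_at1; exact: normc_omegaX.
have /choice[g gP] : forall z, exists a, climit (fun M => Av M i k f z) a.
  move=> z; have [zB|zB] := pselect (Bn z); last first.
    exists 0; rewrite (_ : (fun M => _) = fun=> 0); first exact: climit_cst.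
    by apply/funext => M; rewrite Av0.
  apply: climit_cauchy => e e0; have [K [t [K0 t01 h]]] := gf z zB.
  have e2 : 0 < e / 2 by lra.
  have [N hN] := geometric_small K t01 e2.
  exists (N + k.+1)%N => M M' NM NM'.
  have kM := leq_trans (leq_addl _ _) NM; have kM' := leq_trans (leq_addl _ _) NM'.
  have [_ _ /(_ M' kM')] := h z (@polydisc_refl z) M k kM.
  move=> /le_trans; apply; rewrite mulrDr.
  have := hN _ (leq_trans (leq_addr _ _) NM); have := hN _ (leq_trans (leq_addr _ _) NM').
  by lra.
have bnd z : Bn z -> exists K t : R, [/\ 0 <= K, 0 <= t < 1 &
      forall v, polydisc z v -> normc (g v) <= K * t ^+ k /\
        forall M, (k < M)%N -> normc (Av M i k f v - g v) <= K * t ^+ M].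
  move=> zB; have [K [t [K0 t01 h]]] := gf z zB; exists K, t; split => // v zv.
  split.
    apply: climit_le (gP v) _; exists k.+1 => M kM.
    by have [] := h v zv M k kM.
  move=> M kM; apply/ler_addgt0Pl => e e0.
  have [N hN] := geometric_small K t01 e0.
  have [_ _ H] := h v zv M k kM.
  have lim : climit (fun M' => -1 * Av M' i k f v + Av M i k f v) (-1 * g v + Av M i k f v).
    by apply: climit_lin (gP v) (climit_cst _).
  rewrite addrC -mulN1r; apply: climit_le lim _.
  exists (N + k.+1)%N => M' NM'.
  have kM' := leq_trans (leq_addl _ _) NM'.
  rewrite mulN1r addrC; apply: le_trans (H M' kM') _; rewrite mulrDr addrC.
  by have := hN M' (leq_trans (leq_addr _ _) NM'); lra.
exists g; split => //.
- move=> z zB; apply: (climit_unique (gP z)).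
  rewrite (_ : (fun M => _) = fun=> 0); first exact: climit_cst.
  by apply/funext => M; rewrite Av0.
move=> z u zB u1; have [K [t [K0 t01 h]]] := gf z zB.
have lim : climit (fun M => - u ^+ k * Av M i k f z + Av M i k f (scl i u z))
    (- u ^+ k * g z + g (scl i u z)) by apply: climit_lin; exact: gP.
apply/eqP; rewrite -subr_eq0 addrC -mulNr; apply/eqP.
apply: (climit_unique lim) => e e0.
have [N hN] := geometric_small K t01 e0.
exists (N + k.+1)%N => M NM; rewrite subr0 mulNr addrC.
have kM := leq_trans (leq_addl _ _) NM.
have [_ /(_ u u1) H _] := h z (@polydisc_refl z) M k kM.
by apply: le_trans H _; apply: hN; exact: leq_trans (leq_addr _ _) NM.
Qed.

(* The part of f in the coordinate i is a limit of averages commuting with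
   those in the coordinate l *)
Lemma good_limit i l k f g : good l f ->
  (forall z, Bn z -> climit (fun M => Av M i k f z) (g z)) -> good l g.
Proof.
move=> gf lim z zB; have [K [t [K0 t01 h]]] := gf z zB.
exists K, t; split => // v zv M q qM.
have M0 : (0 < M)%N by rewrite (leq_trans _ qM).
have limAv M' q' v' : (0 < M')%N -> polydisc z v' ->
    climit (fun m => Av m i k (Av M' l q' f) v') (Av M' l q' g v').
  move=> M'0 zv'; under eq_fun do rewrite Av_comm.
  apply: climit_Av => // u u1; apply: lim; apply: Bn_scl; first by rewrite u1.
  exact: polydisc_Bn zB zv'.
have zrot v' u : polydisc z v' -> normc u = 1 -> polydisc z (scl i u v').
  by move=> zv' u1; apply: polydisc_scl => //; rewrite u1.
split.
- apply: climit_le (limAv M q v M0 zv) _; exists 1%N => m m0.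
  by apply: normc_Av => // u u1; have [] := h _ (zrot v u zv u1) M q qM.
- move=> u u1; have zuv := polydisc_scl l u1 zv.
  have L := climit_lin (- u ^+ q) (limAv M q v M0 zv) (limAv M q _ M0 zuv).
  rewrite addrC -mulNr; apply: climit_le L _; exists 1%N => m m0.
  rewrite -Av_scl -Av_lin; apply: normc_Av => // u' u'1.
  have [_ /(_ u u1) H _] := h _ (zrot v u' zv u'1) M q qM.
  rewrite -[X in normc X]/(- u ^+ q * Av M l q f _ + Av M l q f (scl l u _)) mulNr addrC.
  exact: H.
- move=> M' qM'; have M'0 : (0 < M')%N by rewrite (leq_trans _ qM').
  have L := climit_lin (-1) (limAv M' q v M'0 zv) (limAv M q v M0 zv).
  rewrite addrC -mulN1r; apply: climit_le L _; exists 1%N => m m0.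
  rewrite -Av_lin; apply: normc_Av => // u' u'1.
  have [_ _ /(_ M' qM') H] := h _ (zrot v u' zv u'1) M q qM.
  rewrite -[X in normc X]/(-1 * Av M' l q f _ + Av M l q f _) mulN1r addrC.
  exact: H.
Qed.

Lemma homog_limit i l k d f g : homog l d f ->
  (forall z, Bn z -> climit (fun M => Av M i k f z) (g z)) -> homog l d g.
Proof.
move=> hf lim z u zB u1.
have zuB := Bn_scl l u1 zB.
have L := climit_lin (u ^+ d) (lim z zB) (climit_cst 0); rewrite addr0 in L.
apply: (climit_unique (lim _ zuB)); move: L.
rewrite (_ : (fun k0 => _) = (fun M => Av M i k f (scl l u z)))//.
apply/funext => M; rewrite addr0 -Av_scl /Av mulrCA; congr (_ * _).
rewrite mulr_sumr; apply: eq_bigr => j _; rewrite hf//; first by rewrite mulrCA.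
by apply: Bn_scl => //; rewrite normc_omegaX.
Qed.

(** For fixed M the averages add up to f exactly, and those with D <= k < M are controlled by a
    geometric tail independent of M; then M tends to infinity. *)
Lemma sum_parts i f (G : nat -> Fun) : good i f ->
  (forall k z, Bn z -> climit (fun M => Av M i k f z) (G k z)) ->
  forall z, Bn z -> climit (fun D => \sum_(k < D) G k z) (f z).
Proof.
move=> gf lim z zB e e0; have [K [t [K0 t01 h]]] := gf z zB.
have /andP[t0 t1] := t01; have t1' : 0 < 1 - t by lra.
have [N hN] := geometric_small (K / (1 - t)) t01 e0.
exists N => D ND.
have limD : climit (fun M => \sum_(k < D) Av M i k f z) (\sum_(k < D) G k z).
  elim: (index_enum _) => [|j r IH].
    rewrite big_nil (_ : (fun m => _) = fun=> 0); first exact: climit_cst.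
    by apply/funext => m; rewrite big_nil.
  rewrite big_cons (_ : (fun m => _) = fun m =>
     1 * Av m i j f z + \sum_(j <- r) Av m i j f z); last first.
    by apply/funext => m; rewrite big_cons mul1r.
  by rewrite -[G j z]mul1r; apply: climit_lin => //; exact: lim.
have L := climit_lin 1 limD (climit_cst (- f z)); rewrite mul1r in L.
apply: climit_le L _; exists D.+1 => M DM; rewrite mul1r.
have M0 : (0 < M)%N by rewrite (leq_trans _ DM).
rewrite -(Av_total i f z M0) -normc_opp opprB.
rewrite -(big_mkord xpredT (fun k => Av M i k f z)) -(big_mkord xpredT (fun k => Av M i k f z)).
rewrite (@big_cat_nat _ _ _ D 0 M)//=; last exact: ltnW.
rewrite addrAC subrr add0r.
apply: le_trans (normc_sum _ _ _) _.
apply: (@le_trans _ _ (\sum_(D <= k < M) K * t ^+ k)).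
  rewrite big_nat_cond [leRHS]big_nat_cond; apply: ler_sum => k /andP[/andP[_ kM] _].
  by have [] := h z (@polydisc_refl z) M k kM.
rewrite -mulr_sumr; apply: le_trans (hN D ND).
rewrite mulrAC -mulrA; apply: ler_wpM2l => //; exact: geometric_tail.
Qed.

End CoordinateAverages.

(** * Compact polydiscs and the estimates for holomorphic functions *)

Section PolydiscBound.
Variables (R : realType).
Notation C := R[i].

Lemma compact_disc (r : R) : compact [set z : C | normc z <= r].
Proof.
pose phi (p : R * R) : C := Complex p.1 p.2.
have cphi : continuous phi.
  move=> [a b] A /nbhs_complexP[e e0 he].
  apply/nbhs_ballP; exists (e / 2); first by rewrite /= divr_gt0.
  move=> [a' b'] [/=]; rewrite /ball /= => h1 h2; apply: he.
  apply: le_lt_trans (normc_le_ReIm _) _ => /=.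
  by rewrite (distrC a') (distrC b'); lra.
have cbox : compact (phi @` (`[- r, r] `*` `[- r, r])).
  apply: continuous_compact; first exact: continuous_subspaceT.
  by apply: compact_setX; exact: segment_compact.
have cl : closed [set z : C | normc z <= r].
  move=> z hz; rewrite /= leNgt; apply/negP => zr.
  have [|w [/= wr wz]] := hz [set w | normc (w - z) < normc z - r].
    by apply/nbhs_complexP; exists (normc z - r); rewrite ?subr_gt0.
  have := normcD w (z - w); rewrite addrC subrK normc_distrC; lra.
have -> : [set z : C | normc z <= r] = phi @` (`[- r, r] `*` `[- r, r]) `&` [set z : C | normc z <= r].
  apply/seteqP; split => z; last by case.
  move=> /= zr; split => //; exists (complex.Re z, complex.Im z); last by case: z {zr}.
  have := normc_Re z; have := normc_Im z; rewrite !ler_norml !in_itv /= => h1 h2.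
  by split => /=; lra.
exact: compact_closedI.
Qed.

Variable n : nat.
Notation Cn := 'cV[C]_n.
Notation Fun := (Cn -> C^o).

Lemma polydisc_bounded (f : Fun) (z : Cn) :
  (forall v, polydisc z v -> {for v, continuous f}) ->
  exists K : R, forall v, polydisc z v -> normc (f v) <= K.
Proof.
move=> cf; pose D := [set x : 'rV[C]_n | forall i, normc (x ord0 i) <= normc (z i 0)].
(* f is moved to row vectors because [rV_compact] concerns products of compact sets in that form. *)
have cD : compact D.
  exact: (@rV_compact C n (fun i => [set x | normc x <= normc (z i 0)]) (fun i => @compact_disc _)).
pose F (x : 'rV[C]_n) : R := normc (f x^T).
have DP x : D x -> polydisc z x^T by move=> h i; rewrite mxE.
have cF : {within D, continuous F}.
  apply: continuous_in_subspaceT => x; rewrite inE => /DP/cf cx.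
  move=> A /nbhs_ballP[e /= e0 he].
  have nb : nbhs (f x^T : C^o) [set u : C | normc (u - f x^T) < e].
    by apply/nbhs_complexP; exists e.
  have /nbhs_cV[d d0 hd] : nbhs x^T (f @^-1` [set u : C | normc (u - f x^T) < e]) := cx _ nb.
  apply/nbhs_ballP; exists d%:C%C => /=; first by rewrite ltcR.
  move=> y [_ xy]; apply: he.
  have hy : normc (f y^T - f x^T) < e.
    apply: hd => i; rewrite !mxE.
    by have := xy 0 i; rewrite -ball_normE /= normc_ltc normc_distrC.
  rewrite /ball /= ltr_norml /F; apply/andP; split.
    have := normcD (f x^T - f y^T) (f y^T); have := normcD (f y^T - f x^T) (f x^T).
    by rewrite !subrK; lra.
  have := normcD (f x^T - f y^T) (f y^T); rewrite subrK normc_distrC; lra.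
have [M [_ hM]] := compact_bounded (continuous_compact cF cD).
have M1 : M < M + 1 by rewrite ltrDl.
have {}hM : forall y, (F @` D) y -> `|y| <= M + 1 := hM _ M1.
exists (M + 1) => v zv.
have vD : (F @` D) (F v^T) by exists v^T => // i; rewrite mxE.
by have := hM _ vD; rewrite /F trmxK ger0_norm ?normc_ge0.
Qed.

Definition upd (i : 'I_n) (u : C) (z : Cn) : Cn := \col_l (if l == i then u else z l 0).

Lemma scl_upd i u z : scl i u z = upd i (u * z i 0) z.
Proof. by apply/matrixP => l j; rewrite ord1 sclE mxE; case: eqP => [->|_]; rewrite ?mul1r. Qed.

(** Brings the averages in one coordinate down to the one-variable averages of a slice of f. *)
Lemma Av_avg M k (f : Fun) i z : Av M i k f z = avg M k (fun u => f (upd i u z)) (z i 0).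
Proof. by congr (_ * _); apply: eq_bigr => j _; rewrite scl_upd. Qed.

Lemma upd_scl i u v z : upd i u (scl i v z) = upd i u z.
Proof.
apply/matrixP => l j; rewrite ord1 !mxE; case: eqP => // li.
by rewrite /one_at; case: eqP => [/val_inj//|_]; rewrite mul1r.
Qed.

Lemma sqnorm_upd i u z : sqnorm (upd i u z) = sqnorm z - normc (z i 0) ^+ 2 + normc u ^+ 2.
Proof.
rewrite /sqnorm (bigD1 i)//= [X in _ = X - _ + _](bigD1 i)//= mxE eqxx.
rewrite (eq_bigr (fun l => normc (z l 0) ^+ 2)); first by ring.
by move=> l /negbTE li; rewrite mxE li.
Qed.

Lemma differentiable_cdiff (f : Fun) i z u : differentiable f (upd i u z) ->
  cdiff (fun v => f (upd i v z)) u.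
Proof.
move=> df; have dd : derivable f (upd i u z) (delta_mx i 0).
  exact (@diff_derivable _ _ _ f (upd i u z) (delta_mx i 0) df).
have E h : h *: delta_mx i 0 + upd i u z = upd i (h + u) z.
  apply/matrixP => l j; rewrite ord1 !mxE eqxx andbT.
  by case: eqP => _; rewrite ?mulr1// mulr0 add0r.
have /cvg_ex[q hq] := dd; exists (q : C) => e e0.
have nq : nbhs (q : C^o) [set w : C | normc (w - q) <= e].
  by apply/nbhs_complexP; exists e => // w; exact: ltW.
have /nbhs_complexP[r r0 hr] := hq _ nq; exists r => // w wu.
have [->|nwu] := eqVneq w u; first by rewrite !subrr mulr0 subr0 normc0 mulr0.
have nz : w - u != 0 by rewrite subr_eq0.
have hw0 : normc (w - u - 0) < r by rewrite subr0.
have H : normc ((w - u)^-1 * (f ((w - u) *: delta_mx i 0 + upd i u z) - f (upd i u z)) - q) <= e.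
  exact (hr (w - u) hw0 nz).
rewrite E subrK in H.
have -> : f (upd i w z) - f (upd i u z) - q * (w - u) =
    ((w - u)^-1 * (f (upd i w z) - f (upd i u z)) - q) * (w - u).
  by rewrite mulrBl mulrAC mulVf// mul1r.
by rewrite normcM ler_wpM2r// normc_ge0.
Qed.

(** The radius |z_i| can be enlarged to some r without the polydisc leaving the ball. On the
    enlarged polydisc f is bounded by compactness, so one constant K and one ratio |z_i| / r serve
    all v in the polydisc of z, as [good] demands. *)
Lemma holomorphic_good (f : Fun) i : holomorphic f -> good i f.
Proof.
move=> hf z zB; pose s := normc (z i 0).
(* The squared radius of the disc in which z_i may vary while the other coordinates are fixed. *)
pose Q := 1 - sqnorm z + s ^+ 2.
have s0 : 0 <= s := normc_ge0 _.
have zz : sqnorm z < 1 := zB.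
have Qs : s ^+ 2 < Q by rewrite /Q; lra.
have Q0 : 0 <= Q by apply: le_trans (sqr_ge0 s) (ltW Qs).
pose R0 := Num.sqrt Q.
have R0Q : R0 ^+ 2 = Q by rewrite sqr_sqrtr.
have sR0 : s < R0 by rewrite -(ltr_pXn2r (_ : 0 < 2)%N) ?nnegrE ?sqrtr_ge0// R0Q.
pose r := (s + R0) / 2.
have sr : s < r by rewrite /r; lra.
have rR0 : r < R0 by rewrite /r; lra.
have r0 : 0 < r by lra.
pose z' := upd i r%:C%C z.
have nr : normc (r%:C%C : C) = r by rewrite normc_real ger0_norm// ltW.
have z'B : Bn z'.
  rewrite /Bn /= sqnorm_upd nr -/s.
  have : r ^+ 2 < R0 ^+ 2 by rewrite ltrXn2r// ?nnegrE; lra.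
  by rewrite R0Q /Q; lra.
have [K hK] : exists K, forall v, polydisc z' v -> normc (f v) <= K.
  apply: polydisc_bounded => v zv.
  exact/differentiable_continuous/hf/(polydisc_Bn z'B zv).
have K0 : 0 <= K by apply: le_trans (normc_ge0 _) (hK z' (@polydisc_refl _ _ _)).
have r1 : 0 <= s / r < 1.
  by rewrite divr_ge0 ?(ltW r0)//= ltr_pdivrMr// mul1r.
exists (4 * K / (1 - s / r)), (s / r); split => //.
  by rewrite divr_ge0 ?mulr_ge0//; lra.
move=> v zv M k kM.
pose g u := f (upd i u v).
(* The other coordinates of v are no larger than those of z, so the slice through v contains the
   disc found for z. *)
have updB u : normc u < R0 -> Bn (upd i u v).
  move=> uR; rewrite /Bn /=; have -> : upd i u v = upd i u (upd i 0 v).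
    by apply/matrixP => l j; rewrite ord1 !mxE; case: eqP.
  have h1 : sqnorm (upd i 0 v) <= sqnorm (upd i 0 z).
    apply: ler_sum => l _; rewrite !mxE; case: eqP => // _.
    by rewrite lerXn2r ?nnegrE ?normc_ge0//; exact: zv.
  rewrite sqnorm_upd mxE eqxx normc0 expr0n subr0.
  move: h1; rewrite [leRHS]sqnorm_upd normc0 expr0n -/s => h1.
  have : normc u ^+ 2 < R0 ^+ 2 by rewrite ltrXn2r// ?nnegrE ?normc_ge0 ?sqrtr_ge0.
  by rewrite R0Q /Q /=; move: h1; rewrite /=; lra.
have dg u : normc u < R0 -> cdiff g u.
  by move=> uR; apply: differentiable_cdiff; apply: hf; exact: updB.
have gK u : normc u = r -> normc (g u) <= K.
  move=> ur; apply: hK => l; rewrite !mxE; case: eqP => _; last exact: zv.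
  by rewrite nr ur.
have rr : 0 < r < R0 by rewrite r0.
have sr' : 0 <= s < r by rewrite s0.
have [h1 h2 h3] := avg_bounds dg rr gK sr' kM (zv i).
split.
- by rewrite Av_avg.
- move=> u u1; rewrite !Av_avg; have := h2 u u1.
  rewrite sclE eqxx; congr (normc (_ - _) <= _).
  by congr (avg _ _ _ _); apply/funext => u'; rewrite upd_scl.
- by move=> M' kM'; rewrite !Av_avg; exact: h3.
Qed.

End PolydiscBound.

(** * Expansion into homogeneous parts in one coordinate *)

Section CoordinateSeries.
Variables (R : realType) (n : nat) (lambda : R).
Hypothesis lambda1 : -1 < lambda.
Notation C := R[i].
Notation Cn := 'cV[C]_n.
Notation Fun := (Cn -> C^o).
Notation L2 := (@L2 R n lambda).
Notation dot := (@A2dot R n lambda).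
Notation norm := (@A2norm R n lambda).
Implicit Types (f g h : Fun) (a b : C) (i l : 'I_n) (M D k d : nat).

Lemma mul_conj_neq1 a b : normc b = 1 -> a != b -> a * b^* != 1.
Proof.
move=> b1; apply: contra_neq => ab1.
have bb : b^* * b = 1.
  have : normc b ^+ 2 = 1 by rewrite b1 expr1n.
  rewrite normc_sqr conjE; case: b {ab1 b1} => x y /= xy.
  by apply: complex_eq; rewrite ?cReM ?cImM /=; [rewrite -[RHS]xy|]; ring.
by rewrite -[a]mulr1 -bb mulrA ab1 mul1r.
Qed.

Lemma omega_inj M k d : (k < M)%N -> (d < M)%N -> k != d -> omega R M ^+ k != omega R M ^+ d.
Proof.
wlog kd : k d / (k < d)%N.
  move=> H kM dM kd; have [lt|gt|E] := ltngtP k d; first exact: H.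
    by rewrite eq_sym; apply: H; rewrite // eq_sym.
  by rewrite E eqxx in kd.
move=> kM dM _; apply/eqP => E.
have M0 : (0 < d - k < M)%N by rewrite subn_gt0 kd /= (leq_ltn_trans (leq_subr _ _)).
have := omega_neq1 R M0; rewrite -(subnKC (ltnW kd)) exprD in E.
have o0 : omega R M ^+ k != 0 by rewrite expf_neq0// omega_neq0.
by rewrite -(inj_eq (mulfI o0)) mulr1 -E eqxx.
Qed.

Lemma dot_coord i M k d f g : (k < M)%N -> (d < M)%N -> k != d -> L2 f -> L2 g ->
  (forall z, f (scl i (omega R M) z) = omega R M ^+ k * f z) ->
  (forall z, g (scl i (omega R M) z) = omega R M ^+ d * g z) -> dot f g = 0.
Proof.
move=> kM dM kd fL gL hf hg.
apply: (@dot_eigen _ _ _ lambda1 (one_at i (omega R M)) f g (omega R M ^+ k) (omega R M ^+ d)) => //.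
- by apply: one_at1; exact: normc_omega.
- exact/funext.
- exact/funext.
- by apply: mul_conj_neq1; [exact: normc_omegaX|exact: omega_inj].
Qed.

Lemma AvE M i k f : Av M i k f =
  \sum_(j < M) (M%:R^-1 * (omega R M ^+ (j * k))^-1) *: rotf (one_at i (omega R M ^+ j)) f.
Proof.
apply/funext => z; rewrite fct_sumE /Av mulr_sumr.
by apply: eq_bigr => j _; rewrite mulrA.
Qed.

Lemma L2_Av M i k f : L2 f -> L2 (Av M i k f).
Proof.
move=> fL; rewrite AvE; apply: L2_sum => // j _; apply: L2Z => //; apply: L2_rotf => //.
by apply: one_at1; exact: normc_omegaX.
Qed.

Lemma normsq_sum (F : nat -> Fun) D : (forall k, L2 (F k)) ->
  (forall k d, (k < D)%N -> (d < D)%N -> k != d -> dot (F k) (F d) = 0) ->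
  norm (\sum_(k < D) F k) ^+ 2 = \sum_(k < D) norm (F k) ^+ 2.
Proof.
move=> FL; elim: D => [|D IH] ort.
  rewrite !big_ord0; have := normsqZ lambda1 0 (L2_0 n lambda).
  by rewrite scale0r normc0 expr0n mul0r.
rewrite !big_ord_recr/= pythagoras//; last 2 first.
- by apply: L2_sum => // k _.
- rewrite dot_suml// big1// => k _; apply: ort => //; first exact: ltnW (ltn_ord k).
  by rewrite neq_ltn ltn_ord.
by rewrite IH// => k d kD dD; apply: ort; exact: ltnW.
Qed.

Lemma dot_Av M i k d f : (k < M)%N -> (d < M)%N -> k != d -> L2 f ->
  dot (Av M i k f) (Av M i d f) = 0.
Proof.
move=> kM dM kd fL; have M0 : (0 < M)%N by rewrite (leq_trans _ kM).
apply: (dot_coord kM dM kd); rewrite ?L2_Av//; try exact: L2_Av.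
- by move=> z; exact: Av_eigen.
- by move=> z; exact: Av_eigen.
Qed.

Lemma Av_bessel M D i f : L2 f -> (0 < M)%N -> (D <= M)%N ->
  norm (\sum_(k < D) Av M i k f) ^+ 2 <= norm f ^+ 2.
Proof.
move=> fL M0 DM.
have parseval : \sum_(k < M) norm (Av M i k f) ^+ 2 = norm f ^+ 2.
  rewrite -(normsq_sum (F := fun k => Av M i k f)); last 2 first.
  - by move=> k; exact: L2_Av.
  - by move=> k d kM dM kd; exact: dot_Av.
  by congr (norm _ ^+ 2); apply/funext => z; rewrite fct_sumE Av_total.
rewrite (normsq_sum (F := fun k => Av M i k f)); last 2 first.
- by move=> k; exact: L2_Av.
- by move=> k d kD dD kd; apply: dot_Av => //; exact: leq_trans DM.
rewrite -parseval (big_ord_widen M (fun k => norm (Av M i k f) ^+ 2))//.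
rewrite [leRHS](bigID (fun k : 'I_M => (k < D)%N))/= lerDl.
by apply: sumr_ge0 => k _; exact: sqr_ge0.
Qed.

(** The class within which the coordinates can be treated one after another: it contains A^2 and is
    stable under taking homogeneous parts. *)
Definition good_fun f : Prop :=
  [/\ forall z, ~ Bn z -> f z = 0, L2 f & forall i, good i f].

Lemma homog_rot i k f u z : (forall z, ~ Bn z -> f z = 0) -> homog i k f -> normc u = 1 ->
  f (scl i u z) = u ^+ k * f z.
Proof.
move=> f0 hf u1; have [zB|zB] := pselect (Bn z); first by apply: hf; rewrite ?u1.
by rewrite !f0 ?mulr0//; rewrite /scl Bn_rotv//; exact: one_at1.
Qed.

Lemma climit_sum (s : nat -> nat -> C) (a : nat -> C) D :
  (forall k, climit (s k) (a k)) ->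
  climit (fun m => \sum_(k < D) s k m) (\sum_(k < D) a k).
Proof.
move=> h; elim: D => [|D IH].
  under eq_fun do rewrite big_ord0; rewrite big_ord0; exact: climit_cst.
under eq_fun do rewrite big_ord_recr/= addrC; rewrite big_ord_recr/= addrC.
have := climit_lin 1 (h D) IH; rewrite mul1r; under eq_fun do rewrite mul1r.
by [].
Qed.

Lemma coordinate_series i f : good_fun f -> exists G : nat -> Fun,
  [/\ forall k, good_fun (G k), forall k, homog i k (G k),
      forall k l d, homog l d f -> homog l d (G k) &
      forall e : R, 0 < e -> exists D, norm (f - \sum_(k < D) G k) ^+ 2 <= e].
Proof.
move=> [f0 fL fg].
have [G hG] := choice (fun k => coordinate_part k (fg i) f0).
have G0 k z : ~ Bn z -> G k z = 0 by case: (hG k) => h _ _ _; exact: h.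
have Glim k z : Bn z -> climit (fun M => Av M i k f z) (G k z) by case: (hG k) => _ h _ _; exact: h.
have Ghom k : homog i k (G k) by case: (hG k).
have Gsum D : L2 (\sum_(k < D) G k) /\ norm (\sum_(k < D) G k) ^+ 2 <= norm f ^+ 2.
  apply: (@L2_fatou _ _ _ lambda1 (fun M => \sum_(k < D) Av M i k f)).
  - by move=> M; apply: L2_sum => // k _; exact: L2_Av.
  - move=> z zB e e0.
    have [N hN] := climit_sum (s := fun k M => Av M i k f z) D (fun k => Glim k z zB) e0.
    by exists N => M NM; rewrite !fct_sumE; exact: hN.
  - exists D.+1 => M DM; apply: Av_bessel => //; [exact: leq_trans DM|exact: ltnW].
have GL k : L2 (G k).
  have -> : G k = \sum_(j < k.+1) G j - \sum_(j < k) G j by rewrite big_ord_recr/= addrAC subrr add0r.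
  by apply: L2B => //; exact: (Gsum _).1.
have Gort k d : k != d -> dot (G k) (G d) = 0.
  (* The order k + d + 1 exceeds both degrees, so the rotation has different eigenvalues on the two
     parts. *)
  move=> kd; apply: (@dot_coord i (k + d).+1 k d) => //.
  - by rewrite ltnS leq_addr.
  - by rewrite ltnS leq_addl.
  - by move=> z; apply: homog_rot => //; [exact: G0|exact: normc_omega].
  - by move=> z; apply: homog_rot => //; [exact: G0|exact: normc_omega].
exists G; split => //.
- move=> k; split => //; first exact: G0.
  by move=> l; apply: (good_limit (i := i) (k := k) (fg l)) => z; exact: Glim.
- by move=> k l d hf; apply: (homog_limit (i := i) (k := k) hf) => z; exact: Glim.
move=> e e0.
pose s D := \sum_(k < D) norm (G k) ^+ 2.
have sE D : s D = norm (\sum_(k < D) G k) ^+ 2 by rewrite normsq_sum// => k d _ _; exact: Gort.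
have hs : has_sup (range s).
  split; first by exists (s 0%N), 0%N.
  by exists (norm f ^+ 2) => _ [D _ <-]; rewrite sE; exact: (Gsum D).2.
(* The squared norms of the partial sums are increasing and bounded; D is an index at which they are
   within e of their supremum. *)
have [_ [D _ <-] hD] := sup_adherent e0 hs.
exists D.
suff [] : L2 (f - \sum_(k < D) G k) /\ norm (f - \sum_(k < D) G k) ^+ 2 <= e by [].
(* f minus the partial sum is the pointwise limit of the blocks of parts from D on, whose squared
   norms are s (D + m) - s D. *)
apply: (@L2_fatou _ _ _ lambda1 (fun m => \sum_(k < m) G (D + k)%N)).
- by move=> m; apply: L2_sum.
- move=> z zB e' e'0.
  have [N hN] := sum_parts (fg i) (fun k z => Glim k z) zB e'0.
  exists N => m Nm; have := hN (D + m)%N (leq_trans Nm (leq_addl _ _)).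
  rewrite big_split_ord /= fct_sumE.
  rewrite -[(f - _) z]/(f z - (\sum_(k < D) G k) z) fct_sumE.
  by congr (normc _ <= _); ring.
- exists 0%N => m _.
  rewrite (normsq_sum (F := fun k => G (D + k)%N))//; last first.
    by move=> k d _ _ kd; apply: Gort; rewrite eqn_add2l.
  have : s (D + m)%N <= sup (range s) by apply: ub_le_sup; [case: hs|exists (D + m)%N].
  by rewrite /s big_split_ord /= -/(s D); lra.
Qed.

End CoordinateSeries.

(** * Linear spans *)

Section LinearSpan.
Variables (K : pzRingType) (V : lmodType K).
Implicit Types (E F : set V).

Lemma lin_spanS E : E `<=` lin_span E.
Proof.
move=> v Ev; exists 1%N, (fun=> 1), (fun=> v); split=> //.
by rewrite big_ord1 scale1r.
Qed.

Lemma lin_span_subspace E : lin_subspace (lin_span E).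
Proof.
split; first by exists 0%N, (fun=> 0), (fun=> 0); split=> [[]//|]; rewrite big_ord0.
move=> a _ _ [r [x [u [uE ->]]]] [r' [x' [u' [u'E ->]]]].
exists (r + r')%N, (fun i => match fintype.split i with inl j => a * x j | inr j => x' j end).
exists (fun i => match fintype.split i with inl j => u j | inr j => u' j end); split.
  by move=> i; case: fintype.split.
rewrite big_split_ord scaler_sumr; congr (_ + _); apply: eq_bigr => j _.
  by rewrite (unsplitK (inl j)) scalerA.
by rewrite (unsplitK (inr j)).
Qed.

Lemma lin_subspace_sum F (I : Type) (r : seq I) (P : pred I) (u : I -> V) : lin_subspace F ->
  (forall i, P i -> F (u i)) -> F (\sum_(i <- r | P i) u i).
Proof.
move=> [F0 FD] Fu; elim/big_ind: _ => // x y Fx Fy.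
by rewrite -[x]scale1r; exact: FD.
Qed.

Lemma lin_subspaceZ F a u : lin_subspace F -> F u -> F (a *: u).
Proof. by move=> [F0 FD] Fu; rewrite -[_ *: _]addr0; exact: FD. Qed.

Lemma lin_span_min E F : lin_subspace F -> E `<=` F -> lin_span E `<=` F.
Proof.
move=> sF EF _ [r [a [u [uE ->]]]]; apply: lin_subspace_sum => // i _.
by apply: lin_subspaceZ => //; exact: EF.
Qed.

Lemma lin_span_le E F : E `<=` F -> lin_span E `<=` lin_span F.
Proof.
move=> EF; apply: lin_span_min; first exact: lin_span_subspace.
exact: subset_trans EF (@lin_spanS _).
Qed.

End LinearSpan.

(** Serves [holomorphic_mono]: a monomial cut off outside the ball differs from the polynomial by a
    function that vanishes near every point of the ball. *)
Lemma near0_differentiable (K : numFieldType) (V W : normedModType K) (h : V -> W) (z : V) :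
  nbhs z [set y | h y = 0] -> differentiable h z.
Proof.
move=> h0; have hz : h z = 0 := nbhs_singleton h0.
have h0' : \forall y \near (0 : V), h (y + z) = 0.
  by move: h0; rewrite -[nbhs z _]/(\near z, h z = 0) (near_shift 0 z) /= subr0.
have E : h \o shift z = cst (h z) + (\0 : {linear V -> W}) +o_ 0 id.
  apply/eqaddoP => e e0; near=> y.
  have -> : (h \o shift z - (cst (h z) + (\0 : V -> W))) y = 0.
    rewrite -[LHS]/(h (y + z) - (h z + 0)) hz addr0 subr0.
    by near: y.
  by rewrite normr0 mulr_ge0// ltW.
have c0 : continuous (\0 : {linear V -> W}) by move=> y; exact: cst_continuous.
apply/diff_locallyP; rewrite (diff_unique c0 E); split; first by [].
exact: E.
Unshelve. all: by end_near.
Qed.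

(** * Monomials and their density *)

Section Monomials.
Variables (R : realType) (n : nat) (lambda : R).
Hypothesis lambda1 : -1 < lambda.
Notation C := R[i].
Notation Cn := 'cV[C]_n.
Notation Fun := (Cn -> C^o).
Notation L2 := (@L2 R n lambda).
Notation A2 := (@A2 R n lambda).
Notation dot := (@A2dot R n lambda).
Notation norm := (@A2norm R n lambda).
Implicit Types (f g h : Fun) (a b : C) (i l : 'I_n) (d : 'I_n -> nat).

(** This is [monomial] with the exponents given by a function and without reference to blocks;
    [calP_wspan] makes the translation. *)
Definition mono d : Fun := (fun z => \prod_i z i 0 ^+ d i) \_ Bn.

Lemma mono_in d z : Bn z -> mono d z = \prod_i z i 0 ^+ d i.
Proof. by move=> zB; rewrite /mono patchE mem_set. Qed.

Lemma mono_out d z : ~ Bn z -> mono d z = 0.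
Proof. by move=> zB; rewrite /mono patchE memNset. Qed.

Lemma differentiable_prod d z : differentiable ((fun z => \prod_i z i 0 ^+ d i) : Fun) z.
Proof.
have coordX i k : differentiable ((fun z : Cn => z i 0 ^+ k) : Fun) z.
  elim: k => [|k IH]; first by under eq_fun do rewrite expr0; exact: differentiable_cst.
  under eq_fun do rewrite exprS.
  exact (@differentiableM C _ (fun z : Cn => z i 0 : C^o) (fun z : Cn => z i 0 ^+ k) z (@differentiable_coord C n 1 z i 0) IH).
elim: (index_enum _) => [|i s IH].
  by under eq_fun do rewrite big_nil; exact: differentiable_cst.
under eq_fun do rewrite big_cons.
exact (@differentiableM C _ (fun z : Cn => z i 0 ^+ d i : C^o) (fun z : Cn => \prod_(j <- s) z j 0 ^+ d j) z (coordX i (d i)) IH).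
Qed.

Lemma holomorphic_mono d : holomorphic (mono d).
Proof.
move=> z zB; pose p : Fun := fun z => \prod_i z i 0 ^+ d i.
have -> : mono d = p + (mono d - p) by rewrite addrC subrK.
apply: differentiableD; first exact: differentiable_prod.
apply: near0_differentiable.
apply: filterS (nbhs_Bn zB) => y yB /=.
by rewrite -[LHS]/(mono d y - p y) mono_in// subrr.
Qed.

Lemma cmeasurable_mul f g : cmeasurable f -> cmeasurable g -> cmeasurable (fun z => f z * g z).
Proof.
move=> [fR fI] [gR gI]; split.
  rewrite (_ : (fun x => _) = (fun x => complex.Re (f (Cn_of x)) * complex.Re (g (Cn_of x)) -
     complex.Im (f (Cn_of x)) * complex.Im (g (Cn_of x)))).
    by apply: measurable_funB; apply: measurable_funM.
  by apply/funext => x; rewrite /= cReM.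
rewrite (_ : (fun x => _) = (fun x => complex.Re (f (Cn_of x)) * complex.Im (g (Cn_of x)) +
     complex.Im (f (Cn_of x)) * complex.Re (g (Cn_of x)))).
  by apply: measurable_funD; apply: measurable_funM.
by apply/funext => x; rewrite /= cImM.
Qed.

Lemma cmeasurable_cst a : @cmeasurable R n (fun=> a).
Proof. by split; exact: measurable_cst. Qed.

Lemma cmeasurable_coord i : @cmeasurable R n (fun z => z i 0).
Proof.
split; apply: measurable_funTS.
  rewrite (_ : (fun x => _) = fst \o (fun x : n.-tuple (RR R) => tnth x i)).
    exact: measurableT_comp measurable_fst (measurable_tnth i).
  by apply/funext => x; rewrite mxE.
rewrite (_ : (fun x => _) = snd \o (fun x : n.-tuple (RR R) => tnth x i)).
  exact: measurableT_comp measurable_snd (measurable_tnth i).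
by apply/funext => x; rewrite mxE.
Qed.

Lemma cmeasurable_mono d : cmeasurable (mono d).
Proof.
have coordX i k : @cmeasurable R n (fun z => z i 0 ^+ k).
  elim: k => [|k IH]; first by under eq_fun do rewrite expr0; exact: cmeasurable_cst.
  by under eq_fun do rewrite exprS; apply: cmeasurable_mul => //; exact: cmeasurable_coord.
have [hR hI] : @cmeasurable R n (fun z => \prod_i z i 0 ^+ d i).
  elim: (index_enum _) => [|i s IH].
    by under eq_fun do rewrite big_nil; exact: cmeasurable_cst.
  by under eq_fun do rewrite big_cons; exact: cmeasurable_mul.
split; [move: hR|move: hI]; apply: eq_measurable_fun => x; rewrite inE => xB;
  by rewrite mono_in.
Qed.

Lemma normc_coord (z : Cn) i : Bn z -> normc (z i 0) <= 1.
Proof.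
move=> zB; rewrite -(@expr_le1 _ 2)// ?normc_ge0//; apply: le_trans (ltW zB).
rewrite /sqnorm (bigD1 i)//= lerDl; apply: sumr_ge0 => l _; exact: sqr_ge0.
Qed.

Lemma normc_prod (I : Type) (r : seq I) (F : I -> C) :
  normc (\prod_(i <- r) F i) = \prod_(i <- r) normc (F i).
Proof. by apply: (big_morph (@normc R)) => [x y|]; [exact: normcM|exact: normc1]. Qed.

(** Monomials are bounded by 1 on the ball, whose weighted measure is finite. *)
Lemma L2_mono d : L2 (mono d).
Proof.
apply/L2P; split; first exact: cmeasurable_mono.
apply: le_lt_trans (weight_lty n lambda1); rewrite sqintE.
have mB := @measurable_Bnr R n.
apply: ge0_le_integral => //.
- by move=> x _; rewrite lee_fin sqf_ge0.
- by apply/measurable_EFinP; apply: measurable_sqf => //; exact: cmeasurable_mono.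
- by apply/measurable_EFinP; exact: measurable_weightB.
move=> x xB; rewrite lee_fin /sqf ler_piMl//; first exact: weight_ge0.
rewrite exprn_ile1// ?normc_ge0// mono_in// normc_prod.
apply: prodr_ile1 => i _; rewrite normc_ge0 normcX exprn_ile1// ?normc_ge0//; exact: normc_coord.
Qed.

Lemma A2_mono d : A2 (mono d).
Proof. by split; [exact: holomorphic_mono|exact: L2_mono|exact: mono_out]. Qed.

Lemma mono_rotv d (u : nat -> C) z : (forall l, normc (u l) <= 1) ->
  Bn z -> mono d (rotv u z) = (\prod_(l < n) u l ^+ d l) * mono d z.
Proof.
move=> u1 zB.
have zuB : Bn (rotv u z).
  apply: (polydisc_Bn zB) => l; rewrite mxE normcM ler_piMl ?normc_ge0//.
rewrite !mono_in// -big_split; apply: eq_bigr => l _.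
by rewrite mxE exprMn.
Qed.

Lemma mono_homog d i : homog i (d i) (mono d).
Proof.
move=> z u zB u1; rewrite mono_rotv//; last first.
  by move=> l; rewrite /one_at; case: ifP => // _; rewrite normc1.
congr (_ * _); rewrite (bigD1 i)//= big1 ?mulr1 /one_at ?eqxx// => l /negbTE li.
by case: eqP => [/val_inj/eqP|]; rewrite ?li ?expr1n.
Qed.

(** Coordinate of a point of the ball at which no monomial vanishes; all coordinates being 1 / (n +
    1), its squared norm is n / (n + 1)^2 < 1. *)
Definition center_coord : C := n.+1%:R^-1.
Definition center_pt : Cn := \col_i center_coord.

Lemma normc_center_coord : normc center_coord = n.+1%:R^-1.
Proof. by rewrite normcV normc_nat. Qed.

Lemma center_coord_neq0 : center_coord != 0. Proof. by rewrite invr_neq0// pnatr_eq0. Qed.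

Lemma Bn_center_pt : Bn center_pt.
Proof.
rewrite /Bn /= /sqnorm (eq_bigr (fun=> (n.+1%:R^-1) ^+ 2)); last first.
  by move=> i _; rewrite mxE normc_center_coord.
rewrite sumr_const card_ord -[ltLHS]mulr_natl exprVn ltr_pdivrMr ?exprn_gt0// mul1r -natrX ltr_nat.
by rewrite -mulnn mulSn ltn_addr// leqnn.
Qed.

Lemma mono_center_pt d : mono d center_pt != 0.
Proof.
rewrite (mono_in _ Bn_center_pt); apply/prodf_neq0 => i _.
by rewrite mxE expf_neq0// center_coord_neq0.
Qed.

Lemma norm_eq0 f : A2 f -> norm f = 0 -> f = 0.
Proof.
move=> [hf fL f0] nf; apply/funext => z; have [zB|zB] := pselect (Bn z); last exact: f0.
apply: (sqint_eq0 lambda1 fL _ _ zB).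
  by move=> y yB; apply: differentiable_continuous; exact: hf.
by rewrite L2_sqint// nf expr0n.
Qed.

Lemma mono_neq0 d : mono d != 0.
Proof.
apply/eqP => h; have := mono_center_pt d.
by rewrite h eqxx.
Qed.

Lemma norm_mono_gt0 d : 0 < norm (mono d).
Proof.
rewrite lt_def A2norm_ge0 andbT; apply: contra (mono_neq0 d) => /eqP h.
by apply/eqP/norm_eq0 => //; exact: A2_mono.
Qed.

Lemma dot_mono d d' : d != d' -> dot (mono d) (mono d') = 0.
Proof.
move=> dd; have [i di] : exists i, d i != d' i.
  apply/not_existsP => h; case/eqP: dd; apply/funext => i.
  by apply/eqP/negPn/negP; exact: h.
apply: (@dot_coord _ _ _ lambda1 i (d i + d' i).+1 (d i) (d' i)); rewrite ?ltnS ?leq_addr ?leq_addl//.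
- exact: L2_mono.
- exact: L2_mono.
- move=> z; apply: homog_rot; [exact: mono_out|exact: mono_homog|exact: normc_omega].
- move=> z; apply: homog_rot; [exact: mono_out|exact: mono_homog|exact: normc_omega].
Qed.

End Monomials.

(** * Density of the monomials *)

Section Density.
Variables (R : realType) (n : nat) (lambda : R).
Hypothesis lambda1 : -1 < lambda.
Notation C := R[i].
Notation Cn := 'cV[C]_n.
Notation Fun := (Cn -> C^o).
Notation L2 := (@L2 R n lambda).
Notation A2 := (@A2 R n lambda).
Notation dot := (@A2dot R n lambda).
Notation norm := (@A2norm R n lambda).
Implicit Types (f g h : Fun) (a b : C) (i l : 'I_n) (d : 'I_n -> nat).

Lemma homog_rotv f d (u : nat -> C) z : (forall i, homog i (d i) f) ->
  (forall l, normc (u l) <= 1) -> Bn z ->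
  f (rotv u z) = (\prod_(l < n) u l ^+ d l) * f z.
Proof.
move=> hf u1 zB.
(* Only the coordinates listed in s are scaled, so that they can be added one at a time. *)
pose p (s : seq 'I_n) : Cn := \col_l ((if l \in s then u l else 1) * z l 0).
have pB s : Bn (p s).
  apply: (polydisc_Bn zB) => l; rewrite mxE normcM ler_piMl ?normc_ge0//.
  by case: ifP => _ //; rewrite normc1.
have claim s : uniq s -> f (p s) = (\prod_(l <- s) u l ^+ d l) * f z.
  elim: s => [_|i s IH /= /andP[si us]].
    by rewrite big_nil mul1r; congr f; apply/matrixP => l j; rewrite ord1 mxE mul1r.
  rewrite big_cons -mulrA -IH// -hf//; congr f; apply/matrixP => l j.
  rewrite ord1 sclE !mxE in_cons; case: eqP => [->|_] /=; last by rewrite mul1r.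
  by rewrite (negbTE si) mul1r.
rewrite -(claim _ (index_enum_uniq 'I_n)); congr f; apply/matrixP => l j.
by rewrite ord1 !mxE mem_index_enum.
Qed.

Lemma homog_mono f d : (forall z, ~ Bn z -> f z = 0) -> (forall i, homog i (d i) f) ->
  exists c : C, f = c *: mono d.
Proof.
move=> f0 hf; pose t := \prod_(l < n) center_coord R n ^+ d l.
have t0 : t != 0 by apply/prodf_neq0 => l _; rewrite expf_neq0// center_coord_neq0.
exists (t^-1 * f (center_pt R n)); apply/funext => z.
rewrite -[RHS]/(t^-1 * f (center_pt R n) * mono d z).
have [zB|zB] := pselect (Bn z); last by rewrite f0// mono_out// mulr0.
pose u m : C := if insub m is Some i then z (i : 'I_n) 0 else 0.
have uE (l : 'I_n) : u l = z l 0 by rewrite /u valK.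
have E : rotv (fun=> center_coord R n) z = rotv u (center_pt R n).
  by apply/matrixP => l j; rewrite ord1 !mxE uE mulrC.
have dens1 : normc (center_coord R n) <= 1 by rewrite normc_center_coord invf_le1// ler1n.
have h1 := homog_rotv (u := fun=> center_coord R n) hf (fun=> dens1) zB.
have h2 : f (rotv u (center_pt R n)) = (\prod_(l < n) u l ^+ d l) * f (center_pt R n).
  apply: homog_rotv => //; last exact: Bn_center_pt.
  by move=> m; rewrite /u; case: insub => [i|]; rewrite ?normc0//; exact: normc_coord.
rewrite mono_in// (eq_bigr (fun l : 'I_n => u l ^+ d l)); last by move=> l _; rewrite uE.
have : t * f z = (\prod_(l < n) u l ^+ d l) * f (center_pt R n) by rewrite -h1 E h2.
by move=> H; rewrite -mulrA [X in _ * X]mulrC -H mulKf.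
Qed.

(** Squared norms are used so that [normsq_le] applies. *)
Definition approx (W : set Fun) f : Prop := forall e : R, 0 < e ->
  exists g, [/\ W g, L2 g & norm (f - g) ^+ 2 <= e].

Variable W : set Fun.
Hypotheses (sW : lin_subspace W) (monoW : forall d, W (mono d)).

Lemma approx_limit f : L2 f ->
  (forall e : R, 0 < e -> exists g, [/\ approx W g, L2 g & norm (f - g) ^+ 2 <= e]) ->
  approx W f.
Proof.
move=> fL h e e0; have e4 : 0 < e / 4 by lra.
have [g [ag gL fg]] := h _ e4; have [p [Wp pL gp]] := ag _ e4.
exists p; split => //; have -> : f - p = (f - g) + (g - p) by rewrite addrA subrK.
by apply: le_trans (normsq_le lambda1 (L2B lambda1 fL gL) (L2B lambda1 gL pL)) _; lra.
Qed.

Lemma approxD f g : L2 f -> L2 g -> approx W f -> approx W g -> approx W (f + g).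
Proof.
move=> fL gL af ag e e0; have e4 : 0 < e / 4 by lra.
have [p [Wp pL fp]] := af _ e4; have [q [Wq qL gq]] := ag _ e4.
exists (p + q); split.
- by rewrite -[p]scale1r; apply: sW.2.
- exact: L2D.
have -> : f + g - (p + q) = (f - p) + (g - q) by rewrite opprD addrACA.
by apply: le_trans (normsq_le lambda1 (L2B lambda1 fL pL) (L2B lambda1 gL qL)) _; lra.
Qed.

Lemma norm0 : norm 0 = 0.
Proof.
by have := normZ lambda1 0 (L2_0 n lambda); rewrite scale0r normc0 mul0r.
Qed.

Lemma approx_refl f : W f -> L2 f -> approx W f.
Proof. by move=> Wf fL e e0; exists f; rewrite subrr norm0 expr0n ltW. Qed.

(** Induction on the list s of coordinates in which f need not be homogeneous yet:
    [coordinate_series] removes one of them and keeps the homogeneity already gained. *)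
Lemma good_approx (s : seq 'I_n) f : good_fun lambda f ->
  (forall i, i \notin s -> exists k : nat, homog i k f) -> approx W f.
Proof.
elim: s f => [|i s IH] f gf hf.
  have [d hd] := choice (fun i => hf i isT).
  have [f0 fL _] := gf; have [c fE] := homog_mono f0 hd.
  apply: approx_refl => //; rewrite fE; exact: lin_subspaceZ.
have [f0 fL _] := gf; have [G [gG homG presG limG]] := coordinate_series lambda1 i gf.
have GL k : L2 (G k) by case: (gG k).
have aG k : approx W (G k).
  apply: IH => // l ls; have [->|li] := eqVneq l i; first by exists k.
  have [|d hd] := hf l; first by rewrite in_cons negb_or li.
  by exists d; exact: presG.
apply: approx_limit => // e e0; have [D hD] := limG e e0.
exists (\sum_(k < D) G k); split => //; last by apply: L2_sum.
elim: D {hD} => [|D IHD].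
  by rewrite big_ord0; apply: approx_refl; [exact: sW.1|exact: L2_0].
by rewrite big_ord_recr/=; apply: approxD => //; apply: L2_sum.
Qed.

(** W may be any subspace that contains the monomials: below it is the span of the candidates for
    the components, but also an orthogonal complement. *)
Lemma A2_approx f : A2 f -> approx W f.
Proof.
move=> [hf fL f0]; apply: (@good_approx (enum 'I_n)).
  by split => // i; exact: holomorphic_good.
by move=> i; rewrite mem_enum.
Qed.

End Density.

(** * Spans of monomials of given block degree as weight spaces *)

Section Weights.
Variables (R : realType) (n m : nat) (lambda : R) (blk : 'I_n -> 'I_m).
Hypothesis lambda1 : -1 < lambda.
Notation C := R[i].
Notation Cn := 'cV[C]_n.
Notation Fun := (Cn -> C^o).
Notation L2 := (@L2 R n lambda).
Notation A2 := (@A2 R n lambda).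
Notation dot := (@A2dot R n lambda).
Notation norm := (@A2norm R n lambda).
Implicit Types (f g h : Fun) (a b : C) (d : 'I_n -> nat) (kappa : {ffun 'I_m -> nat}).

Lemma A2_subspace : lin_subspace A2.
Proof.
split.
  by split; [move=> z _; exact: differentiable_cst|exact: L2_0|].
move=> a f g [hf fL f0] [hg gL g0]; split.
- by move=> z zB; apply: differentiableD (hg z zB); apply: differentiableZ; exact: hf.
- exact: L2_lin.
- move=> z zB; rewrite -[LHS]/(a * f z + g z) f0// g0// mulr0 addr0//.
Qed.

Lemma A2_L2 f : A2 f -> L2 f. Proof. by case. Qed.

Lemma orth_left_subspace g : L2 g -> lin_subspace [set f | L2 f /\ dot f g = 0].
Proof.
move=> gL; split; first by split; [exact: L2_0|exact: dot0l].
move=> a u v [uL ug] [vL vg]; split; first exact: L2_lin.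
by rewrite dot_linl// ug vg mulr0 addr0.
Qed.

Lemma orth_right_subspace g : L2 g -> lin_subspace [set f | L2 f /\ dot g f = 0].
Proof.
move=> gL; split.
  by split; [exact: L2_0|apply: dot_eq0C => //; [exact: L2_0|exact: dot0l]].
move=> a u v [uL ug] [vL vg]; split; first exact: L2_lin.
by rewrite dotDr// ?dotZr// ?ug ?vg ?mulr0 ?addr0//; exact: L2Z.
Qed.

(** The functions orthogonal to h form a subspace containing the monomials, so h is a limit of such
    g; but |h - g|^2 = |h|^2 + |g|^2 >= |h|^2. *)
Lemma orth_mono_eq0 h : A2 h -> (forall d, dot h (mono d) = 0) -> h = 0.
Proof.
move=> hA hm; have hL := A2_L2 hA; apply: (norm_eq0 lambda1 hA).
apply/eqP; rewrite -sqrf_eq0 eq_le sqr_ge0 andbT; apply/ler_addgt0Pl => e e0.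
have Wm d : [set f | L2 f /\ dot h f = 0] (mono d) by split; [exact: L2_mono|].
have [g [[gL hg] _ hge]] := A2_approx lambda1 (orth_right_subspace hL) Wm hA e0.
rewrite addr0; apply: le_trans hge.
have gL' : L2 (- g) by rewrite -scaleN1r; exact: L2Z.
rewrite pythagoras// ?lerDl ?sqr_ge0//.
by rewrite -scaleN1r dotZr// hg mulr0.
Qed.

(** The block degree for an arbitrary map [blk] from coordinates to blocks, which keeps block
    matrices out of the analysis. *)
Definition wt d : {ffun 'I_m -> nat} := [ffun j => \sum_(i | blk i == j) d i]%N.

Definition wspan kappa : set Fun := lin_span [set mono d | d in [set d | wt d = kappa]].

Lemma wspan_A2 kappa : wspan kappa `<=` A2.
Proof.
apply: lin_span_min; first exact: A2_subspace.
by move=> _ [d _ <-]; exact: A2_mono.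
Qed.

Lemma wspan_L2 kappa f : wspan kappa f -> L2 f.
Proof. by move=> /wspan_A2/A2_L2. Qed.

Lemma wspan_orth_mono kappa f d : wspan kappa f -> wt d <> kappa -> dot f (mono d) = 0.
Proof.
move=> Wf dk; suff [] : L2 f /\ dot f (mono d) = 0 by [].
move: f Wf; apply: lin_span_min; first by apply: orth_left_subspace; exact: L2_mono.
move=> _ [d' d'k <-]; split; first exact: L2_mono.
by apply: dot_mono => //; apply/eqP => E; apply: dk; rewrite -E.
Qed.

Lemma wspan_orth kappa kappa' f g : kappa <> kappa' -> wspan kappa f -> wspan kappa' g ->
  dot f g = 0.
Proof.
move=> kk Wf Wg; have fL := wspan_L2 Wf.
suff [] : L2 g /\ dot f g = 0 by [].
move: g Wg; apply: lin_span_min; first exact: orth_right_subspace.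
move=> _ [d dk <-]; split; first exact: L2_mono.
by apply: (wspan_orth_mono Wf); rewrite dk => E; exact: kk.
Qed.

(** Only finitely many monomials have block degree kappa; subtracting from f its projection onto
    their span leaves a function orthogonal to all monomials. *)
Lemma wspan_of_orth kappa f : A2 f ->
  (forall d, wt d <> kappa -> dot f (mono d) = 0) -> wspan kappa f.
Proof.
move=> fA fo; have fL := A2_L2 fA.
(* Every exponent of a monomial of block degree kappa is at most S, so these monomials are indexed
   by a finite type of functions. *)
pose S := (\sum_j kappa j)%N.
pose D (x : {ffun 'I_n -> 'I_S.+1}) (i : 'I_n) : nat := x i.
have Dinj x y : D x = D y -> x = y.
  by move=> E; apply/ffunP => i; apply: val_inj; exact: (congr1 (fun d => d i) E).
have Dsurj d : wt d = kappa -> exists x, D x = d.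
  move=> dk; exists [ffun i => inord (d i)]; apply/funext => i; rewrite /D ffunE inordK// ltnS.
  apply: (@leq_trans (kappa (blk i))).
    by rewrite -dk ffunE (bigD1 i)//= leq_addr.
  by rewrite /S (bigD1 (blk i))//= leq_addr.
pose co d := dot f (mono d) / (norm (mono d) ^+ 2)%:C%C.
pose p : Fun := \sum_(x | wt (D x) == kappa) co (D x) *: mono (D x).
have Wp : wspan kappa p.
  apply: lin_subspace_sum; first exact: lin_span_subspace.
  move=> x /eqP xk; apply: lin_subspaceZ; first exact: lin_span_subspace.
  by apply: lin_spanS; exists (D x).
suff -> : f = p by [].
have pL := wspan_L2 Wp.
apply/eqP; rewrite -subr_eq0; apply/eqP; apply: orth_mono_eq0.
  rewrite addrC -scaleN1r; apply: A2_subspace.2 => //; exact: wspan_A2 Wp.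
move=> d; have mL := L2_mono lambda1 d; rewrite dotBl//.
have [dk|dk] := pselect (wt d = kappa); last by rewrite fo// (wspan_orth_mono Wp)// subrr.
have [x xd] := Dsurj d dk; apply/eqP; rewrite subr_eq0; apply/eqP.
rewrite /p dot_suml//; last by move=> y _; apply: L2Z => //; exact: L2_mono.
rewrite (bigD1 x) /=; last by rewrite xd dk.
rewrite dotZl// ?big1 ?addr0 ?xd//; last first.
  move=> y /andP[_ yx]; rewrite dotZl//; last exact: L2_mono.
  rewrite dot_mono ?mulr0//; apply: contra yx => /eqP E.
  by apply/eqP/Dinj; rewrite E xd.
rewrite dotff// divfK//; apply/eqP => -[/eqP].
by rewrite sqrf_eq0 gt_eqF// norm_mono_gt0.
Qed.

Lemma wspan_closed kappa : closed_in_A2 lambda (wspan kappa).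
Proof.
move=> f fA h; apply: wspan_of_orth => // d dk; have fL := A2_L2 fA.
have mL := L2_mono lambda1 d; have m0 := norm_mono_gt0 lambda1 d.
apply/eqP; rewrite -normc_eq0 eq_le normc_ge0 andbT; apply/ler_addgt0Pl => e e0.
have em : 0 < e / norm (mono d) by rewrite divr_gt0.
have [g Wg fg] := h _ em; have gL := wspan_L2 Wg.
have -> : dot f (mono d) = dot (f - g) (mono d).
  by rewrite dotBl// (wspan_orth_mono Wg dk) subr0.
have fgL := L2B lambda1 fL gL.
rewrite addr0 -(@ler_pXn2r _ 2)// ?nnegrE ?normc_ge0//; last exact: ltW.
apply: le_trans (bessel1 lambda1 fgL mL) _.
rewrite -exprMn lerXn2r// ?nnegrE ?mulr_ge0 ?A2norm_ge0//; first exact: ltW.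
by rewrite -ler_pdivlMr// ltW.
Qed.

Lemma wspan_dense f : A2 f -> forall e : R, 0 < e ->
  exists2 g, lin_span (\bigcup_kappa wspan kappa) g & norm (f - g) < e.
Proof.
move=> fA e e0; have e2 : 0 < (e / 2) ^+ 2 by rewrite exprn_gt0// divr_gt0.
have mW d : lin_span (\bigcup_kappa wspan kappa) (mono d).
  by apply: lin_spanS; exists (wt d) => //; apply: lin_spanS; exists d.
have [g [Wg _ hg]] := A2_approx lambda1 (lin_span_subspace (\bigcup_kappa wspan kappa)) mW fA e2.
exists g => //; apply: (@le_lt_trans _ _ (e / 2)); last by lra.
by move: hg; rewrite ler_pXn2r// nnegrE ?A2norm_ge0//; lra.
Qed.

Lemma wspan_hilbert_sum : hilbert_direct_sum lambda wspan.
Proof.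
split.
- move=> kappa; split; [exact: lin_span_subspace|exact: wspan_A2|exact: wspan_closed].
- by move=> k1 k2 kk f g; exact: wspan_orth.
- exact: wspan_dense.
Qed.

Definition trot (t : 'I_m -> C) : nat -> C :=
  fun p => if insub p is Some i then t (blk i) else 1.

Lemma trotE t (i : 'I_n) : trot t i = t (blk i). Proof. by rewrite /trot valK. Qed.

Lemma normc_trot t : (forall j, normc (t j) = 1) -> forall p, normc (trot t p) = 1.
Proof. by move=> t1 p; rewrite /trot; case: insub => [i|]; rewrite ?normc1. Qed.

Definition chi kappa (t : 'I_m -> C) : C := \prod_j t j ^+ kappa j.

Lemma mono_trot d t : (forall j, normc (t j) = 1) ->
  rotf (trot t) (mono d) = chi (wt d) t *: mono d.
Proof.
move=> t1; apply/funext => z; rewrite -[RHS]/(chi (wt d) t * mono d z) /rotf.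
have [zB|zB] := pselect (Bn z); last first.
  have zB' : ~ Bn (rotv (trot t) z) by rewrite Bn_rotv//; exact: normc_trot.
  by rewrite !mono_out// mulr0.
rewrite mono_rotv//; last by move=> l; rewrite normc_trot.
congr (_ * _); rewrite /chi (partition_big blk xpredT)//=.
apply: eq_bigr => j _; rewrite ffunE expr_sum//.
by apply: eq_bigr => l /eqP <-; rewrite trotE.
Qed.

Lemma wspan_trot kappa f t : (forall j, normc (t j) = 1) -> wspan kappa f ->
  rotf (trot t) f = chi kappa t *: f.
Proof.
move=> t1; move: f; apply: (@lin_span_min _ _ _ [set f | rotf (trot t) f = chi kappa t *: f]).
  split; first by rewrite /= scaler0.
  move=> a u v /= hu hv.
  rewrite -[LHS]/(a *: rotf (trot t) u + rotf (trot t) v) hu hv scalerDr !scalerA.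
  by rewrite mulrC.
by move=> _ [d <- <-]; exact: mono_trot.
Qed.

Lemma chi_separate kappa kappa' : kappa <> kappa' ->
  exists2 t, (forall j, normc (t j) = 1) & chi kappa t != chi kappa' t.
Proof.
move=> kk; have [j kj] : exists j, kappa j != kappa' j.
  apply/not_existsP => h; apply: kk; apply/ffunP => j.
  by apply/eqP/negPn/negP; exact: h.
(* M exceeds both degrees in the block j, the only one that is rotated, so the two powers of omega
   differ. *)
pose M := (kappa j + kappa' j).+1.
exists (fun l => if l == j then omega R M else 1).
  by move=> l; case: ifP => _; rewrite ?normc1 ?normc_omega.
have E k : chi k (fun l => if l == j then omega R M else 1) = omega R M ^+ k j.
  by rewrite /chi (bigD1 j)//= eqxx big1 ?mulr1// => l /negbTE ->; rewrite expr1n.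
by rewrite !E; apply: omega_inj; rewrite ?ltnS ?leq_addr ?leq_addl.
Qed.

Lemma normc_chi kappa t : (forall j, normc (t j) = 1) -> normc (chi kappa t) = 1.
Proof.
by move=> t1; rewrite /chi normc_prod big1// => j _; rewrite normcX t1 expr1n.
Qed.

Lemma eigen_wspan kappa f : A2 f ->
  (forall t, (forall j, normc (t j) = 1) -> rotf (trot t) f = chi kappa t *: f) ->
  wspan kappa f.
Proof.
move=> fA hf; apply: wspan_of_orth => // d dk.
have [|t t1 tn] := @chi_separate kappa (wt d); first by move=> E; apply: dk.
apply: (dot_eigen lambda1 (normc_trot t1) (A2_L2 fA) (L2_mono lambda1 d) (hf t t1) (mono_trot d t1)).
by apply: mul_conj_neq1 => //; exact: normc_chi.
Qed.

End Weights.

(** * Isotypic components *)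

Section Completeness.
Variable R : realType.
Notation C := R[i].

(** Completeness lets R[i] itself be the Hilbert space of the one-dimensional modules. *)
Lemma complex_cauchy_cvg (F : set_system C) : ProperFilter F -> cauchy F -> cvg F.
Proof.
move=> PF /cauchyP cF.
have part_cvg (p : C -> R) : (forall x y, `|p x - p y| <= normc (x - y)) ->
    exists a : R, forall e : R, 0 < e -> F [set z | `|a - p z| < e].
  move=> hp; have cp : cauchy (p @ F).
    apply: cauchy_exP => e e0; have [|x Fx] := cF e%:C%C; first by rewrite ltcR.
    exists (p x); apply: (@filterS _ F _ (ball x e%:C%C) (p @^-1` ball (p x) e)) Fx => y xy0.
    have xy : normc (x - y) < e by move: xy0; rewrite -ball_normE /= normc_ltc.
    by apply: le_lt_trans xy; exact: hp.
  have /cvg_ex[a pa] : cvg (p @ F) by exact: cauchy_cvg.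
  exists a => e e0; apply: (pa [set y | `|a - y| < e]).
  by apply/nbhs_ballP; exists e.
have hRe (x y : C) : `|complex.Re x - complex.Re y| <= normc (x - y).
  by rewrite -cReN -cReD; exact: normc_Re.
have hIm (x y : C) : `|complex.Im x - complex.Im y| <= normc (x - y).
  by rewrite -cImN -cImD; exact: normc_Im.
have [a ha] := part_cvg (@complex.Re R) hRe.
have [b hb] := part_cvg (@complex.Im R) hIm.
apply/cvg_ex; exists (Complex a b) => A /nbhs_complexP[e e0 hA].
have e2 : 0 < e / 2 by rewrite divr_gt0.
apply: filterS (filterI (ha _ e2) (hb _ e2)) => z [/= h1 h2]; apply: hA.
apply: le_lt_trans (normc_le_ReIm _) _; rewrite cReD cReN cImD cImN /=.
rewrite (distrC _ a) (distrC _ b); lra.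
Qed.

End Completeness.

HB.instance Definition _ (R : realType) :=
  Uniform_isComplete.Build R[i] (@complex_cauchy_cvg R).

(** * The complex numbers as a Hilbert space *)

Section ComplexDot.
Variable R : realType.
Notation C := R[i].

Definition cdot (u v : C) : C := u * v^*.

Lemma cdot_bilinear : bilinear_for (GRing.Scale.Law.clone _ _ *%R _)
  (GRing.Scale.Law.clone _ _ (Num.conj \; *%R) _) cdot.
Proof.
split=> [u' a x y|u a x y]; rewrite /cdot /=.
  by rewrite mulrDl -mulrA.
by rewrite rmorphD rmorphM mulrDr mulrCA.
Qed.

HB.instance Definition _ := bilinear_isBilinear.Build C C C C _ _ cdot cdot_bilinear.

Lemma cdot_hermitian (u v : C) : cdot u v = (-1) ^+ false * (cdot v u)^*.
Proof.
rewrite /cdot expr0 mul1r !conjE; case: u v => [a b] [c e].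
by apply: complex_eq; rewrite ?cReM ?cImM /= ?cReM ?cImM /=; ring.
Qed.

HB.instance Definition _ := isHermitianSesquilinear.Build C C false Num.conj cdot cdot_hermitian.

Lemma cdot_gt0 (u : C) : u != 0 -> 0 < cdot u u.
Proof. by move=> u0; rewrite /cdot -normCK exprn_gt0// normr_gt0. Qed.

HB.instance Definition _ := isDotProduct.Build C C cdot cdot_gt0.

End ComplexDot.

Section ConjContinuous.
Variables (R : realType) (m : nat).
Notation C := R[i].

Lemma conj_continuous : continuous (Num.conj : C^o -> C^o).
Proof.
move=> z A /nbhs_complexP[e e0 hA]; apply/nbhs_complexP; exists e => // w wz; apply: hA.
by rewrite -rmorphB normc_conj.
Qed.

Lemma prod_conj_continuous p (ix : 'I_m -> 'I_p) (e : 'I_m -> nat) :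
  continuous (fun A : 'M[C]_p => \prod_j ((A (ix j) (ix j))^*) ^+ e j : C^o).
Proof.
elim: (index_enum _) => [|j s IH].
  by under eq_fun do rewrite big_nil; exact: cst_continuous.
under eq_fun do rewrite big_cons.
have cj : continuous (fun A : 'M[C]_p => (A (ix j) (ix j))^* : C^o).
  move=> A; apply: (@continuous_comp _ _ _ (fun A : 'M[C]_p => A (ix j) (ix j) : C^o) (Num.conj : C^o -> C^o)).
    exact: coord_continuous.
  exact: conj_continuous.
have cX q : continuous (fun A : 'M[C]_p => ((A (ix j) (ix j))^*) ^+ q : C^o).
  elim: q => [|q IHq]; first by under eq_fun do rewrite expr0; exact: cst_continuous.
  under eq_fun do rewrite exprS.
  move=> A; exact (@continuousM C _ _ _ A (cj A) (IHq A)).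
move=> A; exact (@continuousM C _ _ _ A (cX (e j) A) (IH A)).
Qed.

End ConjContinuous.

(** * The torus, its characters and its one-dimensional modules *)

Section Torus.
Variables (R : realType) (m : nat) (k : 'I_m -> nat).
Hypothesis k_gt0 : forall j, (0 < k j)%N.
Notation C := R[i].
Notation n := (\sum_(j < m) k j)%N.
Notation Cn := 'cV[C]_n.
Notation Fun := (Cn -> C^o).
Implicit Types (t : 'I_m -> C) (kappa : {ffun 'I_m -> nat}).

Definition blk (i : 'I_n) : 'I_m := tagnat.sig1 i.

Definition tmx t : 'M[C]_n := \mxdiag_(j < m) (t j)%:M.

Lemma tmx_mulE t p (B : 'M[C]_(n, p)) i l : (tmx t *m B) i l = t (blk i) * B i l.
Proof.
rewrite -{1}[B]submxcolK mul_mxdiag_mxcol mxE mul_scalar_mx !mxE.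
by rewrite tagnat.sig2K.
Qed.

Lemma tmx_mul t (z : Cn) : tmx t *m z = rotv (trot blk t) z.
Proof. by apply/matrixP => i l; rewrite ord1 tmx_mulE mxE trotE. Qed.

Lemma tmxE t i l : tmx t i l = t (blk i) * (1%:M : 'M[C]_n) i l.
Proof. by rewrite -{1}[tmx t]mulmx1 tmx_mulE. Qed.

Lemma tmx_diag t i : tmx t i i = t (blk i).
Proof. by rewrite tmxE mxE eqxx mulr1. Qed.

Lemma tmxM t t' : tmx t *m tmx t' = tmx (fun j => t j * t' j).
Proof.
by apply/matrixP => i l; rewrite tmx_mulE !tmxE mulrA.
Qed.

Lemma tmx1 : tmx (fun=> 1) = 1%:M.
Proof.
by apply/matrixP => i l; rewrite tmxE mul1r.
Qed.

Lemma torusP A : torus R k A <-> exists2 t, (forall j, normc (t j) = 1) & A = tmx t.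
Proof.
split=> -[t t1 ->]; exists t => // j; last by rewrite -[LHS]/((normc (t j))%:C%C) t1.
exact: (congr1 (@complex.Re R) (t1 j)).
Qed.

Lemma unit_neq0 (u : C) : normc u = 1 -> u != 0.
Proof. by move=> u1; rewrite -normc_eq0 u1 oner_neq0. Qed.

Lemma unit_conj (u : C) : normc u = 1 -> u^* = u^-1.
Proof.
move=> u1; apply: (mulfI (unit_neq0 u1)); rewrite divff ?unit_neq0//.
have : normc u ^+ 2 = 1 by rewrite u1 expr1n.
rewrite normc_sqr conjE; case: u {u1} => x y /= xy.
by apply: complex_eq; rewrite ?cReM ?cImM /=; [rewrite -[RHS]xy|]; ring.
Qed.

Lemma normc_unitV (u : C) : normc u = 1 -> normc u^-1 = 1.
Proof. by move=> u1; rewrite normcV u1 invr1. Qed.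

Lemma pi_tmx t (f : Fun) : (forall j, normc (t j) = 1) ->
  pi_ (tmx t) f = rotf (trot blk (fun j => (t j)^-1)) f.
Proof.
move=> t1; apply/funext => z; rewrite /pi_ /rotf -tmx_mul; congr (f (_ *m z)).
have tt : tmx t *m tmx (fun j => (t j)^-1) = 1%:M.
  rewrite tmxM -tmx1; congr tmx; apply/funext => j.
  by rewrite divff// unit_neq0.
have [tu _] := mulmx1_unit tt.
by rewrite -[LHS]mulmx1 -tt mulKmx.
Qed.

Lemma block_degree_wt (alpha : 'cV[nat]_n) j :
  block_degree alpha j = wt blk (fun i => alpha i 0) j.
Proof.
rewrite ffunE (reindex (@tagnat.rank m k)) /=; last exact: onW_bij (@tagnat.rank_bij m k).
transitivity (\sum_(i < m | i == j) \sum_(l < k i) alpha (tagnat.Rank i l) ord0)%N.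
  by rewrite big_pred1_eq; apply: eq_bigr => l _; rewrite mxE.
rewrite sig_big_dep /=; apply: eq_big => p; last by rewrite tagnat.rankE.
by rewrite /blk tagnat.rankE tagnat.Rank1K andbT.
Qed.

Lemma calP_wspan kappa : calP R k kappa = wspan (R := R) blk kappa.
Proof.
congr lin_span; apply/seteqP; split=> _ [d dk <-].
  exists (fun i => d i 0) => //; apply/ffunP => j.
  by rewrite -block_degree_wt; exact: dk.
exists (\col_i d i).
  by move=> j; rewrite block_degree_wt -dk; congr (wt blk _ j); apply/funext => i; rewrite mxE.
apply/funext => z; rewrite /monomial /mono; congr (patch _ _ _ z).
by apply/funext => y; apply: eq_bigr => i _; rewrite mxE.
Qed.

Definition blk0 j : 'I_n := tagnat.Rank j (Ordinal (k_gt0 j)).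

Lemma blk0K j : blk (blk0 j) = j. Proof. exact: tagnat.Rank1K. Qed.

(** The character t^(-kappa) as a function of the matrix: t_j is read off a diagonal entry of the
    block j, which exists as k_j > 0, and its inverse is written as a conjugate. In this form it is
    continuous on all matrices. *)
Definition chiA kappa (A : 'M[C]_n) : C :=
  \prod_j ((A (blk0 j) (blk0 j))^*) ^+ kappa j.

Lemma chiA_tmx kappa t : (forall j, normc (t j) = 1) ->
  chiA kappa (tmx t) = chi kappa (fun j => (t j)^-1).
Proof.
by move=> t1; apply: eq_bigr => j _; rewrite tmx_diag blk0K unit_conj.
Qed.

Lemma chiM kappa t t' : chi kappa (fun j => t j * t' j) = chi kappa t * chi kappa t'.
Proof. by rewrite /chi -big_split; apply: eq_bigr => j _; rewrite exprMn. Qed.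

Lemma pi_wspan kappa f A : torus R k A -> wspan (R := R) blk kappa f ->
  pi_ A f = chiA kappa A *: f.
Proof.
move=> /torusP[t t1 ->] Wf; rewrite pi_tmx// chiA_tmx//.
by apply: wspan_trot => // j; exact: normc_unitV.
Qed.

Lemma wspan_neq0 kappa : exists d : 'I_n -> nat, wt blk d = kappa.
Proof.
exists (fun i => if i == blk0 (blk i) then kappa (blk i) else 0%N).
apply/ffunP => j; rewrite ffunE (bigD1 (blk0 j)) ?blk0K//= eqxx big1 ?addn0// => i /andP[/eqP <-].
by move=> /negbTE ->.
Qed.

Lemma chiA_continuous kappa : continuous (chiA kappa : 'M[C]_n -> C^o).
Proof. exact: prod_conj_continuous. Qed.

Lemma chi_act_linear kappa A : torus R k A -> linear (fun v : C => chiA kappa A * v : C).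
Proof. by move=> _ a u v; rewrite mulrDr mulrCA. Qed.

Lemma chiA1 kappa (v : C) : chiA kappa 1%:M * v = v.
Proof.
rewrite -tmx1 chiA_tmx; last by move=> j; rewrite normc1.
by rewrite /chi big1 ?mul1r// => j _; rewrite invr1 expr1n.
Qed.

Lemma chiAM kappa A B (v : C) : torus R k A -> torus R k B ->
  chiA kappa (A *m B) * v = chiA kappa A * (chiA kappa B * v).
Proof.
move=> /torusP[t t1 ->] /torusP[t' t'1 ->].
rewrite tmxM !chiA_tmx//; last by move=> j; rewrite normcM t1 t'1 mul1r.
rewrite mulrA -chiM; congr (_ * _); congr chi; apply/funext => j.
by rewrite invfM.
Qed.

Lemma normc_chiA kappa A : torus R k A -> normc (chiA kappa A) = 1.
Proof.
move=> /torusP[t t1 ->]; rewrite chiA_tmx// normc_chi// => j; exact: normc_unitV.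
Qed.

Lemma chi_unitary kappa A (u v : C) : torus R k A ->
  cdot (chiA kappa A * u) (chiA kappa A * v) = cdot u v.
Proof.
move=> HA; rewrite /cdot conjcM mulrACA unit_conj ?normc_chiA// divff ?mul1r//.
by rewrite unit_neq0// normc_chiA.
Qed.

Lemma chi_act_continuous kappa (v : C) :
  {within torus R k, continuous (fun A => chiA kappa A * v : C)}.
Proof.
apply: continuous_subspaceT => A.
exact (@continuousM C _ _ _ A (@chiA_continuous kappa A) (@cst_continuous _ _ (v : C^o) A)).
Qed.

Lemma cdotE (v : C) : `|v| ^+ 2 = cdot v v.
Proof. exact: normCK. Qed.

Definition chi_module kappa : hmodule (torus R k) :=
  @HModule R n (torus R k) R[i] (@cdot R) cdotE (fun A v => chiA kappa A * v)
    (@chi_act_linear kappa) (@chiA1 kappa) (@chiAM kappa)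
    (fun A u v HA => @chi_unitary kappa A u v HA) (@chi_act_continuous kappa).

Lemma chi_module_irreducible kappa : irreducible_hmodule (chi_module kappa).
Proof.
split; first by exists (1 : C); exact: oner_neq0.
move=> E [E0 ED] _ _; have [[e Ee e0]|h] := pselect (exists2 e, E e & e != 0).
  right; apply/seteqP; split=> // v _.
  have := ED (v / e : C) e 0 Ee E0; rewrite addr0.
  by rewrite -[_ *: _]/((v : C) / e * e) divfK.
left; apply/seteqP; split=> v; last by move=> ->.
move=> Ev; apply/eqP/negPn/negP => v0; apply: h; by exists v.
Qed.

End Torus.

(** * Identification of the isotypic components *)

Section IsotypicComponents.
Variables (R : realType) (m : nat) (k : 'I_m -> nat) (lambda : R).
Hypotheses (k_gt0 : forall j, (0 < k j)%N) (lambda1 : -1 < lambda).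
Notation C := R[i].
Notation n := (\sum_(j < m) k j)%N.
Notation Cn := 'cV[C]_n.
Notation Fun := (Cn -> C^o).
Notation H := (torus R k).
Notation A2 := (A2 lambda : set Fun).
Notation dot := (@A2dot R n lambda).
Notation norm := (@A2norm R n lambda).
Notation wspan := (wspan (R := R) (@blk m k)).
Notation chiA := (@chiA R m k k_gt0).
Implicit Types (t : 'I_m -> C) (kappa : {ffun 'I_m -> nat}) (f g : Fun) (V : hmodule H).

Definition line f : set Fun := [set c *: f | c in [set: C]].

Lemma line_submodule kappa f : f != 0 -> wspan kappa f -> submodule lambda H (line f).
Proof.
move=> f0 Wf; have fA : A2 f := wspan_A2 lambda1 Wf; have fL := A2_L2 fA.
have nf : 0 < norm f.
  rewrite lt_def A2norm_ge0 andbT; apply: contra f0 => /eqP h.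
  by apply/eqP/(norm_eq0 lambda1).
have sA := @A2_subspace R n lambda lambda1.
split.
- split; first by exists 0; rewrite ?scale0r.
  move=> a _ _ [c _ <-] [c' _ <-]; exists (a * c + c') => //.
  by rewrite scalerDl scalerA.
- by move=> _ [c _ <-]; exact: lin_subspaceZ.
- move=> g gA hg; have gL := A2_L2 gA.
  (* Coefficient of the orthogonal projection of g onto the line; by Pythagoras no other point of
     the line is closer to g. *)
  pose a := dot g f / (norm f ^+ 2)%:C%C.
  have aL := L2Z lambda1 a fL.
  suff E : g - a *: f = 0 by exists a => //; apply/esym/eqP; rewrite -subr_eq0 E.
  have qA : A2 (g - a *: f) by rewrite addrC -scaleNr; exact: sA.2.
  have qf : dot (g - a *: f) f = 0.
    rewrite dotBl// dotZl// dotff// /a divfK ?subrr//; apply/eqP => -[/eqP].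
    by rewrite sqrf_eq0 gt_eqF.
  apply: (norm_eq0 lambda1 qA); apply/eqP; rewrite eq_le A2norm_ge0 andbT.
  apply/ler_addgt0Pl => e e0; rewrite addr0; have [_ [c _ <-] ce] := hg e e0.
  apply: ltW; apply: le_lt_trans ce.
  rewrite -(@ler_pXn2r _ 2)// ?nnegrE ?A2norm_ge0//.
  have -> : g - c *: f = (g - a *: f) + (a - c) *: f by rewrite scalerBl addrA subrK.
  have qL := A2_L2 qA; have acL := L2Z lambda1 (a - c) fL.
  by rewrite [leRHS](pythagoras lambda1 qL acL) ?lerDl ?sqr_ge0// dotZr// qf mulr0.
- move=> A _ HA [c _ <-]; exists (c * chiA kappa A) => //.
  by rewrite -scalerA -(pi_wspan k_gt0 HA Wf).
Qed.

Lemma line_isomorphic V kappa f (v0 : V) : f != 0 -> wspan kappa f ->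
  v0 != 0 -> (forall v : V, exists c : C, v = c *: v0) ->
  (forall A (v : V), H A -> hact A v = chiA kappa A *: v) ->
  isomorphic lambda V (line f).
Proof.
move=> f0 Wf v00 span char; have fA : A2 f := wspan_A2 lambda1 Wf; have fL := A2_L2 fA.
have nf : 0 < norm f.
  rewrite lt_def A2norm_ge0 andbT; apply: contra f0 => /eqP h.
  by apply/eqP/(norm_eq0 lambda1).
have [co hco] := choice span.
have co_eq x y : x *: v0 = y *: v0 -> x = y.
  move=> /eqP; rewrite -subr_eq0 -scalerBl scaler_eq0 (negbTE v00) orbF subr_eq0.
  by move=> /eqP.
have coZ c : co (c *: v0) = c by apply: co_eq; rewrite -hco.
pose phi v : Fun := co v *: f.
have lphi : linear phi.
  move=> a u v; rewrite /phi scalerA -scalerDl; congr (_ *: _); apply: co_eq.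
  by rewrite -hco scalerDl -scalerA -!hco.
pose Phi : {linear V -> Fun} := HB.pack phi (GRing.isLinear.Build _ _ _ _ phi lphi).
have PhiE v : Phi v = co v *: f by [].
exists Phi; split.
- move=> u v; rewrite !PhiE => /eqP; rewrite -subr_eq0 -scalerBl scaler_eq0 (negbTE f0) orbF.
  by rewrite subr_eq0 => /eqP uv; rewrite (hco u) uv -hco.
- apply/seteqP; split=> [_ [v _ <-]|_ [c _ <-]]; first by exists (co v).
  by exists (c *: v0) => //; rewrite PhiE coZ.
- move=> A v HA; rewrite !PhiE char//.
  have -> : pi_ A (co v *: f) = co v *: pi_ A f by [].
  rewrite (pi_wspan k_gt0 HA Wf) scalerA mulrC; congr (_ *: _); apply: co_eq.
  by rewrite -hco -scalerA -hco.
(* [phi] is a multiple of an isometry, so both constants of the equivalence of norms are norm f / r,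
   with r the norm of v0. *)
have /posC[r r0 v0r] : 0 < `|v0| by rewrite normr_gt0.
have nfr : 0 < norm f / r by rewrite divr_gt0.
have E v : (norm f / r)%:C%C * `|v| = (norm (Phi v))%:C%C.
  rewrite {1}(hco v) normrZ v0r PhiE normZ//.
  rewrite -[`|co v|]/((normc (co v))%:C%C) -!rmorphM; congr (_%:C%C).
  by rewrite mulrCA divfK ?gt_eqF.
by exists (norm f / r), (norm f / r); split => // v; rewrite E lexx.
Qed.

(** Every element of a copy of V is an eigenvector with the character of kappa, hence lies in
    [wspan]; conversely each monomial of block degree kappa spans a copy of V. *)
Lemma isotypic_character V kappa (v0 : V) :
  v0 != 0 -> (forall v : V, exists c : C, v = c *: v0) ->
  (forall A (v : V), H A -> hact A v = chiA kappa A *: v) ->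
  isotypic lambda V = wspan kappa.
Proof.
move=> v00 span char; apply/seteqP; split.
  apply: lin_span_min; first exact: lin_span_subspace.
  move=> w [W [[_ WA _ _] [phi [_ rphi ephi _]]] Ww].
  apply: (eigen_wspan lambda1 (WA _ Ww)) => t t1.
  have [v _ wE] : range phi w by rewrite rphi.
  (* The inverses are taken because [pi_] composes with the inverse matrix. *)
  pose s j := (t j)^-1; have s1 j : normc (s j) = 1 by exact: normc_unitV.
  have sV : (fun j => (s j)^-1) = t by apply/funext => j; rewrite /s invrK.
  have HA : H (tmx k s) by apply/torusP; exists s.
  have := ephi _ v HA; rewrite char// linearZ /= wE pi_tmx// sV => <-.
  by rewrite chiA_tmx// sV.
apply: lin_span_le => _ [d dk <-].
have Wd : wspan kappa (mono d) by apply: lin_spanS; exists d.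
exists (line (mono d)); last by exists 1; rewrite ?scale1r.
split; first by apply: line_submodule Wd; exact: mono_neq0.
by apply: line_isomorphic Wd v00 span char; exact: mono_neq0.
Qed.

Lemma irreducible_character V : irreducible_hmodule V -> isotypic lambda V <> [set 0] ->
  exists kappa, isotypic lambda V = wspan kappa.
Proof.
move=> [[v0 v00] irr] iso0.
have [W [sW [phi [iphi rphi ephi [a [b [a0 b0 hab]]]]]]] :
    exists W, submodule lambda H W /\ isomorphic lambda V W.
  apply: contrapT => h; apply: iso0; apply/seteqP; split; last first.
    by move=> _ ->; exact: (lin_span_subspace _).1.
  apply: lin_span_min.
    by split=> // c u v -> ->; rewrite /= scaler0 addr0.
  by move=> w [W [? ?] _]; exfalso; apply: h; exists W.
have phiA v : A2 (phi v) by case: sW => _ WA _ _; apply: WA; rewrite -rphi; exists v.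
have phiL v := A2_L2 (phiA v).
have [d hd] : exists d, dot (phi v0) (mono d) != 0.
  apply/not_existsP => h; case/eqP: v00; apply: iphi; rewrite linear0.
  apply: (orth_mono_eq0 lambda1 (phiA v0)) => d.
  by apply/eqP/negPn/negP; exact: h.
have mL := @L2_mono R n lambda lambda1 d.
have m0 := @norm_mono_gt0 R n lambda lambda1 d.
pose l v := dot (phi v) (mono d).
have lP c u v : l (c *: u + v) = c * l u + l v by rewrite /l linearP dot_linl.
have l0 : l 0 = 0 by rewrite /l linear0 dot0l.
have hl A v : H A -> l (hact A v) = chiA (wt (@blk m k) d) A * l v.
  move=> HA; rewrite /l ephi//; have /torusP[t t1 AE] := HA.
  pose s j := (t j)^-1; have s1 j : normc (s j) = 1 by exact: normc_unitV.
  have c1 := normc_trot (@blk m k) s1.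
  (* On the right both arguments are rotated by unitarity; the monomial then contributes the
     conjugate character, which cancels the factor in front. *)
  rewrite AE pi_tmx// chiA_tmx// -/s -(dot_rotf lambda1 c1 (phiL v) mL).
  have rL := L2_rotf lambda1 c1 (phiL v).
  rewrite mono_trot// dotZr// mulrA unit_conj ?normc_chi// divff ?mul1r//.
  by rewrite unit_neq0// normc_chi.
have ker0 u : l u = 0 -> u = 0.
  have [|||E|E] := irr [set u | l u = 0].
  - by split=> // c u' v /= hu hv; rewrite lP hu hv mulr0 addr0.
  (* The kernel is closed since l is continuous, by Cauchy-Schwarz and the upper bound b on [phi];
     the radius below makes the resulting estimate equal to e. *)
  - move=> u' clu; suff lu e : 0 < e -> normc (l u') <= e.
      apply/eqP; rewrite -normc_eq0 eq_le normc_ge0 andbT.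
      by move: (normc _) lu => x hx; apply/ler_addgt0Pl => e /hx; rewrite addr0.
    move=> e0.
    have e1 : 0 < e / (b * norm (mono d)) by rewrite divr_gt0// mulr_gt0.
    have [|w [/= lw uw]] := clu (ball u' (e / (b * norm (mono d)))%:C%C).
      by apply: nbhsx_ballx; rewrite ltcR.
    have E : l u' = l (u' - w).
      by rewrite -[u' - w]addrC -scaleN1r lP lw mulr0 add0r.
    have hn : norm (phi (u' - w)) <= b * (e / (b * norm (mono d))).
      rewrite -lecR; have /andP[_ h2] := hab (u' - w); apply: le_trans h2 _.
      rewrite rmorphM ler_pM2l ?ltcR//; apply: ltW.
      by move: uw; rewrite -ball_normE.
    suff lw' : normc (l (u' - w)) <= e.
      exact (eq_ind_r (fun x : C => normc x <= e) lw' E).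
    have l2 : normc (l (u' - w)) ^+ 2 <= norm (phi (u' - w)) ^+ 2 * norm (mono d) ^+ 2.
      exact: bessel1.
    have n2 : norm (phi (u' - w)) * norm (mono d) <= e.
      apply: (@le_trans _ _ (b * (e / (b * norm (mono d))) * norm (mono d))).
        by rewrite ler_pM2r.
      by rewrite mulrAC mulrC divfK// gt_eqF// mulr_gt0.
    move: l2; rewrite -exprMn; move: (normc _) (normc_ge0 (l (u' - w))) => x x0 xn.
    apply: le_trans n2; move: xn; rewrite ler_pXn2r// nnegrE.
    by rewrite mulr_ge0// ?A2norm_ge0// ltW.
  - by move=> A v HA /= lv; rewrite hl// lv mulr0.
  - by move=> lu; have : [set u | l u = 0] u by []; rewrite E.
  - by move: hd; rewrite -/(l v0); have : [set u | l u = 0] v0 by [rewrite E]; move=> /= ->; rewrite eqxx.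
(* As l is injective, identities in V may be tested on their values under l; both that v0 spans V
   and the formula for the action follow. *)
exists (wt (@blk m k) d); apply: (@isotypic_character V _ v0) => //.
  move=> v; exists (l v / l v0); apply/eqP; rewrite eq_sym -subr_eq0; apply/eqP/ker0.
  by rewrite -scaleN1r addrC -[_ *: v0]addr0 !lP l0 addr0 divfK// mulN1r addNr.
move=> A v HA; apply/eqP; rewrite -subr_eq0 addrC -scaleNr; apply/eqP/ker0.
by rewrite lP hl// mulNr addNr.
Qed.

Lemma wspan_nonzero kappa : wspan kappa <> [set 0].
Proof.
move=> E; have [d dk] := wspan_neq0 k_gt0 kappa.
have : wspan kappa (mono d) by apply: lin_spanS; exists d.
by rewrite E => /= /eqP; apply/negP; exact: mono_neq0.
Qed.

Lemma wspan_inj kappa kappa' : wspan kappa = wspan kappa' -> kappa = kappa'.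
Proof.
move=> E; apply: contrapT => kk; have [d dk] := wspan_neq0 k_gt0 kappa.
have Wd : wspan kappa (mono d) by apply: lin_spanS; exists d.
have Wd' : wspan kappa' (mono d) by rewrite -E.
have := wspan_orth lambda1 kk Wd Wd'; rewrite dotff//; last exact: L2_mono.
move=> -[/eqP]; rewrite sqrf_eq0 gt_eqF//; exact: norm_mono_gt0.
Qed.

Lemma wspan_isotypic kappa : wspan kappa = isotypic lambda (chi_module R k_gt0 kappa).
Proof.
apply/esym; apply: (@isotypic_character (chi_module R k_gt0 kappa) kappa (1 : C)).
- exact: oner_neq0.
- by move=> v; exists (v : C); rewrite -[RHS]/((v : C) * 1) mulr1.
- by [].
Qed.

End IsotypicComponents.

Theorem proposition4p7 (R : realType) (m : nat) (k : 'I_m -> nat)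
    (k_gt0 : forall j, (0 < k j)%N) (lambda : R) (lambda_gtN1 : -1 < lambda) :
  isotypic_decomposition lambda (torus R k)
    (fun kappa : {ffun 'I_m -> nat} => calP R k kappa).
Proof.
have -> : (fun kappa => calP R k kappa) = wspan (R := R) (@blk m k).
  by apply/funext => kappa; exact: calP_wspan.
split.
- exact: wspan_hilbert_sum.
- move=> kappa; split; first exact: wspan_nonzero.
  exists (chi_module R k_gt0 kappa); first exact: chi_module_irreducible.
  exact: wspan_isotypic.
move=> V irr iso0; have [kappa E] := irreducible_character k_gt0 lambda_gtN1 irr iso0.
exists kappa; split; first by rewrite E.
by move=> kappa' E'; apply: (wspan_inj k_gt0 lambda_gtN1); rewrite -E E'.
Qed.
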